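(* Let $n\ge2$, $p>0$, and let $\mu$ be a measure on $\mathbb{R}^n$ with a continuous density $g$ that is $p$-concave and $\frac1p$-homogeneous. Let $K$ be an origin-symmetric convex body and $L$ a star body in $\mathbb{R}^n$, and let $\varepsilon\ge0$ be such that $$P_{\mu,K}(\theta)\le\mu_{n-1}(L\cap\theta^\perp)+\varepsilon\qquad\text{for all }\theta\in S^{n-1}.$$ Setting $q=\frac{1}{n+\frac1p}$, we have $$\mu(K)^{1-q}\le\left(\frac{1-\frac1n}{1-q}\right)\mu(L)^{1-q}+\frac{\omega_n}{\mu(B_2^n)^q\,\omega_{n-1}}\,\varepsilon.$$
   Context: A function $f\ge0$ is $p$-concave ($p\neq0$) if $f(\lambda x+(1-\lambda)y)\ge(\lambda f(x)^p+(1-\lambda)f(y)^p)^{1/p}$ for all $\lambda\in[0,1]$ and $x,y$ in the support of $f$; it is $s$-homogeneous if $f(ax)=a^sf(x)$ for all $a>0$, $x\in\mathbb{R}^n$. A star body is a compact set $L$ such that $x\in L$ implies $[0,x)\subseteq\operatorname{int}L$. $\omega_k$ is the volume of the $k$-dimensional Euclidean unit ball, $B_2^n$ the unit ball. Mixed $\mu$-measure: $\mu_1(A,B)=\liminf_{\varepsilon\to0}\frac{\mu(A+\varepsilon B)-\mu(A)}{\varepsilon}$. $\mu$-projection: $P_{\mu,K}(\theta)=\frac n2\int_0^1\mu_1(tK,[-\theta,\theta])\,dt$. For $A\subseteq\theta^\perp$, $\mu_{n-1}(A)=\int_A g\,d\lambda_{n-1}$ with $\lambda_{n-1}$ Lebesgue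 measure on $\theta^\perp$. *)

(* Defs.v *)
From HB Require Import structures.
From mathcomp Require Import all_boot all_order all_algebra.
From mathcomp Require Import all_classical all_reals all_analysis.
Set Implicit Arguments. Unset Strict Implicit. Unset Printing Implicit Defensive.
Import Order.TTheory GRing.Theory Num.Theory.
Import numFieldNormedType.Exports.
Local Open Scope classical_set_scope.
Local Open Scope ring_scope.

Section Defs.
Variable R : realType.

Definition sqnorm (n : nat) (x : 'rV[R]_n) : R := (x *m x^T) ord0 ord0.

Definition ball2 (n : nat) : set 'rV[R]_n := [set x | sqnorm x <= 1].

(* Integral of a function over R^k w.r.t. k-dimensional Lebesgue measure,
   defined as the iterated (Tonelli) integral of one-dimensional Lebesgue
   integrals; used only for nonnegative integrands. *)
Fixpoint lebint (k : nat) : ('rV[R]_k -> \bar R) -> \bar R :=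
  match k return ('rV[R]_k -> \bar R) -> \bar R with
  | 0 => fun f => f 0
  | k'.+1 => fun f =>
      (\int[@lebesgue_measure R]_(x in [set: R]) (fun x : R =>
         lebint (fun y : 'rV[R]_k' =>
           f (\row_(i < k'.+1) match unlift ord0 i with
                               | Some j => y ord0 j | None => x end))) x)%E
  end.

Definition leb (k : nat) (A : set 'rV[R]_k) : \bar R :=
  lebint (fun x => (\1_A x)%:E).

Definition omega (k : nat) : R := fine (leb (@ball2 k)).

Definition dmeas (n : nat) (g : 'rV[R]_n -> R) (A : set 'rV[R]_n) : \bar R :=
  lebint (fun x => (\1_A x * g x)%:E).

Definition msum (n : nat) (A B : set 'rV[R]_n) : set 'rV[R]_n :=
  [set a + b | a in A & b in B].
Definition dil (n : nat) (t : R) (A : set 'rV[R]_n) : set 'rV[R]_n :=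
  [set t *: a | a in A].

Definition seg (n : nat) (th : 'rV[R]_n) : set 'rV[R]_n :=
  [set t *: th | t in [set t : R | -1 <= t <= 1]].

(* mixed mu-measure: mu_1(A,B) = liminf_{e -> 0+} (mu(A + eB) - mu(A))/e *)
Definition mixed1 (n : nat) (g : 'rV[R]_n -> R) (A B : set 'rV[R]_n) : \bar R :=
  ereal_sup [set ereal_inf
     [set ((dmeas g (msum A (dil e B)) - dmeas g A) * (e^-1)%:E)%E
       | e in [set e : R | 0 < e < d]]
    | d in [set d : R | 0 < d]].

Definition muproj (n : nat) (g : 'rV[R]_n -> R) (K : set 'rV[R]_n) (th : 'rV[R]_n)
  : \bar R :=
  ((n%:R / 2)%:E *
   \int[@lebesgue_measure R]_(t in [set t : R | (0 <= t <= 1)%R])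
      mixed1 g (dil t K) (seg th))%E.

Definition orth_last (n : nat) (th : 'rV[R]_n) (U : 'M[R]_n) : Prop :=
  U *m U^T = 1%:M /\ forall j : 'I_n, val j = n.-1 -> row j U = th.

(* isometric parametrization of th^perp by R^(n-1):
   y |-> (y, 0) U, where U is an orthogonal matrix with last row th *)
Definition perp_param (n : nat) (th : 'rV[R]_n) (y : 'rV[R]_n.-1) : 'rV[R]_n :=
  (\row_(i < n) (match (insub (val i) : option 'I_n.-1) with
                   | Some j => y ord0 j | None => 0 end))
    *m xget 1%:M [set U | orth_last th U].

Definition hypmeas (n : nat) (g : 'rV[R]_n -> R) (L : set 'rV[R]_n) (th : 'rV[R]_n)
  : \bar R :=
  lebint (fun y : 'rV[R]_n.-1 =>
    (\1_L (perp_param th y) * g (perp_param th y))%:E).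

Definition convex_body (n : nat) (K : set 'rV[R]_n) : Prop :=
  compact K /\ (exists x, (K°) x) /\
  forall x y l, K x -> K y -> 0 <= l <= 1 -> K (l *: x + (1 - l) *: y).

Definition origin_symmetric (n : nat) (K : set 'rV[R]_n) : Prop :=
  forall x, K x -> K (- x).

Definition star_body (n : nat) (L : set 'rV[R]_n) : Prop :=
  compact L /\
  forall x, L x -> forall t : R, 0 <= t < 1 -> (L°) (t *: x).

Definition pconcave (n : nat) (p : R) (g : 'rV[R]_n -> R) : Prop :=
  forall (l : R) (x y : 'rV[R]_n), 0 <= l <= 1 -> 0 < g x -> 0 < g y ->
    powR (l * powR (g x) p + (1 - l) * powR (g y) p) (p^-1)
      <= g (l *: x + (1 - l) *: y).

Definition homogeneous (n : nat) (s : R) (g : 'rV[R]_n -> R) : Prop :=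
  forall (a : R) (x : 'rV[R]_n), 0 < a -> g (a *: x) = powR a s * g x.

End Defs.

(* Main.v *)
(** Let [r = n + 1/p], [q = 1/r] and let [B] be the unit ball.  The hypothesis at
    [th/|th|] is integrated over [th] in [B] with weight [1/|th|], which replaces
    polar coordinates on the sphere.

    Sections.  The averages of [g] over [L] intersected with the slabs
    [|<x,th>| <= 1/j] dominate [mu_(n-1)(L \cap th^\perp)/|th|] as [j] grows, so
    Fatou bounds the integrated sections by [omega_(n-1)] times the [g]-integral
    of [1/|x|] over [L].  By homogeneity of [g] and comparison with a centred
    ball, that integral is at most [mu(L)^(1-q) mu(B)^q / (1-q)].

    Projections.  Let [u] be [1_K] convolved with a bump of mass [kappa].  The
    first variation of [mu] at [K] along a segment [[-th,th]] is, up to an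
    arbitrarily small error, at least the [g]-integral of [|<grad u,th>| / kappa];
    homogeneity turns the integral over [t] in the definition of the projection
    into the factor [q].  Integrating over [th] gives the [g]-integral of
    [|grad u|], which is bounded below by [kappa r mu(K)^(1-q) mu(B)^q]: apply
    the Brunn-Minkowski inequality of [mu] (Borell-Brascamp-Lieb) to the
    superlevel sets of [u] and integrate over the levels. *)
Require Import Defs.
From HB Require Import structures.
From mathcomp Require Import all_boot all_order all_algebra.
From mathcomp Require Import all_classical all_reals all_analysis.
From mathcomp Require Import measurable_realfun.
From mathcomp Require Import ring lra.
Set Implicit Arguments. Unset Strict Implicit. Unset Printing Implicit Defensive.
Import Order.TTheory GRing.Theory Num.Theory.
Import numFieldNormedType.Exports.
Local Open Scope classical_set_scope.
Local Open Scope ring_scope.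

(** * Lebesgue measure on row vectors *)

(** A surface measure on the boundary of [K] is avoided: the gradient of [u] has an explicit
    quadratic Taylor remainder, so increments of [u] are compared with those of the indicator of [K]
    at a fixed small step [e]. The delicate point is that every error must survive division by [e].
    Because [K] contains a ball about the origin, [K] and its translate by a vector of length [e]
    differ by a set of volume O(e); moving the argument of [g] by a small vector therefore costs O(w
    e), where [w] is a modulus of continuity of [g]. The bump radius is chosen after [w], and
    [kappa] cancels in the end.

    Constants, in dimension n: the integral of |<v,th>| / |th|^2 over [B] is 2 omega_(n-1) |v| /
    (n-1), that of 1/|th| is n omega_n / (n-1), and the projection contributes n q / 2. Since r q =
    1, division of the integrated inequality by n omega_(n-1) mu(B)^q / (n-1) gives the stated
    coefficients.

    Two parameters below 1 deal with boundaries: a factor [rho] shrinks [K] to a set where [u] is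
    maximal, and a factor [t0] moves points of [L] into its interior. Both tend to 1 only in the
    final inequality between real numbers. *)

Definition rV_display : measure_display. Proof. exact: default_measure_display. Qed.

Section rV_measurable.
Variables (R : realType) (k : nat).

Let coors : 'I_k -> 'rV[R]_k -> R := fun i x => x ord0 i.

Let rV_set0 : g_sigma_preimage coors set0.
Proof. exact: sigma_algebra0. Qed.

Let rV_setC A : g_sigma_preimage coors A -> g_sigma_preimage coors (~` A).
Proof. exact: sigma_algebraC. Qed.

Let rV_bigcup (F : _^nat) : (forall i, g_sigma_preimage coors (F i)) ->
  g_sigma_preimage coors (\bigcup_i (F i)).
Proof. exact: sigma_algebra_bigcup. Qed.

HB.instance Definition _ := @isMeasurable.Build rV_display
  'rV[R]_k (g_sigma_preimage coors) rV_set0 rV_setC rV_bigcup.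

Lemma measurable_coord (i : 'I_k) :
  measurable_fun [set: 'rV[R]_k] (fun x : 'rV[R]_k => x ord0 i).
Proof.
move=> _ Y mY; rewrite setTI; apply: sub_sigma_algebra => /=.
rewrite -bigcup_seq/=; exists i => /=; first by rewrite mem_index_enum.
by exists Y => //; rewrite setTI.
Qed.

Lemma measurable_fun_rVP d (T : measurableType d) (f : T -> 'rV[R]_k) :
  (forall i, measurable_fun [set: T] (fun t => f t ord0 i)) ->
  measurable_fun [set: T] f.
Proof.
move=> mf.
have H : preimage_set_system [set: T] f measurable `<=` measurable.
  rewrite [X in preimage_set_system _ _ X](_ : _ = g_sigma_preimage (fun i (x : 'rV[R]_k) => x ord0 i))//.
  rewrite -[X in X `<=` _]g_sigma_preimageE.
  apply: smallest_sub; first exact: sigma_algebra_measurable.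
  move=> _ [B + <-]; rewrite -bigcup_seq => -[i _ [A mA <-]].
  rewrite !setTI -comp_preimage -[X in measurable X]setTI.
  exact: mf.
move=> _ Y mY; apply: H; exists Y => //.
Qed.

End rV_measurable.

Section cons.
Variables (R : realType) (k : nat).

(** The body is the row that occurs in [lebint], so an unfolded iterated integral already has this
    form. *)
Definition rcons0 (x : R) (y : 'rV[R]_k) : 'rV[R]_k.+1 :=
  \row_(i < k.+1) match unlift ord0 i with
                   | Some j => y ord0 j | None => x end.

Definition rtail (z : 'rV[R]_k.+1) : 'rV[R]_k := \row_j z ord0 (lift ord0 j).

Lemma rcons00 x y : rcons0 x y ord0 ord0 = x.
Proof. by rewrite mxE unlift_none. Qed.

Lemma rcons0S x y j : rcons0 x y ord0 (lift ord0 j) = y ord0 j.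
Proof. by rewrite mxE liftK. Qed.

Lemma rtail_cons x y : rtail (rcons0 x y) = y.
Proof. by apply/rowP => j; rewrite mxE rcons0S. Qed.

Definition unc (z : R * 'rV[R]_k) := rcons0 z.1 z.2.

Lemma measurable_unc : measurable_fun [set: R * 'rV[R]_k] unc.
Proof.
apply: measurable_fun_rVP => i; rewrite /unc.
case: (unliftP ord0 i) => [j|] ->.
  under eq_fun do rewrite rcons0S.
  by apply: (measurableT_comp (measurable_coord j)).
under eq_fun do rewrite rcons00.
exact: measurable_fst.
Qed.

Lemma measurable_rtail : measurable_fun [set: 'rV[R]_k.+1] rtail.
Proof.
apply: measurable_fun_rVP => i.
under eq_fun do rewrite mxE.
exact: measurable_coord.
Qed.

End cons.

(** Change of variables in which [m2] only has to agree with the image of [m1] on measurable sets;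
    this covers measures that are not constructed as images. *)
Lemma ge0_integral_image d1 d2 (T1 : measurableType d1) (T2 : measurableType d2)
    (R : realType) (m1 : {measure set T1 -> \bar R})
    (m2 : {measure set T2 -> \bar R}) (phi : T1 -> T2) (D : set T2)
    (f : T2 -> \bar R) :
  measurable_fun setT phi ->
  (forall A, measurable A -> m2 A = m1 (phi @^-1` A)) ->
  measurable D -> measurable_fun D f -> (forall x, D x -> 0 <= f x)%E ->
  (\int[m2]_(x in D) f x = \int[m1]_(x in phi @^-1` D) f (phi x))%E.
Proof.
move=> mphi m12 mD mf f0.
rewrite -(ge0_integral_pushforward mphi)//; last by move=> x /set_mem; exact: f0.
apply: (@eq_measure_integral _ _ _ D
  (measure_function_pushforward__canonical__measure_function_Measure m1 mphi)).
by move=> A mA _; exact: m12.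
Qed.

(* [lebesgue_measure] lives on [measurableTypeR R], whose display differs from
   the one of the canonical measurable structure of [R]; [leb1] is the same
   measure on the latter. *)
Section leb1.
Local Open Scope ereal_scope.
Variable R : realType.

Definition leb1 (A : set R) : \bar R := @lebesgue_measure R A.

Let leb1_0 : leb1 set0 = 0. Proof. exact: (@measure0 _ _ _ (@lebesgue_measure R)). Qed.
Let leb1_ge0 A : 0 <= leb1 A.
Proof. exact: (@measure_ge0 _ _ _ (@lebesgue_measure R)). Qed.
Let leb1_sigma : semi_sigma_additive leb1.
Proof. exact: (@measure_semi_sigma_additive _ _ _ (@lebesgue_measure R)). Qed.
HB.instance Definition _ := isMeasure.Build _ _ _ leb1 leb1_0 leb1_ge0 leb1_sigma.

Let leb1_sf : sigma_finite setT leb1.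
Proof. exact: (@sigma_finiteT _ _ _ (@lebesgue_measure R)). Qed.
HB.instance Definition _ := @Measure_isSigmaFinite.Build _ _ _ leb1 leb1_sf.

Lemma integral_leb1 (D : set R) (f : R -> \bar R) :
  measurable D -> measurable_fun D f -> (forall x, D x -> 0 <= f x) ->
  \int[lebesgue_measure]_(x in D) f x = \int[leb1]_(x in D) f x.
Proof.
move=> mD mf f0; apply/esym.
rewrite (ge0_integral_image (m1 := @lebesgue_measure R) (phi := (idfun : measurableTypeR R -> R)))//.
exact: measurable_id.
Qed.

End leb1.

Section vol_cons.
Local Open Scope ereal_scope.
Variables (R : realType) (k : nat).
Variable m : {sigma_finite_measure set 'rV[R]_k -> \bar R}.

Definition vol_cons (A : set 'rV[R]_k.+1) : \bar R :=
  (@leb1 R \x m) (@unc R k @^-1` A).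

Let measurable_unc_preimage A : measurable A -> measurable (@unc R k @^-1` A).
Proof.
by move=> mA; rewrite -[X in measurable X]setTI; exact: measurable_unc.
Qed.

Let vol_cons0 : vol_cons set0 = 0.
Proof. by rewrite /vol_cons preimage_set0 measure0. Qed.

Let vol_cons_ge0 A : 0 <= vol_cons A.
Proof. exact: measure_ge0. Qed.

Let vol_cons_sigma_additive : semi_sigma_additive vol_cons.
Proof.
move=> F mF tF mUF; rewrite /vol_cons preimage_bigcup.
apply: measure_semi_sigma_additive.
- by move=> n; exact: measurable_unc_preimage.
- apply/trivIsetP => /= i j _ _ ij; rewrite -preimage_setI.
  by move/trivIsetP : tF => /(_ _ _ _ _ ij) ->//; rewrite preimage_set0.
- by rewrite -preimage_bigcup; exact: measurable_unc_preimage.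
Qed.

HB.instance Definition _ := isMeasure.Build _ _ _ vol_cons
  vol_cons0 vol_cons_ge0 vol_cons_sigma_additive.

Lemma vol_cons_sigma_finite : sigma_finite setT vol_cons.
Proof.
have /sigma_finiteP[F [TF ndF Foo]] := sigma_finiteT (@leb1 R).
have /sigma_finiteP[G [TG ndG Goo]] := sigma_finiteT m.
(* [phi] is inverse to [unc]; the products of sets of finite measure are pulled back along it. *)
pose phi (z : 'rV[R]_k.+1) := (z ord0 ord0, rtail z).
have mphi : measurable_fun setT phi.
  apply: measurable_fun_pair; first exact: measurable_coord.
  exact: measurable_rtail.
exists (fun n => phi @^-1` (F n `*` G n)).
  rewrite -preimage_bigcup (_ : \bigcup_i (F i `*` G i) = setT) ?preimage_setT//.
  rewrite -setXTT TF TG predeqE => -[x y]; split.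
    by move=> [n _ []/= ? ?]; split; exists n.
  move=> [/= [n _ Fnx] [j _ Gky]]; exists (maxn n j) => //; split.
  - by move: x Fnx; exact/subsetPset/ndF/leq_maxl.
  - by move: y Gky; exact/subsetPset/ndG/leq_maxr.
move=> i; have [? ?] := Foo i; have [? ?] := Goo i.
have mX : measurable (F i `*` G i) by exact: measurableX.
split; first by rewrite -[X in measurable X]setTI; exact: mphi.
rewrite /= /vol_cons -comp_preimage (_ : _ \o _ = id); last first.
  by apply/funext => -[x y]; rewrite /phi /unc /= rcons00 rtail_cons.
by rewrite product_measure1E//= lte_mul_pinfty// ge0_fin_numE.
Qed.

HB.instance Definition _ := @Measure_isSigmaFinite.Build _ _ _ vol_cons vol_cons_sigma_finite.

Definition vol_cons_pack : {sigma_finite_measure set 'rV[R]_k.+1 -> \bar R} := vol_cons.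

Lemma integral_vol_cons (f : 'rV[R]_k.+1 -> \bar R) :
  measurable_fun setT f -> (forall x, 0 <= f x) ->
  \int[vol_cons]_x f x = \int[@leb1 R]_x \int[m]_y f (rcons0 x y).
Proof.
move=> mf f0.
rewrite (@ge0_integral_image _ _ _ _ _ (@leb1 R \x m) vol_cons (@unc R k))//; last exact: measurable_unc.
rewrite preimage_setT fubini_tonelli1//=.
by apply: measurableT_comp => //; exact: measurable_unc.
Qed.

End vol_cons.

Definition dirac0 (R : realType) : {sigma_finite_measure set 'rV[R]_0 -> \bar R} :=
  @dirac _ 'rV[R]_0 0 R.

(** The recursion follows [lebint]: a point mass on the one-point space, then a product with the
    line in the first coordinate. A genuine measure gives access to Tonelli, Fatou and changes of
    variables. *)
Fixpoint vol (R : realType) (k : nat) : {sigma_finite_measure set 'rV[R]_k -> \bar R} :=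
  match k with
  | 0 => dirac0 R
  | k'.+1 => vol_cons_pack (vol R k')
  end.

Section vol.
Local Open Scope ereal_scope.
Variable R : realType.

Lemma integral_vol0 (f : 'rV[R]_0 -> \bar R) : measurable_fun setT f ->
  \int[vol R 0]_x f x = f 0%R.
Proof. by move=> mf; rewrite integral_dirac// diracT mul1e. Qed.

Lemma integral_volS k (f : 'rV[R]_k.+1 -> \bar R) :
  measurable_fun setT f -> (forall x, 0 <= f x) ->
  \int[vol R k.+1]_x f x =
    \int[@leb1 R]_x \int[vol R k]_y f (rcons0 x y).
Proof. exact: integral_vol_cons. Qed.

Lemma measurable_rcons0 k (x : R) : measurable_fun setT (@rcons0 R k x).
Proof. exact: (measurableT_comp (@measurable_unc R k) (measurable_pair1 x)). Qed.

(** Bridge from the iterated integrals of the statement to integrals against [vol]. Joint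
    measurability of [f] yields that of the inner integrals. *)
Lemma lebintE k (f : 'rV[R]_k -> \bar R) :
  measurable_fun setT f -> (forall x, 0 <= f x) ->
  lebint f = \int[vol R k]_x f x.
Proof.
elim: k f => [|k IH] f mf f0; first by rewrite integral_vol0.
rewrite integral_volS//= -integral_leb1//.
- apply: eq_integral => x _.
  rewrite IH//; apply: (measurableT_comp mf); exact: measurable_rcons0.
- apply: (measurable_fun_fubini_tonelli_F (m2 := vol R k) (f \o @unc R k)) => //=.
  by apply: measurableT_comp => //; exact: measurable_unc.
- by move=> x _; exact: integral_ge0.
Qed.

End vol.

(** * Borel sets of row vectors *)

Section rV_borel.
Variables (R : realType) (k : nat).
Implicit Types (x y : 'rV[R]_k).

Lemma measurable_rV_box (a : 'I_k -> set R) : (forall i, measurable (a i)) ->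
  measurable [set x : 'rV[R]_k | forall i, a i (x ord0 i)].
Proof.
move=> ma; rewrite (_ : mkset _ =
    \bigcap_(i in [set: 'I_k]) ((fun x : 'rV[R]_k => x ord0 i) @^-1` a i)).
  apply: fin_bigcap_measurable => // i _.
  by rewrite -[X in measurable X]setTI; exact: measurable_coord.
by apply/seteqP; split => [x /= H i _|x /= H i]; exact: H.
Qed.

(** An open set is the union of the cubes with rational centre and radius 1/(m+1) that it contains;
    there are countably many, and each is a coordinate box. *)
Lemma open_measurable_rV (U : set 'rV[R]_k) : open U -> measurable U.
Proof.
move=> oU.
pose B (z : 'rV[rat]_k * nat) := [set x : 'rV[R]_k | forall i,
  `|x ord0 i - ratr (z.1 ord0 i)| < z.2.+1%:R^-1].
rewrite (_ : U = \bigcup_z (if pselect (B z `<=` U) then B z else set0)).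
  apply: countable_bigcupT_measurable => // z.
  case: pselect => [h|h] /=; last exact: measurable0.
  apply: (measurable_rV_box (a := fun i => [set t | `|t - ratr (z.1 ord0 i)| < z.2.+1%:R^-1])).
  move=> i; rewrite [X in measurable X](_ : _ = ball (ratr (z.1 ord0 i) : R) z.2.+1%:R^-1).
    exact: measurable_ball.
  by apply/seteqP; split => t /=; rewrite /ball/= distrC.
apply/seteqP; split => [x Ux|x [z _]]; last by case: pselect => [zU|zU] //=; exact: zU.
move: oU; rewrite openE => /(_ _ Ux) /nbhs_ballP[e /= e0 eU].
(* A cube of radius 1/(m+1) that contains [x] stays within 2/(m+1) < e of [x]. *)
have [m me] : exists m : nat, m.+1%:R^-1 < e / 2.
  exists (Num.truncn (e / 2)^-1).
  rewrite invf_plt ?posrE ?divr_gt0//; exact: truncnS_gt.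
have m0 : (0 : R) < m.+1%:R^-1 by rewrite invr_gt0.
have H i : exists q : rat, `|x ord0 i - ratr q| < m.+1%:R^-1.
  have [|q] := @rat_in_itvoo R (x ord0 i) (x ord0 i + m.+1%:R^-1).
    by rewrite ltrDl.
  rewrite in_itv /= => /andP[q1 q2]; exists q.
  by rewrite distrC gtr0_norm ?subr_gt0// ltrBlDl.
pose q := \row_i sval (cid (H i)).
exists (q, m) => //; case: pselect => [h|h] /=; last first.
  exfalso; apply: h => y By; apply: eU; split => // i j.
  rewrite ord1 /ball/=; have := By j; have := svalP (cid (H j)).
  rewrite /q mxE /=; set w := ratr _; move: me; set em := _^-1 => me h1 h2.
  rewrite (_ : _ - _ = (x ord0 j - w) - (y ord0 j - w)); last by ring.
  by rewrite (le_lt_trans (ler_normB _ _))// (lt_trans (ltrD h1 h2))//; lra.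
by move=> i; rewrite /q mxE; exact: (svalP (cid (H i))).
Qed.

Lemma closed_measurable_rV (U : set 'rV[R]_k) : closed U -> measurable U.
Proof.
by move=> cU; rewrite -[U]setCK; apply: measurableC; apply: open_measurable_rV; exact: closed_openC.
Qed.

Lemma compact_measurable_rV (U : set 'rV[R]_k) : compact U -> measurable U.
Proof.
by move=> cU; apply: closed_measurable_rV; apply: compact_closed => //; exact: norm_hausdorff.
Qed.

Lemma continuous_measurable_rV (f : 'rV[R]_k -> R) :
  continuous f -> measurable_fun setT f.
Proof.
move=> /continuousP cf; apply: (measurability _ (RGenOpens.measurableE R)).
move=> _ [_ [a [b ->] <-]]; rewrite setTI; apply: open_measurable_rV.
exact/cf/interval_open.
Qed.

Section fun_.
Context d (T : measurableType d).
Implicit Types f g : T -> 'rV[R]_k.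

Lemma measurable_coordT f i : measurable_fun setT f ->
  measurable_fun setT (fun t => f t ord0 i).
Proof. exact: (measurableT_comp (measurable_coord i)). Qed.

Lemma measurable_rVD f g : measurable_fun setT f -> measurable_fun setT g ->
  measurable_fun setT (fun t => f t + g t).
Proof.
move=> mf mg; apply: measurable_fun_rVP => i; under eq_fun do rewrite mxE.
by apply: measurable_funD; exact: measurable_coordT.
Qed.

Lemma measurable_rVZ (c : T -> R) f : measurable_fun setT c ->
  measurable_fun setT f -> measurable_fun setT (fun t => c t *: f t).
Proof.
move=> mc mf; apply: measurable_fun_rVP => i; under eq_fun do rewrite mxE.
by apply: measurable_funM => //; exact: measurable_coordT.
Qed.

Lemma measurable_rVN f : measurable_fun setT f ->
  measurable_fun setT (fun t => - f t).
Proof.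
move=> mf; apply: measurable_fun_rVP => i; under eq_fun do rewrite mxE.
exact: (measurable_funN (measurable_coordT i mf)).
Qed.

Definition dotv (x y : 'rV[R]_k) : R := \sum_i x ord0 i * y ord0 i.

Lemma measurable_dotv f g : measurable_fun setT f -> measurable_fun setT g ->
  measurable_fun setT (fun t => dotv (f t) (g t)).
Proof.
move=> mf mg; apply: measurable_sum => i.
by apply: measurable_funM; exact: measurable_coordT.
Qed.

End fun_.

End rV_borel.

Lemma measurable_mulmxT d (T : measurableType d) (R : realType) k l (U : 'M[R]_(k, l))
    (f : T -> 'rV[R]_k) :
  measurable_fun setT f -> measurable_fun setT (fun t => f t *m U).
Proof.
move=> mf; apply: measurable_fun_rVP => i; under eq_fun do rewrite mxE.
apply: measurable_sum => j; apply: measurable_funM => //.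
exact: measurable_coordT.
Qed.

(** * Affine and orthogonal changes of variables *)

Section affine1.
Local Open Scope ereal_scope.
Variable R : realType.

(** The right-hand side is a measure in [A], and it has the value of Lebesgue measure on half-open
    intervals, which determine it. *)
Lemma leb1_affine (a b : R) (A : set R) : (0 < a)%R -> measurable A ->
  leb1 A = a%:E * leb1 ((fun x => a * x + b)%R @^-1` A).
Proof.
move=> a0 mA.
pose phi : measurableTypeR R -> measurableTypeR R := fun x => (a * x + b)%R.
have mphi : measurable_fun setT phi.
  apply: (@continuous_measurable_fun R (fun x => a * x + b)%R) => x.
  by apply: cvgD; [apply: cvgM; [exact: cvg_cst|exact: cvg_id]|exact: cvg_cst].
pose a' : {nonneg R} := NngNum (ltW a0).
apply: (@lebesgue_measure_unique R (mscale a'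
  (measure_function_pushforward__canonical__measure_function_Measure
    (@lebesgue_measure R) mphi))) => // X [[c d] _ <-] /=.
rewrite /mscale /= /pushforward.
have -> : phi @^-1` `]c, d] = `]((c - b) / a)%R, ((d - b) / a)%R]%classic.
  apply/seteqP; split => x /=; rewrite !in_itv/= /phi => /andP[h1 h2].
    by rewrite ltr_pdivrMr// ler_pdivlMr//; apply/andP; split; lra.
  move: h1 h2; rewrite ltr_pdivrMr// ler_pdivlMr// => h1 h2.
  by apply/andP; split; lra.
rewrite !lebesgue_measure_itv /= !lte_fin ltr_pM2r ?invr_gt0// ltrD2r.
case: ifPn => _; last by rewrite mule0.
rewrite -!EFinB -EFinM; congr (_%:E); field.
by rewrite gt_eqF.
Qed.

Lemma integral_leb1_affine (a b : R) (f : R -> \bar R) : (0 < a)%R ->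
  measurable_fun setT f -> (forall x, 0 <= f x) ->
  \int[@leb1 R]_x f x = a%:E * \int[@leb1 R]_x f (a * x + b)%R.
Proof.
move=> a0 mf f0.
pose phi : R -> R := fun x => (a * x + b)%R.
have mphi : measurable_fun setT phi.
  apply: (@continuous_measurable_fun R (fun x => a * x + b)%R) => x.
  by apply: cvgD; [apply: cvgM; [exact: cvg_cst|exact: cvg_id]|exact: cvg_cst].
rewrite (ge0_integral_image (m1 := mscale (NngNum (ltW a0)) (@leb1 R)) mphi)//.
  rewrite preimage_setT ge0_integral_mscale//.
  exact: measurableT_comp.
by move=> A mA; rewrite /mscale /=; exact: leb1_affine.
Qed.

End affine1.

Section vol_affine.
Local Open Scope ereal_scope.
Variable R : realType.

Lemma measurable_affine k (a : R) (v : 'rV[R]_k) :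
  measurable_fun setT (fun x : 'rV[R]_k => (a *: x + v)%R).
Proof.
by apply: measurable_rVD => //; apply: measurable_rVZ => //; exact: measurable_id.
Qed.

Lemma measurable_slice k (f : 'rV[R]_k.+1 -> \bar R) : measurable_fun setT f ->
  (forall x, 0 <= f x) ->
  measurable_fun setT (fun x => \int[vol R k]_y f (rcons0 x y)).
Proof.
move=> mf f0.
apply: (measurable_fun_fubini_tonelli_F (m2 := vol R k) (f \o @unc R k)) => //=.
by apply: measurableT_comp => //; exact: measurable_unc.
Qed.

(** Induction on the dimension: the one-dimensional formula for the first coordinate, the induction
    hypothesis for the tail of [v] inside. *)
Lemma integral_vol_affine k (a : R) (v : 'rV[R]_k) (f : 'rV[R]_k -> \bar R) :
  (0 < a)%R -> measurable_fun setT f -> (forall x, 0 <= f x) ->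
  \int[vol R k]_x f x = (a ^+ k)%:E * \int[vol R k]_x f (a *: x + v)%R.
Proof.
move=> a0; elim: k v f => [|k IH] v f mf f0.
  rewrite expr0 mul1e !integral_vol0//; first by congr (f _); apply/rowP => -[].
  apply: measurableT_comp => //; exact: measurable_affine.
rewrite integral_volS// (integral_leb1_affine (v ord0 ord0) a0); first last.
- by move=> x; exact: integral_ge0.
- exact: measurable_slice.
rewrite integral_volS//; first last.
  by apply: measurableT_comp => //; exact: measurable_affine.
rewrite exprS EFinM -muleA; congr (_ * _).
rewrite -ge0_integralZl//; first last.
- by rewrite lee_fin exprn_ge0// ltW.
- by move=> x _; exact: integral_ge0.
- apply: (@measurable_slice _ (fun z => f (a *: z + v)%R)) => //.
  by apply: measurableT_comp => //; exact: measurable_affine.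
apply: eq_integral => x _.
rewrite (IH (rtail v))//; last exact: (measurableT_comp mf (measurable_rcons0 _)).
congr (_ * _); apply: eq_integral => y _; congr (f _).
apply/rowP => i; case: (unliftP ord0 i) => [j|] ->.
  by rewrite rcons0S !mxE !liftK.
by rewrite rcons00 !mxE unlift_none.
Qed.

Lemma integral_vol_shift k (v : 'rV[R]_k) (f : 'rV[R]_k -> \bar R) :
  measurable_fun setT f -> (forall x, 0 <= f x) ->
  \int[vol R k]_x f (x + v)%R = \int[vol R k]_x f x.
Proof.
move=> mf f0; rewrite [RHS](integral_vol_affine v ltr01)// expr1n mul1e.
by apply: eq_integral => x _; rewrite scale1r.
Qed.

Lemma integral_vol_scale k (a : R) (f : 'rV[R]_k -> \bar R) :
  (0 < a)%R -> measurable_fun setT f -> (forall x, 0 <= f x) ->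
  \int[vol R k]_x f x = (a ^+ k)%:E * \int[vol R k]_x f (a *: x)%R.
Proof.
move=> a0 mf f0; rewrite (integral_vol_affine 0%R a0)//.
by congr (_ * _); apply: eq_integral => x _; rewrite addr0.
Qed.

Definition box k (c : R) : set 'rV[R]_k := [set x | forall i, (`|x ord0 i| <= c)%R].

Lemma measurable_box k c : measurable (@box k c).
Proof.
apply: (measurable_rV_box (a := fun=> [set t : R | (`|t| <= c)%R])) => i.
rewrite (_ : mkset _ = `[(- c)%R, c]%classic); first exact: measurable_itv.
by apply/seteqP; split => t /=; rewrite in_itv/= ler_norml.
Qed.

Lemma vol_indic k (A : set 'rV[R]_k) : measurable A ->
  vol R k A = \int[vol R k]_x (\1_A x)%:E.
Proof. by move=> mA; rewrite integral_indic// setIT. Qed.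

Lemma measurable_Eindic d (T : measurableType d) (A : set T) : measurable A ->
  measurable_fun setT (fun x => (\1_A x : R)%:E).
Proof. by move=> mA; apply/measurable_EFinP; exact: measurable_indic. Qed.

Lemma vol_box k (c : R) : (0 <= c)%R -> vol R k (@box k c) = ((2 * c) ^+ k)%:E.
Proof.
move=> c0; elim: k => [|k IH].
  rewrite expr0 /= /dirac indicE (_ : (_ \in _) = true)//.
  by apply/mem_set => -[].
have mb := measurable_box; have mI := measurable_Eindic.
rewrite vol_indic// integral_volS//; last by apply: mI; exact: mb.
  transitivity (\int[@leb1 R]_x ((\1_`[(- c)%R, c] x)%:E * ((2 * c) ^+ k)%:E)).
    apply: eq_integral => x _.
    rewrite -IH vol_indic// -ge0_integralZl//; last by apply: mI; exact: mb.
    apply: eq_integral => y _; rewrite -EFinM; congr (_%:E).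
    rewrite !indicE -natrM mulnb; congr ((nat_of_bool _)%:R).
    apply/idP/andP => [/set_mem H|[/set_mem Hx /set_mem Hy]].
      split; apply/mem_set.
        by have := H ord0; rewrite rcons00 /= in_itv/= ler_norml.
      by move=> j; have := H (lift ord0 j); rewrite rcons0S.
    apply/mem_set => i; case: (unliftP ord0 i) => [j|] ->.
      by rewrite rcons0S; exact: Hy.
    by rewrite rcons00 ler_norml; move: Hx; rewrite /= in_itv.
  rewrite ge0_integralZr//; last 2 first.
  - by apply: mI; exact: measurable_itv.
  - by rewrite lee_fin exprn_ge0// mulr_ge0.
  have -> : \int[@leb1 R]_x (\1_`[(- c)%R, c] x)%:E = @lebesgue_measure R `[(- c)%R, c]%classic.
    by rewrite integral_indic// ?setIT//; exact: measurable_itv.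
  rewrite lebesgue_measure_itv /= lte_fin.
  case: ifPn => [_|]; first by rewrite -EFinB -EFinM exprS; congr (_%:E); ring.
  rewrite -leNgt => cc; have -> : c = 0%R by lra.
  by rewrite mul0e mulr0 exprS mul0r.
Qed.

Lemma dotv_sqnorm k (x : 'rV[R]_k) : dotv x x = sqnorm x.
Proof. by rewrite /sqnorm mxE; apply: eq_bigr => i _; rewrite !mxE. Qed.

Lemma sqnormE k (x : 'rV[R]_k) : sqnorm x = (\sum_i x ord0 i ^+ 2)%R.
Proof. by rewrite -dotv_sqnorm; apply: eq_bigr => i _; rewrite expr2. Qed.

Lemma measurable_sqnorm k : measurable_fun setT (@sqnorm R k).
Proof.
rewrite (_ : @sqnorm R k = fun x => dotv x x); last first.
  by apply/funext => x; rewrite dotv_sqnorm.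
by apply: measurable_dotv; exact: measurable_id.
Qed.

Lemma measurable_ball2 k : measurable (@ball2 R k).
Proof.
rewrite (_ : @ball2 R k = setT `&` @sqnorm R k @^-1` `]-oo, 1%R]).
  by apply: measurable_sqnorm => //; exact: measurable_itv.
by rewrite setTI; apply/seteqP; split => x /=; rewrite /ball2/= in_itv.
Qed.

Lemma coord_sqnorm k (x : 'rV[R]_k) i : (x ord0 i ^+ 2 <= sqnorm x)%R.
Proof.
rewrite sqnormE (bigD1 i)//= lerDl; apply: sumr_ge0 => j _; exact: sqr_ge0.
Qed.

Lemma vol_ball2_lty k : vol R k (@ball2 R k) < +oo.
Proof.
apply: (@le_lt_trans _ _ (vol R k (@box k 1))).
  apply: le_measure; rewrite ?inE; [exact: measurable_ball2|exact: measurable_box|].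
  move=> x /= x1 i; rewrite -(@ler_pXn2r _ 2)// ?nnegrE// expr1n.
  by rewrite real_normK ?num_real// (le_trans (coord_sqnorm _ _)).
by rewrite vol_box// ltry.
Qed.

Lemma vol_ball2_gt0 k : 0 < vol R k (@ball2 R k).
Proof.
(* The cube of half-side [c] lies in the ball, since the squared norm is at most k c^2 <= k c <=
   1. *)
pose c : R := (k.+1%:R^-1)%R.
have c0 : (0 < c)%R by rewrite invr_gt0.
apply: (@lt_le_trans _ _ (vol R k (@box k c))).
  by rewrite vol_box ?(ltW c0)// lte_fin exprn_gt0// mulr_gt0.
apply: le_measure; rewrite ?inE; [exact: measurable_box|exact: measurable_ball2|].
move=> x /= xc; rewrite /ball2 /= sqnormE.
apply: (@le_trans _ _ (\sum_(i < k) c))%R; last first.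
  by rewrite sumr_const card_ord -mulr_natr mulrC /c ler_pdivrMr// mul1r ler_nat.
apply: ler_sum => i _; rewrite -real_normK ?num_real//.
apply: (@le_trans _ _ (c ^+ 2)%R); first by rewrite ler_pXn2r// ?nnegrE// ltW.
by rewrite expr2 ger_pMr// /c invf_le1// ler1n.
Qed.

Definition orthomat k (U : 'M[R]_k) := U *m U^T = 1%:M.

Lemma sqnorm_orthomat k (U : 'M[R]_k) (x : 'rV[R]_k) : orthomat U ->
  sqnorm (x *m U) = sqnorm x.
Proof.
by rewrite /sqnorm => UU; rewrite trmx_mul mulmxA -(mulmxA x) UU mulmx1.
Qed.

(* Both sides are integrals of translation-invariant measures, so Fubini on the
   product with the indicator of the ball, which the rotation preserves,
   identifies them. *)
Lemma integral_vol_orthomat k (U : 'M[R]_k) (f : 'rV[R]_k -> \bar R) :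
  orthomat U -> measurable_fun setT f -> (forall x, 0 <= f x) ->
  \int[vol R k]_x f (x *m U)%R = \int[vol R k]_x f x.
Proof.
move=> UU mf f0.
have UU' : (U^T *m U = 1%:M)%R by exact: mulmx1C.
pose g (x : 'rV[R]_k) : \bar R := (\1_(@ball2 R k) x)%:E.
have mg : measurable_fun setT g by apply: measurable_Eindic; exact: measurable_ball2.
have g0 x : 0 <= g x by rewrite lee_fin.
have gU x : g (- (x *m U))%R = g x.
  rewrite /g !indicE; congr ((nat_of_bool _)%:R%:E).
  have e : sqnorm (- (x *m U))%R = sqnorm x.
    by rewrite -(sqnorm_orthomat x UU) !sqnormE; apply: eq_bigr => i _; rewrite mxE sqrrN.
  by apply/idP/idP => /set_mem H; apply/mem_set; move: H; rewrite /ball2/= e.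
have vB : vol R k (@ball2 R k) = \int[vol R k]_x g x.
  by rewrite vol_indic//; exact: measurable_ball2.
have mU : measurable_fun setT (fun x : 'rV[R]_k => x *m U)%R.
  by apply: measurable_mulmxT; exact: measurable_id.
have m1 : measurable_fun setT (fun z : 'rV[R]_k * 'rV[R]_k => z.1 *m U + z.2)%R.
  by apply: measurable_rVD => //; apply: measurable_mulmxT; exact: measurable_fst.
have m2 : measurable_fun setT (fun z : 'rV[R]_k * 'rV[R]_k => z.2 + - (z.1 *m U))%R.
  by apply: measurable_rVD => //; apply: measurable_rVN; apply: measurable_mulmxT; exact: measurable_fst.
have key : (\int[vol R k]_x f (x *m U)%R) * vol R k (@ball2 R k) =
           (\int[vol R k]_x f x) * vol R k (@ball2 R k).
  rewrite [in LHS]vB -ge0_integralZl//; last exact: integral_ge0.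
  transitivity (\int[vol R k]_y \int[vol R k]_x (g y * f (x *m U + y)%R)).
    apply: eq_integral => y _.
    rewrite ge0_integralZl//; last by apply: measurableT_comp => //; exact: (measurableT_comp m1 (measurable_pair2 _)).
    rewrite muleC; congr (_ * _).
    (* A translation after the rotation is a translation by [y *m U^T] before it. *)
    have e x : (x *m U + y)%R = ((x + y *m U^T) *m U)%R.
      by rewrite mulmxDl -mulmxA UU' mulmx1.
    under [RHS]eq_integral do rewrite e.
    by rewrite (integral_vol_shift (y *m U^T)%R (f := fun z => f (z *m U)%R))//; apply: measurableT_comp.
  rewrite (fubini_tonelli (m1 := vol R k) (m2 := vol R k) (fun z => g z.1 * f (z.2 *m U + z.1)%R))/=; last 2 first.
  - apply: emeasurable_funM; first exact: (measurableT_comp mg measurable_fst).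
    apply: (measurableT_comp mf); apply: measurable_rVD => //; apply: measurable_mulmxT; exact: measurable_snd.
  - by move=> z; exact: mule_ge0.
  transitivity (\int[vol R k]_x \int[vol R k]_y (g (y + - (x *m U))%R * f y)).
    apply: eq_integral => x _.
    rewrite -(integral_vol_shift (x *m U)%R (f := fun y => g (y + - (x *m U))%R * f y)).
    - by apply: eq_integral => y _; rewrite addrK addrC.
    - apply: emeasurable_funM => //; apply: (measurableT_comp mg); apply: measurable_rVD => //; exact: measurable_id.
    - by move=> y; exact: mule_ge0.
  rewrite (fubini_tonelli (m1 := vol R k) (m2 := vol R k) (fun z => g (z.2 + - (z.1 *m U))%R * f z.2))/=; last 2 first.
  - apply: emeasurable_funM; first exact: (measurableT_comp mg m2).
    exact: (measurableT_comp mf measurable_snd).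
  - by move=> z; exact: mule_ge0.
  rewrite -ge0_integralZr//.
  apply: eq_integral => y _.
  rewrite ge0_integralZr//; last first.
    by apply: (measurableT_comp mg); apply: measurable_rVD => //; apply: measurable_rVN; exact: mU.
  rewrite muleC; congr (_ * _).
  rewrite vB -(integral_vol_shift (y *m U^T)%R (f := fun z => g (y + - (z *m U))%R)).
  - apply: eq_integral => x _; rewrite -[in RHS]gU; congr g.
    by rewrite mulmxDl -mulmxA UU' mulmx1 opprD addrCA subrr addr0.
  - by apply: (measurableT_comp mg); apply: measurable_rVD => //; apply: measurable_rVN; exact: mU.
  - by [].
have := vol_ball2_lty k; have := vol_ball2_gt0 k.
case: (vol R k _) key => // b key b0 _.
apply/eqP; rewrite eq_le; apply/andP; split; rewrite -(@lee_pmul2r _ b%:E)//; by rewrite key lexx.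
Qed.

End vol_affine.

(** * Layer cake and Brunn-Minkowski inequalities *)

Section layer_cake.
Local Open Scope ereal_scope.
Variable R : realType.

Lemma leb1_itv (a b : R) (ba bb : bool) : (a <= b)%R ->
  leb1 [set` Interval (BSide ba a) (BSide bb b)] = (b - a)%:E.
Proof.
move=> ab; rewrite [LHS](lebesgue_measure_itv (Interval (BSide ba a) (BSide bb b)))/= lte_fin.
case: ltP => // ba'; rewrite (_ : a = b) ?subrr//; apply/eqP; rewrite eq_le ab.
exact: ba'.
Qed.

Lemma indic_eq (T1 T2 : Type) (A : set T1) (B : set T2) x y : (A x <-> B y) ->
  \1_A x = \1_B y :> R.
Proof.
move=> h; rewrite !indicE; congr ((nat_of_bool _)%:R).
by apply/idP/idP => /set_mem /h H; apply/mem_set.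
Qed.

Lemma measurable_subgraph d (T : measurableType d) (f : T -> \bar R) (c : R) :
  measurable_fun setT f -> measurable [set z : T * R | (c * z.2)%:E < f z.1].
Proof.
move=> mf; rewrite [X in measurable X](_ : _ = setT `&` [set z : T * R | (c * z.2)%:E < f z.1]); last by rewrite setTI.
apply: emeasurable_fun_lt => //; last exact: (measurableT_comp mf measurable_fst).
apply/measurable_EFinP.
by apply: measurable_funM => //; exact: measurable_snd.
Qed.

Lemma measurable_layer d (T : measurableType d) (m : {sigma_finite_measure set T -> \bar R})
    (f : T -> \bar R) (c : R) : measurable_fun setT f ->
  measurable_fun setT (fun s : R => m [set x | (c * s)%:E < f x]).
Proof.
move=> mf; have := measurable_fun_ysection m (measurable_subgraph c mf).
congr (measurable_fun _ _); apply/funext => s; congr (m _).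
by apply/seteqP; split => x; rewrite /ysection /= inE.
Qed.

Definition superlevel T (f : T -> \bar R) (t : R) : set T := [set x | t%:E < f x].

(** Tonelli on the region c s < f x, 0 < s < 1, whose slice over [x] has length min(f x / c, 1).
    Levels are normalized to (0, 1) so that functions with different maxima can be compared at the
    same relative level, and the truncation at [c] allows [f] to exceed [c]. *)
Lemma layer_cake_weight d (T : measurableType d) (m : {sigma_finite_measure set T -> \bar R})
    (w : T -> R) (f : T -> \bar R) (c : R) : (0 < c)%R ->
  measurable_fun setT w -> (forall x, 0 <= w x)%R ->
  measurable_fun setT f -> (forall x, 0 <= f x) ->
  \int[m]_x (mine (f x) c%:E * (w x)%:E) =
  c%:E * \int[@leb1 R]_(s in `]0%R, 1%R[)
    \int[m]_x (\1_(superlevel f (c * s)) x * w x)%:E.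
Proof.
move=> c0 mw w0 mf f0.
pose E := [set z : T * R | (c * z.2)%:E < f z.1].
have mE : measurable E by exact: measurable_subgraph.
pose D := `]0%R, 1%R[%classic : set R.
have mD : measurable D by exact: measurable_itv.
pose G (z : T * R) : \bar R := (\1_E z * w z.1 * \1_D z.2)%:E.
have mG : measurable_fun setT G.
  apply/measurable_EFinP; apply: measurable_funM.
    apply: measurable_funM; first exact: measurable_indic.
    exact: (measurableT_comp mw measurable_fst).
  by apply: (measurableT_comp (measurable_indic mD)); exact: measurable_snd.
have G0 z : 0 <= G z by rewrite lee_fin !mulr_ge0.
transitivity (c%:E * \int[m]_x \int[@leb1 R]_s G (x, s)).
  rewrite -ge0_integralZl//; first last.
  - by rewrite lee_fin ltW.
  - by move=> x _; exact: integral_ge0.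
  - exact: (measurable_fun_fubini_tonelli_F (m2 := @leb1 R) G).
  apply: eq_integral => x _.
  pose S : set R := [set s | (c * s)%:E < f x].
  have -> : \int[@leb1 R]_s G (x, s) = (w x)%:E * leb1 (D `&` S).
    have mI : measurable (D `&` S).
      apply: measurableI => //.
      have := measurable_xsection x mE; congr measurable.
      by apply/seteqP; split => s; rewrite /xsection /E /= inE.
    have -> : leb1 (D `&` S) = \int[@leb1 R]_s (\1_(D `&` S) s)%:E.
      by rewrite integral_indic// setIT.
    rewrite -ge0_integralZl//; last 2 first.
    - by apply: measurable_Eindic.
    - by rewrite lee_fin.
    apply: eq_integral => s _; rewrite -EFinM; congr (_%:E).
    rewrite mulrAC [RHS]mulrC; congr (_ * _)%R.
    by rewrite indicI /= mulrC; congr (_ * _)%R.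
  rewrite muleCA [LHS]muleC; congr (_ * _).
  have [fc|fc] := leP (f x) c%:E; last first.
    rewrite (_ : D `&` _ = D).
      by rewrite /D leb1_itv// subr0 mule1.
    apply/seteqP; split => [s []//|s Ds]; split=> //=; apply: le_lt_trans fc.
    move: Ds; rewrite /D/= in_itv/= => /andP[s0 s1].
    by rewrite lee_fin ger_pMr// ltW.
  have := f0 x; case fx : (f x) fc => [r| |]//; rewrite !lee_fin => rc r0.
  rewrite (_ : D `&` _ = `]0%R, (r / c)%R[%classic).
    rewrite leb1_itv ?subr0; last by rewrite divr_ge0// ltW.
    by rewrite -EFinM mulrC divfK// gt_eqF.
  apply/seteqP; split => s /=; rewrite /D /S /= fx !in_itv/= lte_fin.
    by move=> [/andP[-> _]] /=; rewrite ltr_pdivlMr// mulrC.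
  move=> /andP[-> ] /=; rewrite ltr_pdivlMr// mulrC => h; split => //.
  by rewrite -(ltr_pM2l c0) mulr1 (lt_le_trans h).
rewrite fubini_tonelli//; congr (_ * _).
rewrite [RHS]integral_mkcond; apply: eq_integral => s _.
rewrite patchE; case: ifPn => sD.
  apply: eq_integral => x _; congr (_%:E).
  rewrite /G /= [\1_D s]indicE sD mulr1; congr (_ * _)%R.
rewrite integral0_eq// => x _.
by rewrite /G /= [\1_D s]indicE (negbTE sD) mulr0.
Qed.

Lemma layer_cake d (T : measurableType d) (m : {sigma_finite_measure set T -> \bar R})
    (f : T -> \bar R) (c : R) : (0 < c)%R ->
  measurable_fun setT f -> (forall x, 0 <= f x) ->
  \int[m]_x mine (f x) c%:E =
  c%:E * \int[@leb1 R]_(s in `]0%R, 1%R[) m [set x | (c * s)%:E < f x].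
Proof.
move=> c0 mf f0.
have := @layer_cake_weight _ _ m (cst 1%R) f c c0 (measurable_cst _) (fun=> ler01) mf f0.
under [in X in X -> _]eq_integral do rewrite mule1.
move=> ->; congr (_ * _); apply: eq_integral => s _.
under eq_integral do rewrite mulr1.
rewrite integral_indic ?setIT//.
rewrite [X in measurable X](_ : _ = setT `&` [set x | (c * s)%:E < f x]); last by rewrite setTI.
exact: emeasurable_fun_o_infty.
Qed.

End layer_cake.

Section brunn_minkowski1.
Local Open Scope ereal_scope.
Variable R : realType.

(** Choose [a] in [A] close to the supremum and [b] in [B] close to the infimum. The part of [A]
    below [a], moved by [b], and the part of [B] above [b], moved by [a], lie in [C] on opposite
    sides of a + b. The two discarded pieces have length at most e / 2 each. Points close to the
    extrema replace attained ones, so neither set has to be closed. *)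
Lemma brunn_minkowski1 (M : R) (A B C : set R) :
  measurable A -> measurable B -> measurable C ->
  A !=set0 -> B !=set0 ->
  (forall x, A x -> `|x| <= M)%R -> (forall x, B x -> `|x| <= M)%R ->
  (forall x y, A x -> B y -> C (x + y)%R) ->
  leb1 A + leb1 B <= leb1 C.
Proof.
move=> mA mB mC A0 B0 AM BM ABC.
have supA : has_sup A.
  by split => //; exists M => x /AM; rewrite ler_norml => /andP[].
have infB : has_inf B.
  by split => //; exists (- M)%R => x /BM; rewrite ler_norml => /andP[].
apply/lee_addgt0Pr => e e0.
have e20 : (0 < e / 2)%R by rewrite divr_gt0.
have [a Aa supa] := sup_adherent e20 supA.
have [b Bb infb] := inf_adherent e20 infB.
pose A1 := A `&` `]-oo, a[; pose B1 := B `&` `]b, +oo[.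
have mA1 : measurable A1 by apply: measurableI => //; exact: measurable_itv.
have mB1 : measurable B1 by apply: measurableI => //; exact: measurable_itv.
have hA : leb1 A <= leb1 A1 + (e / 2)%:E.
  have mi : measurable (`[a, sup A]%classic : set R) by exact: measurable_itv.
  apply: (@le_trans _ _ (leb1 (A1 `|` `[a, sup A]))).
    apply: le_measure; rewrite ?inE//; first exact: measurableU.
    move=> x Ax; have [xa|ax] := ltP x a.
      by left; split => //=; rewrite in_itv.
    by right; rewrite /= in_itv/= ax /=; apply: sup_upper_bound.
  apply: (le_trans (measureU2 _ _ _)) => //; apply: leeD => //.
  rewrite [X in X <= _](@leb1_itv R a (sup A) true false); last by apply: sup_upper_bound.
  by rewrite lee_fin; lra.
have hB : leb1 B <= leb1 B1 + (e / 2)%:E.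
  have mi : measurable (`[inf B, b]%classic : set R) by exact: measurable_itv.
  apply: (@le_trans _ _ (leb1 (B1 `|` `[inf B, b]))).
    apply: le_measure; rewrite ?inE//; first exact: measurableU.
    move=> x Ax; have [xa|ax] := ltP b x.
      by left; split => //=; rewrite in_itv/= andbT.
    by right; rewrite /= in_itv/= ax andbT; apply: inf_lbound => //; case: infB.
  apply: (le_trans (measureU2 _ _ _)) => //; apply: leeD => //.
  rewrite [X in X <= _](@leb1_itv R (inf B) b true false); last by apply: inf_lbound => //; case: infB.
  by rewrite lee_fin; lra.
pose A2 := (fun x => 1 * x + - b)%R @^-1` A1.
pose B2 := (fun x => 1 * x + - a)%R @^-1` B1.
have mshift (c : R) : measurable_fun setT (fun x : R => 1 * x + c)%R.
  by apply: measurable_funD => //; apply: measurable_funM => //; exact: measurable_id.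
have mA2 : measurable A2 by rewrite -[X in measurable X]setTI; exact: mshift.
have mB2 : measurable B2 by rewrite -[X in measurable X]setTI; exact: mshift.
have hC : leb1 A1 + leb1 B1 <= leb1 C.
  rewrite (leb1_affine (-b)%R ltr01 mA1) (leb1_affine (-a)%R ltr01 mB1) !mul1e.
  rewrite -/A2 -/B2 -measureU//; last first.
    apply/seteqP; split => x //= [[_]] + [_]; rewrite /= !in_itv/= andbT => h1 h2.
    by exfalso; lra.
  apply: le_measure; rewrite ?inE//; first exact: measurableU.
  move=> x [[+ _]|[+ _]] => h.
    by rewrite (_ : x = (1 * x + - b) + b)%R; [exact: ABC|ring].
  by rewrite (_ : x = a + (1 * x + - a))%R; [exact: ABC|ring].
apply: (le_trans (leeD hA hB)); rewrite addeACA -EFinD -splitr.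
exact: leeD.
Qed.

End brunn_minkowski1.

(** * The Borell-Brascamp-Lieb inequality *)

Section BBL.
Variable R : realType.

Lemma powRK (x a : R) : 0 <= x -> a != 0 -> (x `^ a) `^ a^-1 = x.
Proof. by move=> x0 a0; rewrite -powRrM divff// powRr1. Qed.

Lemma powRVK (x a : R) : 0 <= x -> a != 0 -> (x `^ a^-1) `^ a = x.
Proof. by move=> x0 a0; rewrite -powRrM mulVf// powRr1. Qed.

(* Hoelder with the exponents [1 / q] and [c / q]. *)
Lemma powR_hoelder2 (c q a b m n : R) : 0 < c -> q^-1 = 1 + c^-1 ->
  0 <= a -> 0 <= b -> 0 <= m -> 0 <= n ->
  ((a * m) `^ q + (b * n) `^ q) `^ q^-1 <= (a + b) * (m `^ c + n `^ c) `^ c^-1.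
Proof.
move=> c0 qE a0 b0 m0 n0.
have ci : 0 < c^-1 by rewrite invr_gt0.
have q0 : 0 < q by rewrite -invr_gt0 qE addr_gt0.
have H1 : 0 < q^-1 by rewrite invr_gt0.
have H2 : 0 < c / q by rewrite divr_gt0.
have H3 : q^-1^-1 + (c / q)^-1 = 1.
  by rewrite invrK invf_div -[X in X + _]mulr1 -mulrDr -qE divff// gt_eqF.
have := @hoelder2 R (a `^ q) (b `^ q) (m `^ q) (n `^ q) q^-1 (c / q)
  (powR_ge0 _ _) (powR_ge0 _ _) (powR_ge0 _ _) (powR_ge0 _ _) H1 H2 H3.
have q0' : q != 0 by rewrite gt_eqF.
have c0' : c != 0 by rewrite gt_eqF.
rewrite (powRK a0 q0') (powRK b0 q0').
have e x : x `^ q `^ (c / q) = x `^ c.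
  by rewrite -powRrM mulrC divfK.
rewrite !e -(powRM _ a0 m0) -(powRM _ b0 n0) => h.
have s0 : 0 <= m `^ c + n `^ c by rewrite addr_ge0// powR_ge0.
have t0 : 0 <= (a * m) `^ q + (b * n) `^ q by rewrite addr_ge0// powR_ge0.
have := ge0_ler_powR (ltW H1) _ _ h.
rewrite !nnegrE t0 mulr_ge0 ?powR_ge0// => /(_ isT isT) h'.
apply: (le_trans h'); rewrite invrK powRM ?powR_ge0// powRK ?addr_ge0//.
by rewrite -powRrM invf_div mulrAC divff// mul1r.
Qed.

Local Open Scope ereal_scope.

(** Normalize [f] and [g] by their suprema. At relative level [t] the superlevel sets add up into
    the superlevel set of [h] at level t Mh, with [Mh] the [c]-mean of the suprema, so
    [brunn_minkowski1] integrated over [t] gives Mh (I / Mf + J / Mg), and Hoelder turns this into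
    the [q]-mean. The form with x + y and no weights suits a homogeneous density. *)
Lemma bbl1 (c q M bf bg I J : R) (f g : R -> R) (h : R -> \bar R) :
  (0 < c)%R -> (q^-1 = 1 + c^-1)%R ->
  measurable_fun setT f -> measurable_fun setT g -> measurable_fun setT h ->
  (forall x, 0 <= f x <= bf)%R -> (forall x, 0 <= g x <= bg)%R -> (forall x, 0 <= h x) ->
  (forall x, 0 < f x -> `|x| <= M)%R -> (forall x, 0 < g x -> `|x| <= M)%R ->
  (forall x y, (0 < f x)%R -> (0 < g y)%R ->
    ((f x `^ c + g y `^ c) `^ c^-1)%:E <= h (x + y)%R) ->
  \int[@leb1 R]_x (f x)%:E = I%:E -> \int[@leb1 R]_x (g x)%:E = J%:E ->
  (0 < I)%R -> (0 < J)%R ->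
  ((I `^ q + J `^ q) `^ q^-1)%:E <= \int[@leb1 R]_x h x.
Proof.
move=> c0 qE mf mg mh f0 g0 h0 fM gM fgh If Ig I0 J0.
(* A positive integral forces a positive supremum; the supremum is approached, so the superlevel
   sets are nonempty at every relative level below 1. *)
have Sup (k : R -> R) b K : (forall x, 0 <= k x <= b)%R -> \int[@leb1 R]_x (k x)%:E = K%:E -> (0 < K)%R ->
    exists s : R, [/\ (0 < s)%R, (forall x, k x <= s)%R & forall t, (t < s)%R -> exists x, (t < k x)%R].
  move=> k0 Ik K0.
  have hs : has_sup (range k).
    by split; [exists (k 0%R); exists 0%R|exists b => _ [x _ <-]; have /andP[] := k0 x].
  exists (sup (range k)); split.
  - rewrite lt_neqAle; apply/andP; split; last first.
      apply: (@le_trans _ _ (k 0%R)); first by have /andP[] := k0 0%R.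
      by apply: sup_upper_bound => //; exists 0%R.
    apply/negP => /eqP s0.
    have : (K%:E = 0 :> \bar R).
      rewrite -Ik; apply: integral0_eq => x _; congr (_%:E).
      apply/eqP; rewrite eq_le; have /andP[-> _] := k0 x; rewrite andbT s0.
      by apply: sup_upper_bound => //; exists x.
    by move=> [] K0'; rewrite K0' ltxx in K0.
  - by move=> x; apply: sup_upper_bound => //; exists x.
  - move=> t ts; have [] := @sup_adherent _ (range k) (sup (range k) - t)%R _ hs.
      by rewrite subr_gt0.
    by move=> _ [x _ <-]; rewrite subKr => ?; exists x.
have [Mf [Mf0 fMf supf]] := Sup f bf I f0 If I0.
have [Mg [Mg0 gMg supg]] := Sup g bg J g0 Ig J0.
pose Mh : R := ((Mf `^ c + Mg `^ c) `^ c^-1)%R.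
have Mh0 : (0 < Mh)%R by rewrite powR_gt0// addr_gt0// powR_gt0.
have lay (k : R -> R) s K : (0 < s)%R -> measurable_fun setT k -> (forall x, 0 <= k x)%R ->
   (forall x, k x <= s)%R -> \int[@leb1 R]_x (k x)%:E = K%:E ->
   \int[@leb1 R]_(t in `]0%R, 1%R[) leb1 [set x | (s * t < k x)%R] = (K / s)%:E.
  move=> s0 mk k0 ks Ik.
  have /(congr1 (fun z => (s^-1)%:E * z)) := @layer_cake R _ _ (@leb1 R) (EFin \o k) s s0
    (measurableT_comp (@EFin_measurable R setT) mk) (fun x => k0 x).
  rewrite muleA -EFinM mulVf ?gt_eqF// mul1e => e.
  rewrite -[LHS]e mulrC EFinM -Ik; congr (_ * _); apply: eq_integral => x _.
  by rewrite min_l// lee_fin.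
have L1 := lay f Mf I Mf0 mf (fun x => proj1 (andP (f0 x))) fMf If.
have L2 := lay g Mg J Mg0 mg (fun x => proj1 (andP (g0 x))) gMg Ig.
have mset d (T : measurableType d) (k : T -> R) (t : R) : measurable_fun setT k -> measurable [set x | (t < k x)%R].
  move=> mk; rewrite (_ : mkset _ = setT `&` k @^-1` `]t, +oo[).
    by apply: mk => //; exact: measurable_itv.
  by rewrite setTI; apply/seteqP; split => x /=; rewrite in_itv/= andbT.
have mh' : measurable_fun setT (fun x => mine (h x) Mh%:E) by exact: measurable_mine.
apply: (@le_trans _ _ (\int[@leb1 R]_x mine (h x) Mh%:E)); last first.
  apply: ge0_le_integral => //; last by move=> x _; rewrite ge_min lexx.
  by move=> x _; rewrite le_min h0 lee_fin ltW.
rewrite layer_cake//.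
apply: (@le_trans _ _ (Mh%:E * (I / Mf + J / Mg)%:E)).
  rewrite -EFinM lee_fin mulrC.
  (* Hoelder for the normalized masses [I / Mf], [J / Mg] and the heights [Mf], [Mg]. *)
  have := powR_hoelder2 (c := c) (a := I / Mf) (b := J / Mg) (m := Mf) (n := Mg) c0 qE.
  by rewrite !divfK ?gt_eqF//; apply; rewrite ?divr_ge0// ltW.
rewrite lee_pmul2l ?lte_fin// EFinD -L1 -L2.
have mI : measurable (`]0%R, 1%R[%classic : set R) by exact: measurable_itv.
have ml (k : R -> R) s : measurable_fun setT k ->
    measurable_fun (`]0%R, 1%R[%classic : set R) (fun t : R => leb1 [set x | (s * t < k x)%R]).
  move=> mk; apply: (@measurable_funTS _ _ _ _ _ (fun t : R => leb1 [set x | (s * t < k x)%R])).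
  exact: (@measurable_layer R _ _ (@leb1 R) (EFin \o k) s (measurableT_comp (@EFin_measurable R setT) mk)).
rewrite -ge0_integralD//; [|exact: ml|exact: ml].
apply: ge0_le_integral => //.
- by move=> t _; exact: adde_ge0.
- by apply: emeasurable_funD; exact: ml.
- by apply: measurable_funTS; exact: measurable_layer.
move=> t /=; rewrite in_itv/= => /andP[t0 t1].
apply: (@brunn_minkowski1 R M) => //; [exact: mset|exact: mset| | | | | |].
- rewrite (_ : mkset _ = setT `&` [set x | (Mh * t)%:E < h x]); last by rewrite setTI.
  exact: emeasurable_fun_o_infty.
- have [x ?] := supf (Mf * t)%R ltac:(by rewrite gtr_pMr); by exists x.
- have [x ?] := supg (Mg * t)%R ltac:(by rewrite gtr_pMr); by exists x.
- by move=> x /= h1; apply: fM; apply: lt_trans h1; exact: mulr_gt0.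
- by move=> x /= h1; apply: gM; apply: lt_trans h1; exact: mulr_gt0.
move=> x y /= fx gy.
have fx0 : (0 < f x)%R by apply: lt_trans fx; exact: mulr_gt0.
have gy0 : (0 < g y)%R by apply: lt_trans gy; exact: mulr_gt0.
apply: lt_le_trans (fgh _ _ fx0 gy0); rewrite lte_fin.
have -> : (Mh * t = (((Mf * t) `^ c + (Mg * t) `^ c) `^ c^-1))%R.
  rewrite !powRM ?ltW// -mulrDl powRM ?addr_ge0 ?powR_ge0//.
  by rewrite powRK ?ltW// gt_eqF.
apply: gt0_ltr_powR; rewrite ?invr_gt0// ?nnegrE ?addr_ge0 ?powR_ge0//.
by apply: ltrD; apply: gt0_ltr_powR; rewrite ?nnegrE ?mulr_ge0// ltW.
Qed.

Lemma integral_box_le k (F : 'rV[R]_k -> R) (M b : R) : (0 <= M)%R ->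
  measurable_fun setT F -> (forall x, 0 <= F x <= b)%R ->
  (forall x, 0 < F x -> box M x)%R ->
  \int[vol R k]_x (F x)%:E <= (b * (2 * M) ^+ k)%:E.
Proof.
move=> M0 mF F0 FM.
rewrite EFinM -vol_box// vol_indic; last exact: measurable_box.
have b0 : (0 <= b)%R by have /andP[? ?] := F0 0%R; exact: (le_trans (y := F 0%R)).
rewrite -ge0_integralZl//; last first.
  by apply: measurable_Eindic; exact: measurable_box.
apply: ge0_le_integral => //.
- by move=> x _; rewrite lee_fin; have /andP[] := F0 x.
- exact/measurable_EFinP.
- by apply: emeasurable_funM => //; apply: measurable_Eindic; exact: measurable_box.
move=> x _; rewrite -EFinM lee_fin indicE.
have [Fx|Fx] := ltP 0%R (F x).
  by rewrite mem_set ?mulr1; [have /andP[] := F0 x|exact: FM].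
by rewrite (le_trans Fx)// mulr_ge0.
Qed.

(** Induction on the dimension. For fixed first coordinates the induction hypothesis says that the
    slice integrals of [F], [G], [H] satisfy the hypothesis of [bbl1] with a new exponent. The
    common bounds and the common box keep all slice integrals finite and uniformly bounded. *)
Lemma bbl k (c q M bf bg I J : R) (F G : 'rV[R]_k -> R) (H : 'rV[R]_k -> \bar R) :
  (0 < c)%R -> (q^-1 = k%:R + c^-1)%R -> (0 <= M)%R ->
  measurable_fun setT F -> measurable_fun setT G -> measurable_fun setT H ->
  (forall x, 0 <= F x <= bf)%R -> (forall x, 0 <= G x <= bg)%R -> (forall x, 0 <= H x) ->
  (forall x, 0 < F x -> box M x)%R -> (forall x, 0 < G x -> box M x)%R ->
  (forall x y, (0 < F x)%R -> (0 < G y)%R ->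
    ((F x `^ c + G y `^ c) `^ c^-1)%:E <= H (x + y)%R) ->
  \int[vol R k]_x (F x)%:E = I%:E -> \int[vol R k]_x (G x)%:E = J%:E ->
  (0 < I)%R -> (0 < J)%R ->
  ((I `^ q + J `^ q) `^ q^-1)%:E <= \int[vol R k]_x H x.
Proof.
move=> c0 + M0; elim: k q I J F G H => [|k IH] q I J F G H qE mF mG mH F0 G0 H0 FM GM FGH FI GJ I0 J0.
  move: FI GJ; rewrite !integral_vol0//; try exact/measurable_EFinP.
  have -> : q = c by rewrite -[q]invrK qE add0r invrK.
  move=> [FI] [GJ]; rewrite -FI -GJ.
  by apply: (le_trans (FGH _ _ _ _)); rewrite ?FI ?GJ// addr0.
have mE (K : 'rV[R]_k.+1 -> R) : measurable_fun setT K -> measurable_fun setT (EFin \o K).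
  by move=> ?; apply/measurable_EFinP.
have mS (K : 'rV[R]_k.+1 -> R) x : measurable_fun setT K -> measurable_fun setT (fun y => K (rcons0 x y)).
  by move=> mK; exact: (measurableT_comp mK (measurable_rcons0 x)).
have bxM (x : R) (y : 'rV[R]_k) : box M (rcons0 x y) -> (`|x| <= M)%R /\ box M y.
  move=> h; split; first by have := h ord0; rewrite rcons00.
  by move=> i; have := h (lift ord0 i); rewrite rcons0S.
pose sl (K : 'rV[R]_k.+1 -> R) x := \int[vol R k]_y (K (rcons0 x y))%:E.
have slf (K : 'rV[R]_k.+1 -> R) (b x : R) : measurable_fun setT K -> (forall x, 0 <= K x <= b)%R -> (forall x, 0 < K x -> box M x)%R ->
    0 <= sl K x <= (b * (2 * M) ^+ k)%:E.
  move=> mK K0 KM; apply/andP; split.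
    by apply: integral_ge0 => y _; rewrite lee_fin; have /andP[] := K0 (rcons0 x y).
  by apply: integral_box_le => //; [exact: mS|move=> y /KM /bxM[]].
have slfin (K : 'rV[R]_k.+1 -> R) (b x : R) : measurable_fun setT K -> (forall x, 0 <= K x <= b)%R -> (forall x, 0 < K x -> box M x)%R ->
    sl K x = (fine (sl K x))%:E.
  move=> mK K0 KM; have /andP[h1 h2] := slf K b x mK K0 KM.
  by rewrite fineK// ge0_fin_numE// (le_lt_trans h2)// ltry.
have msl (K : 'rV[R]_k.+1 -> R) (b : R) : measurable_fun setT K -> (forall x, 0 <= K x <= b)%R -> measurable_fun setT (sl K).
  move=> mK K0; apply: (measurable_slice (mE _ mK)) => x; rewrite lee_fin.
  by have /andP[] := K0 x.
have slM (K : 'rV[R]_k.+1 -> R) (b x : R) : measurable_fun setT K -> (forall x, 0 <= K x <= b)%R -> (forall x, 0 < K x -> box M x)%R ->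
    (0 < fine (sl K x))%R -> (`|x| <= M)%R.
  move=> mK K0 KM; apply: contraTT; rewrite -ltNge => Mx.
  rewrite (_ : sl K x = 0) ?ltxx//; apply: integral0_eq => y _; congr (_%:E).
  apply/eqP; rewrite eq_le; have /andP[-> _] := K0 (rcons0 x y); rewrite andbT leNgt.
  by apply: contraTN Mx => /KM /bxM[]; rewrite leNgt.
rewrite integral_volS//.
(* The exponent for the slices is 1 / (k + 1 / c), which is the [q] of the induction hypothesis; one
   more dimension adds 1 to its inverse. *)
have q0 : (0 < (k%:R + c^-1)^-1 :> R)%R by rewrite invr_gt0 ltr_wpDl// invr_gt0.
have qE' : (q^-1 = 1 + ((k%:R + c^-1)^-1)^-1)%R by rewrite invrK qE -natr1 addrCA addrA.
apply: (@bbl1 (k%:R + c^-1)^-1%R q M (bf * (2 * M) ^+ k)%R (bg * (2 * M) ^+ k)%R I J (fun x => fine (sl F x)) (fun x => fine (sl G x))) => //.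
- exact: (measurableT_comp (@fine_measurable R setT measurableT) (msl F bf mF F0)).
- exact: (measurableT_comp (@fine_measurable R setT measurableT) (msl G bg mG G0)).
- exact: measurable_slice.
- by move=> x; have := slf F bf x mF F0 FM; rewrite (slfin F bf)// !lee_fin.
- by move=> x; have := slf G bg x mG G0 GM; rewrite (slfin G bg)// !lee_fin.
- by move=> x; apply: integral_ge0.
- by move=> x; exact: (slM F bf).
- by move=> x; exact: (slM G bg).
- move=> x y Fx Gy.
  apply: (IH (k%:R + c^-1)^-1%R _ _ (fun z => F (rcons0 x z)) (fun z => G (rcons0 y z))) => //; try rewrite invrK//; try exact: mS.
  + exact: (measurableT_comp mH (measurable_rcons0 _)).
  + by move=> z /FM /bxM[].
  + by move=> z /GM /bxM[].
  + move=> u v Fu Gv; have := FGH _ _ Fu Gv; congr (_ <= H _).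
    apply/rowP => i; case: (unliftP ord0 i) => [j|] ->.
      by rewrite !mxE !liftK mxE.
    by rewrite !mxE unlift_none.
  + exact: (slfin F bf).
  + exact: (slfin G bg).
- rewrite -FI integral_volS//; [|exact: mE|by move=> x; rewrite lee_fin; have /andP[] := F0 x].
  by apply: eq_integral => x _; rewrite -(slfin F bf).
- rewrite -GJ integral_volS//; [|exact: mE|by move=> x; rewrite lee_fin; have /andP[] := G0 x].
  by apply: eq_integral => x _; rewrite -(slfin G bg).
Qed.
End BBL.

(** * Euclidean norm and integrals over balls *)

Section norm2.
Variables (R : realType).

(** The norm that row vectors carry as matrices is the maximum norm, hence a separate Euclidean
    norm. *)
Definition nv k (x : 'rV[R]_k) : R := Num.sqrt (sqnorm x).

Section k.
Variable k : nat.
Implicit Types x y u v : 'rV[R]_k.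

Lemma dotvE x y : dotv x y = (x *m y^T) ord0 ord0.
Proof. by rewrite mxE; apply: eq_bigr => i _; rewrite mxE. Qed.

Lemma dotvC x y : dotv x y = dotv y x.
Proof. by apply: eq_bigr => i _; rewrite mulrC. Qed.

Lemma dotvDl x y v : dotv (x + y) v = dotv x v + dotv y v.
Proof. by rewrite -big_split; apply: eq_bigr => i _ /=; rewrite mxE mulrDl. Qed.

Lemma dotvZl a x v : dotv (a *: x) v = a * dotv x v.
Proof. by rewrite mulr_sumr; apply: eq_bigr => i _ /=; rewrite mxE mulrA. Qed.

Lemma dotvNl x v : dotv (- x) v = - dotv x v.
Proof. by rewrite -scaleN1r dotvZl mulN1r. Qed.

Lemma dotvDr x y v : dotv v (x + y) = dotv v x + dotv v y.
Proof. by rewrite !(dotvC v) dotvDl. Qed.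

Lemma dotvZr a x v : dotv v (a *: x) = a * dotv v x.
Proof. by rewrite !(dotvC v) dotvZl. Qed.

Lemma dotvNr x v : dotv v (- x) = - dotv v x.
Proof. by rewrite !(dotvC v) dotvNl. Qed.

Lemma dot0v x : dotv 0 x = 0.
Proof. by rewrite /dotv big1// => i _; rewrite mxE mul0r. Qed.

Lemma sqnorm_ge0 x : 0 <= sqnorm x.
Proof. by rewrite sqnormE; apply: sumr_ge0 => i _; exact: sqr_ge0. Qed.

Lemma sqnorm_eq0 x : (sqnorm x == 0) = (x == 0).
Proof.
rewrite sqnormE psumr_eq0; last by move=> i _; exact: sqr_ge0.
apply/allP/eqP => [h|-> i _]; last by rewrite /= mxE expr0n eqxx.
apply/rowP => i; have := h i; rewrite mem_index_enum => /(_ isT).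
by rewrite /= sqrf_eq0 mxE => /eqP.
Qed.

Lemma sqnormZ a x : sqnorm (a *: x) = a ^+ 2 * sqnorm x.
Proof. by rewrite -!dotv_sqnorm dotvZl dotvZr mulrA expr2. Qed.

Lemma sqnormN x : sqnorm (- x) = sqnorm x.
Proof. by rewrite -scaleN1r sqnormZ sqrrN expr1n mul1r. Qed.

Lemma sqnormD x y : sqnorm (x + y) = sqnorm x + 2 * dotv x y + sqnorm y.
Proof. by rewrite -!dotv_sqnorm !dotvDl !dotvDr (dotvC y x); ring. Qed.

Lemma nv_ge0 x : 0 <= nv x. Proof. exact: sqrtr_ge0. Qed.

Lemma sqr_nv x : nv x ^+ 2 = sqnorm x.
Proof. by rewrite sqr_sqrtr// sqnorm_ge0. Qed.

Lemma nv_eq0 x : (nv x == 0) = (x == 0).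
Proof. by rewrite -sqrf_eq0 sqr_nv sqnorm_eq0. Qed.

Lemma nv0 : nv (0 : 'rV[R]_k) = 0.
Proof. by apply/eqP; rewrite nv_eq0. Qed.

Lemma nv_gt0 x : (0 < nv x) = (x != 0).
Proof. by rewrite lt_neqAle nv_ge0 andbT eq_sym nv_eq0. Qed.

Lemma nvZ a x : nv (a *: x) = `|a| * nv x.
Proof. by rewrite /nv sqnormZ sqrtrM ?sqr_ge0// sqrtr_sqr. Qed.

Lemma nvN x : nv (- x) = nv x.
Proof. by rewrite /nv sqnormN. Qed.

Lemma le_nv x (r : R) : 0 <= r -> (nv x <= r) = (sqnorm x <= r ^+ 2).
Proof. by move=> r0; rewrite -sqr_nv ler_sqr// nnegrE// nv_ge0. Qed.

Lemma ball2E x : ball2 x <-> nv x <= 1.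
Proof. by rewrite le_nv// expr1n. Qed.

Lemma coord_nv x i : `|x ord0 i| <= nv x.
Proof.
rewrite -(@ler_pXn2r _ 2)// ?nnegrE ?nv_ge0// sqr_nv.
by rewrite real_normK ?num_real// coord_sqnorm.
Qed.

Lemma cauchy_schwarz x y : `|dotv x y| <= nv x * nv y.
Proof.
have [->|y0] := eqVneq y 0; first by rewrite dotvC dot0v normr0 nv0 mulr0.
have s0 : 0 < sqnorm y by rewrite lt_neqAle sqnorm_ge0 andbT eq_sym sqnorm_eq0.
rewrite -(@ler_pXn2r _ 2)// ?nnegrE ?mulr_ge0 ?nv_ge0//.
rewrite exprMn !sqr_nv real_normK ?num_real//.
have := sqnorm_ge0 (x - (dotv x y / sqnorm y) *: y).
rewrite sqnormD sqnormN sqnormZ dotvNr dotvZr => h.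
suff : 0 <= (sqnorm x - dotv x y ^+ 2 / sqnorm y) * sqnorm y.
  by rewrite mulrBl divfK ?gt_eqF// subr_ge0.
apply: mulr_ge0; last exact: ltW.
move: h; congr (_ <= _); field; exact: lt0r_neq0.
Qed.

Lemma nv_triangle x y : nv (x + y) <= nv x + nv y.
Proof.
rewrite le_nv ?addr_ge0 ?nv_ge0// sqnormD sqrrD !sqr_nv lerD2r lerD2l.
rewrite mulr_natl lerMn2r /=; apply: le_trans (cauchy_schwarz _ _).
exact: ler_norm.
Qed.

Lemma nv_le_box x (c : R) : box c x -> nv x <= k%:R * c.
Proof.
case: (posnP k) => [k0|k0] xc.
  have -> : x = 0 by apply/rowP => i; exfalso; case: i => i; rewrite k0.
  by rewrite nv0 k0 mul0r.
have c0 : 0 <= c by apply: le_trans (xc (Ordinal k0)).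
rewrite le_nv ?mulr_ge0// sqnormE.
apply: (@le_trans _ _ (\sum_(i < k) c ^+ 2)).
  apply: ler_sum => i _; rewrite -real_normK ?num_real//.
  by rewrite ler_pXn2r ?nnegrE.
rewrite sumr_const card_ord exprMn -[X in X <= _]mulr_natl ler_wpM2r ?sqr_ge0//.
by rewrite expr2 -natrM ler_nat leq_pmulr.
Qed.

Lemma continuous_sqnorm : continuous (@sqnorm R k).
Proof.
rewrite (_ : @sqnorm R k = fun x => \sum_i x ord0 i ^+ 2); last first.
  by apply/funext => x; exact: sqnormE.
apply: continuous_big => [|i _ x]; first exact: add_continuous.
apply: (@continuous_comp _ _ _ (fun x : 'rV[R]_k => x ord0 i) (fun t => t ^+ 2)).
  exact: coord_continuous.
exact: exprn_continuous.
Qed.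

Lemma continuous_nv : continuous (@nv k).
Proof.
move=> x; apply: (@continuous_comp _ _ _ (@sqnorm R k) Num.sqrt).
  exact: continuous_sqnorm.
exact: sqrt_continuous.
Qed.

Lemma measurable_nv : measurable_fun setT (@nv k).
Proof. exact: (continuous_measurable_rV continuous_nv). Qed.

Lemma measurable_sqnormV : measurable_fun setT (fun x : 'rV[R]_k => (sqnorm x)^-1).
Proof.
rewrite (_ : (fun x => _) = fun x => sqnorm x `^ (-1)).
  by apply: (measurableT_comp (measurable_powR _)); exact: measurable_sqnorm.
by apply/funext => x; rewrite powR_inv1// sqnorm_ge0.
Qed.

Lemma measurable_nvV : measurable_fun setT (fun x : 'rV[R]_k => (nv x)^-1).
Proof.
rewrite (_ : (fun x => _) = fun x => nv x `^ (-1)).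
  by apply: (measurableT_comp (measurable_powR _)); exact: measurable_nv.
by apply/funext => x; rewrite powR_inv1// nv_ge0.
Qed.

Lemma sqnorm_delta i : sqnorm (delta_mx ord0 i : 'rV[R]_k) = 1.
Proof.
rewrite sqnormE (bigD1 i)//= mxE !eqxx expr1n big1 ?addr0// => j ji.
by rewrite mxE (negbTE ji) andbF expr0n.
Qed.

Lemma dotv_delta x i : dotv x (delta_mx ord0 i) = x ord0 i.
Proof.
rewrite /dotv (bigD1 i)//= mxE !eqxx mulr1 big1 ?addr0// => j ji.
by rewrite mxE (negbTE ji) andbF mulr0.
Qed.

Lemma dotv_orthomat (U : 'M[R]_k) x y : orthomat U -> dotv (x *m U) (y *m U) = dotv x y.
Proof.
by rewrite !dotvE => UU; rewrite trmx_mul mulmxA -(mulmxA x) UU mulmx1.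
Qed.

Lemma nv_orthomat (U : 'M[R]_k) x : orthomat U -> nv (x *m U) = nv x.
Proof. by move=> UU; rewrite /nv sqnorm_orthomat. Qed.

Lemma orthomat1 : orthomat (1%:M : 'M[R]_k).
Proof. by rewrite /orthomat trmx1 mulmx1. Qed.

(* The Householder reflection exchanging the [i]-th basis vector and [u]. *)
Lemma exists_orthomat_row (i : 'I_k) u : sqnorm u = 1 ->
  exists2 U : 'M[R]_k, orthomat U & row i U = u.
Proof.
move=> u1; set e := delta_mx ord0 i : 'rV[R]_k.
have [ue|ue] := eqVneq u e.
  by exists 1%:M; [exact: orthomat1|rewrite row1 ue].
pose v := u - e; pose s := sqnorm v; pose c := 2 / s.
have s0 : s != 0 by rewrite sqnorm_eq0 subr_eq0.
have sE : s = 2 * (1 - dotv e u).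
  by rewrite /s /v sqnormD sqnormN dotvNr u1 sqnorm_delta (dotvC e); ring.
have vv : v *m v^T = s%:M.
  by apply/matrixP => a b; rewrite !ord1 -dotvE dotv_sqnorm mxE eqxx mulr1n.
have ev : e *m v^T = (dotv e u - 1)%:M.
  apply/matrixP => a b; rewrite !ord1 -dotvE mxE eqxx mulr1n.
  by rewrite /v dotvDr dotvNr dotv_sqnorm sqnorm_delta.
pose U : 'M[R]_k := 1%:M - c *: (v^T *m v).
have UT : U^T = U.
  by rewrite /U linearB /= trmx1 linearZ /= trmx_mul trmxK.
exists U.
  have AA : (v^T *m v) *m (v^T *m v) = s *: (v^T *m v).
    by rewrite mulmxA -(mulmxA v^T v) vv mul_mx_scalar -scalemxAl.
  rewrite /orthomat UT /U mulmxBr mulmx1 mulmxBl mul1mx -scalemxAl -scalemxAr AA !scalerA.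
  have -> : c * c * s = c + c by rewrite /c -mulrA divfK//; ring.
  by rewrite scalerDl opprB addrK subrK.
rewrite rowE -/e /U mulmxBr mulmx1 -scalemxAr mulmxA ev mul_scalar_mx scalerA.
have -> : c * (dotv e u - 1) = -1.
  by rewrite /c; move: s0; rewrite sE => s0; field; move: s0; rewrite mulf_eq0 negb_or => /andP[].
by rewrite scaleN1r opprK /v addrC subrK.
Qed.

End k.

(** Rotates an integrand that depends on <u, x> into one that depends on the first coordinate, the
    one that [integral_volS] splits off. The case u = 0 is included. *)
Lemma exists_orthomat_first m (u : 'rV[R]_m.+1) :
  exists2 U : 'M[R]_m.+1, orthomat U &
    forall x, dotv u (x *m U) = nv u * x ord0 ord0.
Proof.
have [->|u0] := eqVneq u 0.
  by exists 1%:M; [exact: orthomat1|move=> x; rewrite dot0v nv0 mul0r].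
have nu0 : nv u != 0 by rewrite nv_eq0.
have [|U UU rU] := @exists_orthomat_row _ ord0 ((nv u)^-1 *: u).
  by rewrite sqnormZ exprVn -sqr_nv mulVf// sqrf_eq0.
exists U => // x.
have -> : u = nv u *: (delta_mx ord0 ord0 *m U).
  by rewrite -rowE rU scalerA divff// scale1r.
rewrite dotvZl dotv_orthomat// dotvC dotv_delta nvZ ger0_norm ?nv_ge0//.
by rewrite nv_orthomat// [nv (delta_mx _ _)]/nv sqnorm_delta sqrtr1 mulr1.
Qed.

End norm2.

(** * Radial integrals of homogeneous functions *)

Section power_integrals.
Variable R : realType.

Lemma continuous_powR (a x : R) : 0 < x -> {for x, continuous (@powR R ^~ a)}.
Proof.
move=> x0; apply: differentiable_continuous; apply/derivable1_diffP.
by apply: derivable_powR; rewrite in_itv/= andbT.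
Qed.

Lemma measurable_EpowR (D : set R) (b : R) : measurable_fun D (fun t => (t `^ b)%:E).
Proof.
apply: measurable_funTS; apply/measurable_EFinP; exact: measurable_powR.
Qed.

(** The exponent may have either sign: [hom_integral_neg] leads to a negative one. *)
Lemma integral_powR_tail (a x : R) : a != 0 -> 0 < x <= 1 ->
  (\int[@leb1 R]_(t in `[x, 1%R]) (t `^ (a - 1))%:E = ((1 - x `^ a) / a)%:E)%E.
Proof.
move=> a0 /andP[x0]; rewrite le_eqVlt => /orP[/eqP->|x1].
  rewrite set_itv1 powR1 subrr mul0r -integral_leb1//; last 2 first.
  - exact: measurable_EpowR.
  - by move=> t _; rewrite lee_fin powR_ge0.
  exact: integral_set1.
rewrite -integral_leb1//; last 2 first.
- exact: measurable_EpowR.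
- by move=> t _; rewrite lee_fin powR_ge0.
pose F (t : R) := t `^ a / a.
have dF (t : R) : 0 < t -> is_derive t 1 F (t `^ (a - 1)).
  move=> t0; rewrite (_ : F = (fun t : R => a^-1 *: (t `^ a))); last first.
    by apply/funext => u; rewrite /F mulrC.
  have := is_deriveZ a^-1 (is_derive1_powR a t0).
  by rewrite /GRing.scale /= mulrA mulVf// mul1r.
have cF (t : R) : 0 < t -> {for t, continuous F}.
  move=> t0; apply: cvgM; last exact: cvg_cst.
  exact: continuous_powR.
rewrite (@continuous_FTC2 R (fun t => t `^ (a - 1)) F)//.
- by rewrite /F powR1 -EFinB mulrBl.
- apply: continuous_in_subspaceT => t; rewrite inE /= in_itv/= => /andP[xt _].
  by apply: continuous_powR; exact: lt_le_trans xt.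
- split.
  + move=> t; rewrite in_itv/= => /andP[xt _].
    by have [] := dF t (lt_trans x0 xt).
  + by apply: cvg_at_right_filter; exact: cF.
  + by apply: cvg_at_left_filter; exact: cF.
- move=> t; rewrite in_itv/= => /andP[xt _].
  by rewrite derive1E; exact: (@derive_val _ _ _ _ _ _ _ (dF t (lt_trans x0 xt))).
Qed.

Lemma integral_powR01 (b : R) : 0 <= b ->
  (\int[@leb1 R]_(t in `[0%R, 1%R]) (t `^ b)%:E = ((b + 1)^-1)%:E)%E.
Proof.
move=> b0; have b1 : 0 < b + 1 by rewrite ltr_wpDl.
rewrite -integral_leb1//; last 2 first.
- exact: measurable_EpowR.
- by move=> t _; rewrite lee_fin powR_ge0.
pose F (t : R) := t `^ (b + 1) / (b + 1).
have dF (t : R) : 0 < t -> is_derive t 1 F (t `^ b).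
  move=> t0; rewrite (_ : F = (fun t : R => (b + 1)^-1 *: (t `^ (b + 1)))); last first.
    by apply/funext => u; rewrite /F mulrC.
  have := is_deriveZ (b + 1)^-1 (is_derive1_powR (b + 1) t0).
  by rewrite /GRing.scale /= mulrA mulVf ?gt_eqF// mul1r addrK.
have cF (t : R) : 0 < t -> {for t, continuous F}.
  move=> t0; apply: cvgM; last exact: cvg_cst.
  exact: continuous_powR.
rewrite (@continuous_FTC2 R (fun t => t `^ b) F)//.
- by rewrite /F powR1 powR0 ?gt_eqF// mul0r oppe0 adde0 mul1r.
- move: b0; rewrite le_eqVlt => /orP[/eqP<-|b0].
    rewrite (_ : (fun t => _) = cst 1); last by apply/funext => t; rewrite powRr0.
    by move=> x; exact: cvg_cst.
  apply: derivable_oo_LRcontinuous_within; split.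
  + by move=> t; rewrite in_itv/= => /andP[t0 _]; apply: derivable_powR; rewrite in_itv/= t0.
  + by rewrite powR0 ?gt_eqF//; exact: powR_cvg0.
  + by apply: cvg_at_left_filter; exact: continuous_powR.
- split.
  + move=> t; rewrite in_itv/= => /andP[t0 _].
    by have [] := dF t t0.
  + rewrite {2}/F powR0 ?gt_eqF// mul0r -[X in _ --> X](mul0r (b + 1)^-1).
    by apply: cvgM; [exact: powR_cvg0|exact: cvg_cst].
  + by apply: cvg_at_left_filter; exact: cF.
- move=> t; rewrite in_itv/= => /andP[t0 _].
  by rewrite derive1E; exact: (@derive_val _ _ _ _ _ _ _ (dF t t0)).
Qed.

End power_integrals.

Section ball_integrals.
Local Open Scope ereal_scope.
Variable R : realType.

Lemma gt0_powRD (x r s : R) : (0 < x -> x `^ (r + s) = x `^ r * x `^ s)%R.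
Proof. by move=> x0; rewrite powRD// (gt_eqF x0) implybT. Qed.

Lemma integral_setE d (T : measurableType d) (m : {measure set T -> \bar R})
    (D : set T) (h : T -> R) :
  \int[m]_(t in D) (h t)%:E = \int[m]_t (\1_D t * h t)%:E.
Proof.
rewrite integral_mkcond; apply: eq_integral => t _.
by rewrite patchE indicE; case: ifPn => _; rewrite ?mul1r ?mul0r.
Qed.

(** Scaling by 2 fixes the origin and multiplies volume by 2^(k+1), so the finite volume of the
    origin must vanish. *)
Lemma vol_set0 k : vol R k.+1 [set 0%R] = 0.
Proof.
have m0 : measurable [set (0%R : 'rV[R]_k.+1)].
  by apply: compact_measurable_rV; exact: compact_set1.
have fin : vol R k.+1 [set 0%R] < +oo.
  apply: (@le_lt_trans _ _ (vol R k.+1 (@box R k.+1 1))).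
    apply: le_measure; rewrite ?inE//; first exact: measurable_box.
    by move=> x -> i; rewrite mxE normr0.
  by rewrite vol_box// ltry.
have : vol R k.+1 [set 0%R] = (2 ^+ k.+1)%:E * vol R k.+1 [set 0%R].
  rewrite vol_indic// {1}(@integral_vol_scale _ _ 2%R)//; last exact: measurable_Eindic.
  congr (_ * _); apply: eq_integral => x _; congr (_%:E); apply: indic_eq.
  split => [/= /eqP|/= ->]; last by rewrite scaler0.
  by rewrite scaler_eq0 pnatr_eq0 /= => /eqP.
have : 0 <= vol R k.+1 [set 0%R] by [].
case: (vol R k.+1 [set 0%R]) fin => // v _ v0 [] h; congr (_%:E).
have : ((2 ^+ k.+1 - 1) * v = 0)%R by rewrite mulrBl -h mul1r subrr.
move=> /eqP; rewrite mulf_eq0 => /orP[|/eqP//].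
by rewrite subr_eq0 -[X in _ == X](expr1n _ k.+1) eqrXn2// pnatr_eq1.
Qed.

Section homogeneous.
Variables (k : nat) (d : R) (f : 'rV[R]_k -> R).
Hypotheses (mf : measurable_fun setT f) (f0 : forall x, (0 <= f x)%R)
  (f00 : f 0%R = 0%R)
  (hf : forall a x, (0 < a)%R -> f (a *: x)%R = (a `^ d * f x)%R).

Let measurable_nball (t : R) : measurable [set x : 'rV[R]_k | (nv x <= t)%R].
Proof.
rewrite (_ : mkset _ = setT `&` (@nv R k) @^-1` `]-oo, t]).
  by apply: measurable_nv => //; exact: measurable_itv.
by rewrite setTI; apply/seteqP; split => x /=; rewrite in_itv.
Qed.

Lemma hom_integral_nball (t : R) : (0 < t)%R ->
  \int[vol R k]_x (\1_[set x : 'rV[R]_k | (nv x <= t)%R] x * f x)%:E =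
  (t `^ (k%:R + d))%:E * \int[vol R k]_x (\1_(@ball2 R k) x * f x)%:E.
Proof.
move=> t0.
have mB := @measurable_ball2 R k.
rewrite (@integral_vol_scale _ _ t)//; first last.
- by move=> x; rewrite lee_fin mulr_ge0.
- by apply/measurable_EFinP; apply: measurable_funM => //; exact: measurable_indic.
rewrite gt0_powRD//.
rewrite powR_mulrn ?ltW// EFinM -muleA; congr (_ * _).
rewrite -ge0_integralZl//; first last.
- by rewrite lee_fin powR_ge0.
- by move=> x _; rewrite lee_fin mulr_ge0.
- by apply/measurable_EFinP; apply: measurable_funM => //; exact: measurable_indic.
apply: eq_integral => x _; rewrite -EFinM hf// mulrCA; congr (_ * (_ * _))%R%:E.
apply: indic_eq; rewrite /= nvZ gtr0_norm// ball2E.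
by rewrite -[X in (_ <= X)%R <-> _]mulr1 ler_pM2l.
Qed.

(** Substitute for polar coordinates: (1 - |x|^a) / a is the integral of t^(a-1) over [|x|, 1].
    After Tonelli the inner integral is that of [f] over the ball of radius [t], which scales as
    t^(k+d), and one integral of t^(k+d+a-1) over [0, 1] remains. *)
Lemma hom_integral_tail (a : R) : a != 0%R -> (0 <= k%:R + d + a - 1)%R ->
  \int[vol R k]_x (\1_(@ball2 R k) x * f x * ((1 - nv x `^ a) / a))%:E =
  ((k%:R + d + a)^-1)%:E * \int[vol R k]_x (\1_(@ball2 R k) x * f x)%:E.
Proof.
move=> a0 kda.
pose E := [set z : 'rV[R]_k * R | (nv z.1 <= z.2)%R].
pose D : set R := `]0%R, 1%R]%classic.
have mD : measurable D by exact: measurable_itv.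
have mE : measurable E.
  rewrite (_ : E = setT `&` [set z | ((nv z.1)%:E <= (z.2)%:E)]); last by rewrite setTI.
  apply: emeasurable_fun_le => //; apply/measurable_EFinP; last exact: measurable_snd.
  exact: (measurableT_comp (@measurable_nv R k) measurable_fst).
pose G (z : 'rV[R]_k * R) : \bar R := (\1_D z.2 * (\1_E z * (f z.1 * z.2 `^ (a - 1))))%:E.
have mG : measurable_fun setT G.
  apply/measurable_EFinP; apply: measurable_funM.
    exact: (measurableT_comp (measurable_indic mD) measurable_snd).
  apply: measurable_funM; first exact: measurable_indic.
  apply: measurable_funM; first exact: (measurableT_comp mf measurable_fst).
  exact: (measurableT_comp (measurable_powR _) measurable_snd).
have G0 z : 0 <= G z by rewrite lee_fin !mulr_ge0// powR_ge0.
transitivity (\int[vol R k]_x \int[@leb1 R]_t G (x, t)).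
  apply: eq_integral => x _.
  have [fx|fx] := eqVneq (f x) 0%R.
    rewrite fx mulr0 mul0r; apply/esym; apply: integral0_eq => t _.
    by rewrite /G /= fx mul0r !mulr0.
  have nx0 : (0 < nv x)%R by rewrite nv_gt0; apply: contra_neq fx => ->.
  have [nx1|nx1] := leP (nv x) 1%R; last first.
    rewrite indicE memNset ?mul0r; last by rewrite ball2E leNgt nx1.
    apply/esym; apply: integral0_eq => t _; rewrite /G /=.
    have [/set_mem|] := boolP (t \in D); last by rewrite indicE => /negbTE ->; rewrite mul0r.
    rewrite /D /= in_itv/= => /andP[_ t1].
    rewrite [\1_E _]indicE memNset ?mul0r ?mulr0// /E /= => h.
    by have := lt_le_trans nx1 (le_trans h t1); rewrite ltxx.
  have xB : ball2 x by rewrite ball2E.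
  rewrite indicE mem_set// mul1r EFinM -integral_powR_tail// ?nx0//.
  rewrite integral_setE -ge0_integralZl//; first last.
  - by rewrite lee_fin.
  - by move=> t _; rewrite lee_fin mulr_ge0// powR_ge0.
  - apply/measurable_EFinP; apply: measurable_funM; last exact: measurable_powR.
    by apply: measurable_indic; exact: measurable_itv.
  apply: eq_integral => t _; rewrite -EFinM /G /=; congr (_%:E).
  have -> : (\1_`[nv x, 1%R] t = \1_D t * \1_E (x, t) :> R)%R.
    have -> : (\1_D t * \1_E (x, t) = \1_(D `&` [set t | (nv x <= t)%R]) t :> R)%R.
      by rewrite indicI.
    apply: indic_eq; rewrite /D /= !in_itv/=; split.
      by move=> /andP[h ->]; split => //; rewrite andbT; exact: lt_le_trans nx0 _.
    by move=> [/andP[_ ->] ->].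
  by ring.
rewrite fubini_tonelli//.
set F := \int[vol R k]_x _.
have F0 : 0 <= F by apply: integral_ge0 => x _; rewrite lee_fin mulr_ge0.
transitivity (\int[@leb1 R]_t ((\1_D t * t `^ (k%:R + d + a - 1))%:E * F)).
  apply: eq_integral => t _; rewrite /G /=.
  have [tD|tD] := boolP (t \in D); last first.
    rewrite indicE (negbTE tD) !mul0r mul0e; apply: integral0_eq => x _.
    by rewrite !mul0r.
  rewrite [\1_D t]indicE tD !mul1r.
  have t0 : (0 < t)%R by move: tD => /set_mem; rewrite /D/= in_itv/= => /andP[].
  transitivity ((t `^ (a - 1))%:E * \int[vol R k]_x (\1_[set x : 'rV[R]_k | (nv x <= t)%R] x * f x)%:E).
    rewrite -ge0_integralZl//; first last.
    - by rewrite lee_fin powR_ge0.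
    - by move=> x _; rewrite lee_fin mulr_ge0.
    - by apply/measurable_EFinP; apply: measurable_funM => //; exact: measurable_indic.
    apply: eq_integral => x _; rewrite -EFinM; congr (_%:E).
    have -> : (\1_[set x0 : 'rV[R]_k | (nv x0 <= t)%R] x = \1_E (x, t) :> R)%R by exact: indic_eq.
    by rewrite mul1r; ring.
  rewrite hom_integral_nball// muleA -EFinM -gt0_powRD//.
  by congr ((_ `^ _)%:E * _); ring.
rewrite ge0_integralZr//; last 2 first.
- apply/measurable_EFinP; apply: measurable_funM; last exact: measurable_powR.
  exact: measurable_indic.
- by move=> t _; rewrite lee_fin mulr_ge0// powR_ge0.
congr (_ * _); rewrite -integral_setE.
rewrite -[X in _ = ((X)^-1)%:E](subrK 1%R) -integral_powR01// -!integral_leb1//; first last.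
- by move=> t _; rewrite lee_fin powR_ge0.
- exact: measurable_EpowR.
- by move=> t _; rewrite lee_fin powR_ge0.
- exact: measurable_EpowR.
by rewrite integral_itv_obnd_cbnd//; exact: measurable_EpowR.
Qed.

(** Write |x|^(-a) as 1 + a (1 - |x|^(-a)) / (-a) and apply [hom_integral_tail] with exponent -a;
    the constant is 1 + a / (k + d - a). *)
Lemma hom_integral_neg (a : R) : (0 < a)%R -> (0 <= k%:R + d - a - 1)%R ->
  \int[vol R k]_x (\1_(@ball2 R k) x * f x * nv x `^ (- a))%:E =
  ((k%:R + d) / (k%:R + d - a))%:E * \int[vol R k]_x (\1_(@ball2 R k) x * f x)%:E.
Proof.
move=> a0 kda.
have mB := @measurable_ball2 R k.
have na0 : (- a != 0)%R by rewrite oppr_eq0 gt_eqF.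
have W0 x : (0 <= \1_(@ball2 R k) x * f x * ((1 - nv x `^ (- a)) / - a))%R.
  have [->|x0] := eqVneq x 0%R; first by rewrite f00 mulr0 mul0r.
  rewrite indicE; have [xB|] := boolP (x \in _); last by rewrite !mul0r.
  have -> : ((1 - nv x `^ (- a)) / - a = (nv x `^ (- a) - 1) / a)%R.
    by field; rewrite gt_eqF.
  rewrite mul1r; apply: mulr_ge0 => //; apply: divr_ge0; last exact: ltW.
  rewrite subr_ge0.
  move/set_mem : xB; rewrite ball2E => xB.
  have nx0 : (0 < nv x)%R by rewrite nv_gt0.
  have := ge0_ler_powR (ltW a0) _ _ xB.
  rewrite powR1 !nnegrE nv_ge0 ler01 => /(_ isT isT) h.
  by rewrite powRN invf_ge1// powR_gt0.
have mI : measurable_fun setT (fun x => (\1_(@ball2 R k) x * f x)%R).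
  by apply: measurable_funM => //; exact: measurable_indic.
have mW : measurable_fun setT (fun x => (\1_(@ball2 R k) x * f x * ((1 - nv x `^ (- a)) / - a))%R).
  apply: measurable_funM => //; apply: measurable_funM => //; apply: measurable_funB => //.
  exact: (measurableT_comp (measurable_powR _) (@measurable_nv R k)).
transitivity (\int[vol R k]_x ((\1_(@ball2 R k) x * f x)%:E +
   a%:E * (\1_(@ball2 R k) x * f x * ((1 - nv x `^ (- a)) / - a))%:E)).
  apply: eq_integral => x _; rewrite -EFinM -EFinD; congr (_%:E).
  by field; rewrite gt_eqF.
rewrite ge0_integralD//; last 4 first.
- by move=> x _; rewrite lee_fin mulr_ge0.
- exact/measurable_EFinP.
- by move=> x _; rewrite mule_ge0// lee_fin// ltW.
- by apply: emeasurable_funM => //; apply/measurable_EFinP.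
rewrite ge0_integralZl//; first last.
- by rewrite lee_fin ltW.
- by move=> x _; rewrite lee_fin.
- exact/measurable_EFinP.
rewrite hom_integral_tail// muleA -EFinM.
have F0 : 0 <= \int[vol R k]_x (\1_(@ball2 R k) x * f x)%:E.
  by apply: integral_ge0 => x _; rewrite lee_fin mulr_ge0.
have kda0 : (0 < k%:R + d - a)%R by lra.
rewrite -[X in X + _]mul1e -ge0_muleDl//; last by rewrite lee_fin mulr_ge0// ?invr_ge0 ltW.
rewrite -EFinD; congr (_%:E * _); field; exact: lt0r_neq0.
Qed.

End homogeneous.
End ball_integrals.

(** * Moments of the unit ball *)

Section ball_moments.
Local Open Scope ereal_scope.
Variable R : realType.

Lemma leb_vol k (A : set 'rV[R]_k) : measurable A -> leb A = vol R k A.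
Proof.
move=> mA; rewrite /leb lebintE.
- by rewrite -vol_indic.
- exact: measurable_Eindic.
- by move=> x; rewrite lee_fin.
Qed.

Lemma vol_ball2_omega k : vol R k (@ball2 R k) = (omega R k)%:E.
Proof.
rewrite /omega leb_vol; last exact: measurable_ball2.
by rewrite fineK// ge0_fin_numE// vol_ball2_lty.
Qed.

Lemma omega_gt0 k : (0 < omega R k)%R.
Proof. by rewrite -lte_fin -vol_ball2_omega vol_ball2_gt0. Qed.

(** A function that is homogeneous of degree 0 and vanishes at the origin, as the lemmas on
    homogeneous functions demand; it stands for the constant 1, from which it differs on a null
    set. *)
Definition indneq0 k (x : 'rV[R]_k) : R := (x != 0%R)%:R.

Lemma measurable_indneq0 k : measurable_fun setT (@indneq0 k).
Proof.
rewrite (_ : @indneq0 k = \1_(~` [set 0%R])); last first.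
  apply/funext => x; rewrite indicE /indneq0; congr ((nat_of_bool _)%:R).
  by apply/idP/idP => [/eqP h|/set_mem h]; [exact/mem_set|apply/eqP].
apply: measurable_indic; apply: measurableC; apply: compact_measurable_rV.
exact: compact_set1.
Qed.

Lemma indneq0Z k (a : R) (x : 'rV[R]_k) : (0 < a)%R ->
  indneq0 (a *: x)%R = (a `^ 0 * indneq0 x)%R.
Proof. by move=> a0; rewrite powRr0 mul1r /indneq0 scaler_eq0 gt_eqF. Qed.

Lemma integral_indneq0 k (h : 'rV[R]_k.+1 -> R) : measurable_fun setT h ->
  (forall x, (0 <= h x)%R) ->
  \int[vol R k.+1]_x (h x * indneq0 x)%:E = \int[vol R k.+1]_x (h x)%:E.
Proof.
move=> mh h0; have m0 := @measurable_indneq0 k.+1.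
apply: ge0_ae_eq_integral => //.
- by apply/measurable_EFinP; exact: measurable_funM.
- exact/measurable_EFinP.
- by move=> x _; rewrite lee_fin mulr_ge0.
- by move=> x _; rewrite lee_fin.
exists [set 0%R]; split.
- by apply: compact_measurable_rV; exact: compact_set1.
- exact: vol_set0.
move=> x /=; apply: contra_notP => /eqP x0 _; congr (_%:E).
by rewrite /indneq0 x0 mulr1.
Qed.

(** Total mass of the weight 1/|th|, which becomes the coefficient of the error term. The condition
    on [k] makes the singularity integrable. *)
Lemma integral_ball2_nvV k : (0 < k)%N ->
  \int[vol R k.+1]_x (\1_(@ball2 R k.+1) x * (nv x)^-1)%:E =
  (k.+1%:R / k%:R * omega R k.+1)%:E.
Proof.
move=> k0; have mB := @measurable_ball2 R k.+1.
have h00 : indneq0 (0%R : 'rV[R]_k.+1) = 0%R by rewrite /indneq0 eqxx.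
have h0 (x : 'rV[R]_k.+1) : (0 <= indneq0 x)%R by rewrite /indneq0.
have := @hom_integral_neg R k.+1 0%R (@indneq0 k.+1) (@measurable_indneq0 _) h0 h00 (@indneq0Z _) 1%R ltr01.
rewrite integral_indneq0//.
rewrite -vol_indic// vol_ball2_omega.
rewrite addr0 -[k.+1%:R]natr1 addrK subr_ge0 ler1n => /(_ k0); rewrite -EFinM => <-.
apply: eq_integral => x _; rewrite powR_inv1 ?nv_ge0// -mulrA; congr (_ * _)%:E.
have [->|x0] := eqVneq x 0%R; first by rewrite nv0 invr0 mulr0.
by rewrite /indneq0 x0 mul1r.
Qed.

Lemma integral_ball2_sqnorm k :
  \int[vol R k.+1]_x (\1_(@ball2 R k.+1) x * (1 - sqnorm x))%:E =
  (2 / (k.+1%:R + 2) * omega R k.+1)%:E.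
Proof.
have mB := @measurable_ball2 R k.+1.
have h00 : indneq0 (0%R : 'rV[R]_k.+1) = 0%R by rewrite /indneq0 eqxx.
have h0 (x : 'rV[R]_k.+1) : (0 <= indneq0 x)%R by rewrite /indneq0.
have hk : (0 <= k.+1%:R + 0 + 2 - 1 :> R)%R.
  by rewrite addr0 -addrA addr_ge0// lerBrDr add0r ler1n.
have n2 : (2 != 0 :> R)%R by [].
have := @hom_integral_tail R k.+1 0%R (@indneq0 k.+1) (@measurable_indneq0 _) h0 h00 (@indneq0Z _) 2%R n2 hk.
rewrite integral_indneq0//.
rewrite -vol_indic// vol_ball2_omega addr0 => /(congr1 (fun z => 2%:E * z)).
rewrite -!EFinM mulrA => <-.
have W0 (x : 'rV[R]_k.+1) : (0 <= \1_(@ball2 R k.+1) x * ((1 - sqnorm x) / 2))%R.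
  rewrite indicE; have [/set_mem xB|] := boolP (x \in _); last by rewrite mul0r.
  by rewrite mul1r divr_ge0// subr_ge0.
have mW : measurable_fun setT (fun x : 'rV[R]_k.+1 => \1_(@ball2 R k.+1) x * ((1 - sqnorm x) / 2))%R.
  apply: measurable_funM; first exact: measurable_indic.
  by apply: measurable_funM => //; apply: measurable_funB => //; exact: measurable_sqnorm.
transitivity (2%:E * \int[vol R k.+1]_x (\1_(@ball2 R k.+1) x * ((1 - sqnorm x) / 2))%:E).
  rewrite -ge0_integralZl//; first last.
  - by move=> x _; rewrite lee_fin.
  - exact/measurable_EFinP.
  by apply: eq_integral => x _; rewrite -EFinM; congr (_%:E); field.
congr (_ * _); rewrite -[LHS]integral_indneq0//.
apply: eq_integral => x _; rewrite mulrAC; congr (_ * ((1 - _) / _))%:E.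
by rewrite -[2%R]/(2%:R) powR_mulrn ?nv_ge0// sqr_nv.
Qed.

Lemma integral_leb1_opp (h : R -> \bar R) : measurable_fun setT h -> (forall x, 0 <= h x) ->
  \int[@leb1 R]_x h (- x)%R = \int[@leb1 R]_x h x.
Proof.
move=> mh h0; apply/esym.
rewrite (ge0_integral_image (m1 := @leb1 R) (phi := (fun x => - x)%R : R -> R))//.
- exact: oppr_measurable.
- by move=> A mA; apply/esym; exact: lebesgue_measureN.
Qed.

(** Scaling by the square root of [C] reduces to C = 1, where each half-line contributes 1/2. *)
Lemma integral_leb1_abs (C : R) : (0 <= C)%R ->
  \int[@leb1 R]_t (\1_[set s : R | (s ^+ 2 <= C)%R] t * `|t|)%:E = C%:E.
Proof.
rewrite le_eqVlt => /orP[/eqP<-|C0].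
  apply: integral0_eq => t _; rewrite indicE; case: (boolP (_ \in _)); last by rewrite mul0r.
  move=> /set_mem /= t0; have : (t ^+ 2 == 0 :> R)%R by rewrite eq_le t0 sqr_ge0.
  by rewrite sqrf_eq0 => /eqP ->; rewrite normr0 mulr0.
have mset (c : R) : measurable [set s : R | (s ^+ 2 <= c)%R].
  rewrite (_ : mkset _ = setT `&` (fun s => s ^+ 2)%R @^-1` `]-oo, c]).
    by apply: (exprn_measurable _) => //; exact: measurable_itv.
  by rewrite setTI; apply/seteqP; split => t /=; rewrite in_itv.
have mI c : measurable_fun setT (fun t : R => (\1_[set s : R | (s ^+ 2 <= c)%R] t * `|t|)%:E).
  apply/measurable_EFinP; apply: measurable_funM; first exact: measurable_indic.
  exact: normr_measurable.
pose c := Num.sqrt C; have c0 : (0 < c)%R by rewrite sqrtr_gt0.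
have cE : (c ^+ 2 = C)%R by rewrite sqr_sqrtr// ltW.
rewrite (@integral_leb1_affine R c 0%R)//.
suff h1 : \int[@leb1 R]_t (\1_[set s : R | (s ^+ 2 <= 1)%R] t * `|t|)%:E = 1.
  transitivity (c%:E * (c%:E * \int[@leb1 R]_t (\1_[set s : R | (s ^+ 2 <= 1)%R] t * `|t|)%:E)).
    congr (_ * _); rewrite -ge0_integralZl//; last by rewrite lee_fin ltW.
    apply: eq_integral => t _; rewrite -EFinM addr0 normrM gtr0_norm// mulrCA.
    congr (_ * (_ * _))%:E; apply: indic_eq => /=.
    rewrite exprMn cE -[X in (_ <= X)%R <-> _]mulr1 ler_pM2l//.
  by rewrite h1 mule1 -EFinM -expr2 cE.
pose D1 : set R := `[0%R, 1%R]%classic; pose D2 : set R := [set t | D1 (- t)%R].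
have mD1 : measurable D1 by exact: measurable_itv.
have mD2 : measurable D2.
  rewrite (_ : D2 = setT `&` (fun x : R => - x)%R @^-1` D1); last by rewrite setTI.
  exact: oppr_measurable.
have mI1 (D : set R) : measurable D -> measurable_fun setT (fun t : R => (\1_D t * `|t|)%:E).
  move=> mD; apply/measurable_EFinP; apply: measurable_funM; first exact: measurable_indic.
  exact: normr_measurable.
have I1 : \int[@leb1 R]_t (\1_D1 t * `|t|)%:E = (2^-1)%:E.
  rewrite -(@integral_powR01 R 1%R)// [RHS]integral_setE; apply: eq_integral => t _.
  congr (_%:E); rewrite indicE; have [/set_mem|] := boolP (t \in D1); last by rewrite !mul0r.
  by rewrite /D1 /= in_itv/= => /andP[t0 _]; rewrite powRr1// ger0_norm.
transitivity (\int[@leb1 R]_t ((\1_D1 t * `|t|)%:E + (\1_D2 t * `|t|)%:E)).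
  apply: eq_integral => t _; rewrite -EFinD; congr (_%:E).
  have [->|t0] := eqVneq t 0%R; first by rewrite normr0 !mulr0 addr0.
  rewrite -mulrDl; congr (_ * _)%R.
  have e : (t ^+ 2 <= 1)%R = (`|t| <= 1)%R.
    by rewrite -[in RHS](@ler_pXn2r _ 2)// ?nnegrE// expr1n real_normK ?num_real.
  have h1 : (t \in [set s : R | (s ^+ 2 <= 1)%R]) = (`|t| <= 1)%R.
    by rewrite -e; apply/idP/idP => [/set_mem//|h]; exact/mem_set.
  have h2 : (t \in D1) = (0 <= t <= 1)%R.
    by apply/idP/idP => [/set_mem|h]; [|apply/mem_set]; rewrite /D1/= in_itv.
  have h3 : (t \in D2) = (0 <= - t <= 1)%R.
    by apply/idP/idP => [/set_mem|h]; [|apply/mem_set]; rewrite /D2/D1/= in_itv.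
  rewrite !indicE h1 h2 h3 oppr_ge0.
  move: t0; rewrite neq_lt => /orP[t0|t0].
    by rewrite ltr0_norm// (ltW t0) (lt_geF t0) /= add0r.
  by rewrite gtr0_norm// (ltW t0) (lt_geF t0) /= addr0.
rewrite ge0_integralD//; [|exact: mI1|exact: mI1].
rewrite -[X in _ + X](@integral_leb1_opp)//; last exact: mI1.
rewrite [X in _ + X](_ : _ = (2^-1)%:E).
  by rewrite I1 -EFinD; congr (_%:E); field.
rewrite -I1; apply: eq_integral => t _; rewrite normrN; congr (_ * _)%:E.
by apply: indic_eq; rewrite /D2 /= opprK.
Qed.

Lemma sqnorm_rcons0 k (x : R) (y : 'rV[R]_k) : sqnorm (rcons0 x y) = (x ^+ 2 + sqnorm y)%R.
Proof.
rewrite !sqnormE big_ord_recl rcons00; congr (_ + _)%R.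
by apply: eq_bigr => i _; rewrite rcons0S.
Qed.

(** Integrate over the first coordinate inside: for fixed remaining coordinates [y] it ranges over
    s^2 <= 1 - |y|^2, and |s| integrates to 1 - |y|^2. *)
Lemma integral_ball2_abs0 k :
  \int[vol R k.+2]_x (\1_(@ball2 R k.+2) x * `|x ord0 ord0|)%:E =
  (2 / (k.+1%:R + 2) * omega R k.+1)%:E.
Proof.
have mB := @measurable_ball2 R.
have mI : measurable_fun setT (fun x : 'rV[R]_k.+2 => (\1_(@ball2 R k.+2) x * `|x ord0 ord0|)%:E).
  apply/measurable_EFinP; apply: measurable_funM; first by apply: measurable_indic; exact: mB.
  by apply: (measurableT_comp (@normr_measurable R setT)); exact: measurable_coord.
rewrite integral_volS//.
rewrite (fubini_tonelli (m1 := @leb1 R) (m2 := vol R k.+1)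
  (fun z => (\1_(@ball2 R k.+2) (unc z) * `|unc z ord0 ord0|)%:E))/=; last 2 first.
- by apply: (measurableT_comp mI); exact: measurable_unc.
- by move=> z; rewrite lee_fin mulr_ge0.
rewrite -integral_ball2_sqnorm; apply: eq_integral => y _.
rewrite [in RHS]indicE; have [/set_mem yB|yB] := boolP (y \in _).
  rewrite mul1r -integral_leb1_abs ?subr_ge0//; apply: eq_integral => x _.
  rewrite /unc /= rcons00; congr (_ * _)%:E; apply: indic_eq.
  by rewrite /ball2 /= sqnorm_rcons0 lerBrDr.
rewrite mul0r; apply: integral0_eq => x _; rewrite /unc /= indicE memNset ?mul0r//.
rewrite /ball2 /= sqnorm_rcons0 => h; move/negP : yB; apply; apply/mem_set.
by rewrite /ball2 /=; apply: le_trans h; rewrite lerDr sqr_ge0.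
Qed.

(** Counterpart of the spherical integral of |<u, th>|. A rotation makes the integrand |u| times the
    first coordinate, of degree 1, and [hom_integral_neg] with a = 2 contributes (n+1)/(n-1) for n =
    k+2, which turns 2/(n+1) into 2/(n-1). *)
Lemma integral_ball2_dotv k (u : 'rV[R]_k.+2) :
  \int[vol R k.+2]_x (\1_(@ball2 R k.+2) x * `|dotv u x| * (sqnorm x)^-1)%:E =
  (2 / k.+1%:R * omega R k.+1 * nv u)%:E.
Proof.
have mB := @measurable_ball2 R.
have mc : measurable_fun setT (fun x : 'rV[R]_k.+2 => `|x ord0 ord0|)%R.
  by apply: (measurableT_comp (@normr_measurable R setT)); exact: measurable_coord.
have mV := @measurable_sqnormV R k.+2.
have [U UU uU] := exists_orthomat_first u.
rewrite -(@integral_vol_orthomat _ _ U _ UU); last 2 first.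
- apply/measurable_EFinP; apply: measurable_funM => //; apply: measurable_funM; first by apply: measurable_indic; exact: mB.
  apply: (measurableT_comp (@normr_measurable R setT)).
  by apply: measurable_dotv => //; exact: measurable_id.
- by move=> x; rewrite lee_fin !mulr_ge0// invr_ge0 sqnorm_ge0.
transitivity ((nv u)%:E * \int[vol R k.+2]_x (\1_(@ball2 R k.+2) x * `|x ord0 ord0| * nv x `^ (- 2))%:E).
  rewrite -ge0_integralZl//; first last.
  - by rewrite lee_fin nv_ge0.
  - by move=> x _; rewrite lee_fin !mulr_ge0// powR_ge0.
  - apply/measurable_EFinP; apply: measurable_funM.
      apply: measurable_funM => //; apply: measurable_indic; exact: mB.
    by apply: (measurableT_comp (measurable_powR _)); exact: measurable_nv.
  apply: eq_integral => x _; rewrite -EFinM uU normrM ger0_norm ?nv_ge0//.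
  rewrite sqnorm_orthomat//; congr (_%:E).
  rewrite -[(- 2)%R]/(- (2%:R))%R powR_invn ?nv_ge0// sqr_nv.
  rewrite (_ : \1_(@ball2 R k.+2) (x *m U)%R = \1_(@ball2 R k.+2) x); last first.
    by apply: indic_eq; rewrite /ball2 /= sqnorm_orthomat.
  by ring.
rewrite (@hom_integral_neg R k.+2 1%R (fun x => `|x ord0 ord0|)%R)//.
- rewrite integral_ball2_abs0 -!EFinM; congr (_%:E).
  rewrite -[k.+2%:R]natr1 -[k.+1%:R]natr1.
  have : (0 <= k%:R :> R)%R by [].
  move: (k%:R : R) => a a0; field.
  by do ?(apply/andP; split); apply: lt0r_neq0; lra.
- by rewrite mxE normr0.
- by move=> a x a0; rewrite mxE normrM gtr0_norm// powRr1// ltW.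
Qed.

Lemma measurable_slab k (u : 'rV[R]_k) (e : R) :
  measurable [set y : 'rV[R]_k | (`|dotv u y| <= e)%R].
Proof.
have mabs : measurable_fun setT (fun y : 'rV[R]_k => `|dotv u y|)%R.
  apply: (measurableT_comp (@normr_measurable R setT)).
  by apply: measurable_dotv => //; exact: measurable_id.
rewrite (_ : mkset _ = setT `&` (fun y : 'rV[R]_k => `|dotv u y|)%R @^-1` `]-oo, e]).
  by apply: mabs => //; exact: measurable_itv.
by rewrite setTI; apply/seteqP; split => x /=; rewrite in_itv.
Qed.

(** After rotating [u] to the first axis the slab is |t| <= e/|u|, and each slice of the ball lies
    in the unit ball of one dimension less. In [integral_slabavg_le] the variable is the direction
    and [u] is the point of the body. *)
Lemma vol_ball2_slab k (u : 'rV[R]_k.+1) (e : R) : u != 0%R -> (0 <= e)%R ->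
  vol R k.+1 (@ball2 R k.+1 `&` [set y | (`|dotv u y| <= e)%R])
  <= (2 * e * (nv u)^-1 * omega R k)%:E.
Proof.
move=> u0 e0; set S := _ `&` _.
have mB := @measurable_ball2 R.
have nu0 : (0 < nv u)%R by rewrite nv_gt0.
have mS : measurable S by apply: measurableI; [exact: mB|exact: measurable_slab].
have mI : measurable_fun setT (fun x : 'rV[R]_k.+1 => (\1_S x : R)%:E).
  exact: measurable_Eindic.
have [U UU uU] := exists_orthomat_first u.
rewrite vol_indic// -(@integral_vol_orthomat _ _ U _ UU)//.
rewrite integral_volS//; last first.
  apply: (measurableT_comp mI); apply: measurable_mulmxT; exact: measurable_id.
pose D : set R := `[(- (e / nv u))%R, (e / nv u)%R]%classic.
have mD : measurable D by exact: measurable_itv.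
apply: (@le_trans _ _ (\int[@leb1 R]_t ((\1_D t)%:E * (omega R k)%:E))).
  apply: ge0_le_integral => //.
  - by move=> t _; exact: integral_ge0.
  - apply: (@measurable_slice _ _ (fun x => (\1_S (x *m U)%R)%:E)) => //.
    by apply: (measurableT_comp mI); apply: measurable_mulmxT; exact: measurable_id.
  - by apply: emeasurable_funM => //; exact: measurable_Eindic.
  move=> t _.
  rewrite -vol_ball2_omega vol_indic; last exact: mB.
  rewrite -ge0_integralZl//; last by apply: measurable_Eindic; exact: mB.
  apply: ge0_le_integral => //.
  - apply: (measurableT_comp mI).
    apply: (measurableT_comp (f := fun x => x *m U)%R); last exact: measurable_rcons0.
    by apply: measurable_mulmxT; exact: measurable_id.
  - by apply: emeasurable_funM => //; apply: measurable_Eindic; exact: mB.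
  move=> y _; rewrite -EFinM lee_fin.
  rewrite [X in (X <= _)%R]indicE; have [/set_mem [h1 h2]|_] := boolP (_ \in _); last by rewrite mulr_ge0.
  rewrite !indicE !mem_set ?mulr1//.
  - move: h1; rewrite /ball2 /= sqnorm_orthomat// sqnorm_rcons0.
    by apply: le_trans; rewrite lerDr sqr_ge0.
  - move: h2; rewrite /= uU rcons00 normrM ger0_norm ?nv_ge0// mulrC.
    by rewrite -ler_pdivlMr// /D /= in_itv/= ler_norml.
rewrite ge0_integralZr//; first last.
- by rewrite lee_fin ltW// omega_gt0.
- exact: measurable_Eindic.
rewrite integral_indic ?setIT//.
rewrite [X in X * _](@leb1_itv R _ _ true false); last first.
  have : (0 <= e / nv u)%R by rewrite divr_ge0// ltW.
  by lra.
rewrite -EFinM lee_fin le_eqVlt; apply/orP; left; apply/eqP; ring.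
Qed.

End ball_moments.

(** * Measures with a concave homogeneous density *)

Section bernoulli.
Variable R : realType.

(* Young's inequality for [x + y] and [x ^ (r - 1)] *)
Lemma powR_bernoulli (x y r : R) : 1 < r -> 0 <= x -> 0 <= y ->
  x `^ r + r * x `^ (r - 1) * y <= (x + y) `^ r.
Proof.
move=> r1 x0 y0.
have r0 : 0 < r by lra.
have r10 : 0 < r - 1 by lra.
have := @conjugate_powR R (x + y) (x `^ (r - 1)) r (r / (r - 1)).
rewrite addr_ge0// powR_ge0 r0 divr_gt0// => /(_ isT isT isT isT).
have -> : r^-1 + (r / (r - 1))^-1 = 1 by field; rewrite !gt_eqF.
move=> /(_ erefl); rewrite -powRrM (_ : (r - 1) * (r / (r - 1)) = r); last first.
  by field; rewrite gt_eqF.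
have [->|x0'] := eqVneq x 0.
  by move=> _; rewrite !powR0 ?gt_eqF// mulr0 mul0r !add0r powR_ge0.
have xp : 0 < x by rewrite lt_neqAle eq_sym x0'.
have -> : x `^ r = x * x `^ (r - 1) by rewrite mulr_powRB1.
move: ((x + y) `^ r) (x `^ (r - 1)) => X Y h.
have : r * ((x + y) * Y) <= r * (X / r + x * Y / (r / (r - 1))) by rewrite ler_pM2l.
have -> : r * (X / r + x * Y / (r / (r - 1))) = X + (r - 1) * (x * Y).
  by field; rewrite !gt_eqF.
nra.
Qed.

End bernoulli.

Section box_compact.
Variables (R : realType) (k : nat).

Lemma compact_box (M : R) : compact (@box R k M).
Proof.
rewrite (_ : @box R k M = [set v : 'rV[R]_k | forall i, `[- M, M]%classic (v ord0 i)]).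
  by apply: (@rV_compact R k (fun=> `[- M, M]%classic)) => i; exact: segment_compact.
by apply/seteqP; split => x /= h i; have := h i; rewrite /= in_itv/= ler_norml.
Qed.

Lemma continuous_bounded_box (f : 'rV[R]_k -> R) (M : R) : continuous f ->
  exists2 b : R, 0 <= b & forall x, box M x -> `|f x| <= b.
Proof.
move=> cf.
have : compact (f @` (@box R k M)).
  by apply: continuous_compact; [exact: continuous_subspaceT|exact: compact_box].
move=> /compact_bounded [b [_ hb]].
exists (Num.max 0 (b + 1)); first by rewrite le_max lexx.
move=> x xM; apply: le_trans (_ : b + 1 <= _); last by rewrite le_max lexx orbT.
by apply: (hb (b + 1)); [rewrite ltrDl|exists x].
Qed.

Lemma compact_box_sub (A : set 'rV[R]_k) : compact A ->
  exists2 M : R, 0 < M & A `<=` box M.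
Proof.
move=> /compact_bounded [b [_ hb]].
exists (Num.max 1 (b + 1)); first by rewrite lt_max ltr01.
move=> x Ax i; apply: (@le_trans _ _ (b + 1)); last by rewrite le_max lexx orbT.
apply: le_trans (hb (b + 1) _ x Ax); last by rewrite ltrDl.
rewrite /Num.norm /= mx_normrE.
by apply: (@le_bigmax_cond _ _ _ 0 (ord0, i) xpredT (fun ij => `|x ij.1 ij.2|)).
Qed.

Lemma vol_compact_lty (A : set 'rV[R]_k) : compact A -> (vol R k A < +oo)%E.
Proof.
move=> cA; have [M M0 AM] := compact_box_sub cA.
apply: (@le_lt_trans _ _ (vol R k (@box R k M))); last by rewrite vol_box ?ltry// ltW.
apply: le_measure; rewrite ?inE//; [exact: compact_measurable_rV|exact: measurable_box].
Qed.

Lemma convex_midpoint (A : set 'rV[R]_k) (x y : 'rV[R]_k) :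
  (forall x y l, A x -> A y -> 0 <= l <= 1 -> A (l *: x + (1 - l) *: y)) ->
  A (x - y) -> A (x + y) -> A x.
Proof.
move=> cA Axy Ayx.
have -> : x = 2^-1 *: (x - y) + (1 - 2^-1) *: (x + y).
  have -> : (1 - 2^-1 = 2^-1 :> R) by field.
  by rewrite -scalerDr addrACA addNr addr0 -mulr2n -[x *+ 2]scaler_nat scalerA mulVf ?scale1r// pnatr_eq0.
by apply: cA => //; rewrite invr_ge0 ler0n /= invf_le1// ler1n.
Qed.

End box_compact.

Lemma homogeneity_gt1 (R : realType) (n : nat) (p : R) : (2 <= n)%N -> 0 < p ->
  1 < n%:R + p^-1.
Proof.
move=> n2 p0; apply: (@lt_le_trans _ _ (n%:R : R)); first by rewrite ltr1n.
by rewrite lerDl invr_ge0 ltW.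
Qed.

Section gmeasure.
Local Open Scope ereal_scope.
Variables (R : realType) (n : nat) (g : 'rV[R]_n -> R).
Hypotheses (g0 : forall x, (0 <= g x)%R) (cg : continuous g).

Definition gm (A : set 'rV[R]_n) : \bar R := \int[vol R n]_x (\1_A x * g x)%:E.

Lemma measurable_g : measurable_fun setT g.
Proof. exact: continuous_measurable_rV. Qed.

Lemma measurable_weight (f : 'rV[R]_n -> R) : measurable_fun setT f ->
  measurable_fun setT (fun x => (f x * g x)%:E).
Proof. by move=> mf; apply/measurable_EFinP; apply: measurable_funM => //; exact: measurable_g. Qed.

Lemma measurable_gm_fun (A : set 'rV[R]_n) : measurable A ->
  measurable_fun setT (fun x => (\1_A x * g x)%:E).
Proof. by move=> mA; apply: measurable_weight; exact: measurable_indic. Qed.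

Lemma gm_fun_ge0 (A : set 'rV[R]_n) x : 0 <= (\1_A x * g x)%:E.
Proof. by rewrite lee_fin mulr_ge0. Qed.

Lemma dmeasE (A : set 'rV[R]_n) : measurable A -> dmeas g A = gm A.
Proof.
move=> mA; rewrite /dmeas lebintE//; first exact: measurable_gm_fun.
exact: gm_fun_ge0.
Qed.

Lemma gm_ge0 A : 0 <= gm A.
Proof. by apply: integral_ge0 => x _; exact: gm_fun_ge0. Qed.

Lemma le_gm A B : measurable A -> measurable B -> A `<=` B -> gm A <= gm B.
Proof.
move=> mA mB AB; apply: ge0_le_integral => //.
- by move=> x _; exact: gm_fun_ge0.
- exact: measurable_gm_fun.
- exact: measurable_gm_fun.
move=> x _; rewrite lee_fin ler_wpM2r// !indicE ler_nat.
by have [/set_mem /AB h|//] := boolP (x \in A); rewrite mem_set.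
Qed.

Lemma gm_lty A (M : R) : measurable A -> A `<=` box M -> gm A < +oo.
Proof.
move=> mA AM.
have [M0|M0] := leP 0%R M; last first.
  apply: (@le_lt_trans _ _ (gm (@box R n 0))).
    apply: le_gm => //; first exact: measurable_box.
    by move=> x /AM h i; apply: (le_trans (h i)); exact: ltW.
  rewrite /gm.
  have [b b0 hb] := continuous_bounded_box 0%R cg.
  apply: (@le_lt_trans _ _ (b * (2 * 0) ^+ n)%:E); last exact: ltry.
  apply: integral_box_le => //.
  - by apply: measurable_funM; [apply: measurable_indic; exact: measurable_box|exact: measurable_g].
  - move=> x; rewrite mulr_ge0//= indicE; have [/set_mem xM|_] := boolP (_ \in _); last by rewrite mul0r.
    by rewrite mul1r (le_trans (ler_norm _))// hb.
  - by move=> x; rewrite indicE; have [/set_mem//|_] := boolP (_ \in _); rewrite mul0r ltxx.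
have [b b0 hb] := continuous_bounded_box M cg.
apply: (@le_lt_trans _ _ (b * (2 * M) ^+ n)%:E); last exact: ltry.
apply: integral_box_le => //.
- by apply: measurable_funM; [exact: measurable_indic|exact: measurable_g].
- move=> x; rewrite mulr_ge0//= indicE; have [/set_mem /AM xM|_] := boolP (_ \in _); last by rewrite mul0r.
  by rewrite mul1r (le_trans (ler_norm _))// hb.
- by move=> x; rewrite indicE; have [/set_mem /AM//|_] := boolP (_ \in _); rewrite mul0r ltxx.
Qed.

Lemma dilE (t : R) (A : set 'rV[R]_n) : (0 < t)%R -> dil t A = (fun x => t^-1 *: x)%R @^-1` A.
Proof.
move=> t0; apply/seteqP; split => [_ [x Ax <-]|x /= Ax].
  by rewrite /= scalerA mulVf ?gt_eqF// scale1r.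
by exists (t^-1 *: x)%R => //; rewrite scalerA divff ?gt_eqF// scale1r.
Qed.

Lemma measurable_dil (t : R) (A : set 'rV[R]_n) : (0 < t)%R -> measurable A -> measurable (dil t A).
Proof.
move=> t0 mA; rewrite dilE// -[X in measurable X]setTI.
by apply: measurable_rVZ => //; exact: measurable_id.
Qed.

Variable p : R.
Hypotheses (p0 : (0 < p)%R) (hg : homogeneous p^-1 g) (pg : pconcave p g).

Let r : R := (n%:R + p^-1)%R.

(** Homogeneity with factor 2 at the origin reads g 0 = 2^(1/p) g 0, with a factor above 1. *)
Lemma g_at0 : g 0%R = 0%R.
Proof.
have := @hg 2%R 0%R ltac:(by []); rewrite scaler0.
have : (1 < 2 `^ p^-1 :> R)%R.
  have := @gt0_ltr_powR R p^-1 _ 1%R 2%R; rewrite powR1; apply; rewrite ?nnegrE ?invr_gt0//.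
  by rewrite ltr1n.
by move=> h1 h2; have := g0 0%R; nra.
Qed.

Lemma gm_dil (t : R) (A : set 'rV[R]_n) : (0 < t)%R -> measurable A ->
  gm (dil t A) = (t `^ r)%:E * gm A.
Proof.
move=> t0 mA.
rewrite /gm (@integral_vol_scale _ _ t)//; last 2 first.
- by apply: measurable_gm_fun; exact: measurable_dil.
- by move=> x; exact: gm_fun_ge0.
rewrite /r gt0_powRD// powR_mulrn ?ltW// EFinM -muleA; congr (_ * _).
rewrite -ge0_integralZl//; first last.
- by rewrite lee_fin powR_ge0.
- by move=> x _; exact: gm_fun_ge0.
- exact: measurable_gm_fun.
apply: eq_integral => x _; rewrite -EFinM hg// mulrCA; congr (_ * (_ * _))%:E.
by apply: indic_eq; rewrite dilE//= scalerA mulVf ?gt_eqF// scale1r.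
Qed.

(** Concavity at the midpoint; by homogeneity the factors 2^(-1/p) on the two sides cancel, which
    leaves superadditivity of g^p. *)
Lemma g_superadd x y : (0 < g x)%R -> (0 < g y)%R ->
  ((g x `^ p + g y `^ p) `^ p^-1 <= g (x + y))%R.
Proof.
move=> gx gy; have := @pg 2^-1%R x y; rewrite invr_ge0 ler0n /= invf_le1// ler1n => /(_ isT gx gy).
have -> : (1 - 2^-1 = 2^-1 :> R)%R by field.
rewrite -mulrDr -scalerDr hg// powRM ?addr_ge0 ?powR_ge0//.
by rewrite ler_pM2l// powR_gt0.
Qed.

(** [bbl] with c = p, applied to [g] restricted to the three sets; superadditivity of g^p is its
    pointwise hypothesis. *)
Lemma gm_brunn_minkowski (M a b : R) (A B C : set 'rV[R]_n) : (0 <= M)%R ->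
  measurable A -> measurable B -> measurable C -> A `<=` box M -> B `<=` box M ->
  (forall x y, A x -> B y -> C (x + y)%R) ->
  gm A = a%:E -> gm B = b%:E -> (0 < a)%R -> (0 < b)%R ->
  ((a `^ r^-1 + b `^ r^-1) `^ r)%:E <= gm C.
Proof.
move=> M0 mA mB mC AM BM ABC gA gB a0 b0.
have [bb bb0 hb] := continuous_bounded_box M cg.
have gb (D : set 'rV[R]_n) x : D `<=` box M -> (0 <= \1_D x * g x <= bb)%R.
  move=> DM; rewrite mulr_ge0//= indicE; have [/set_mem /DM xM|_] := boolP (_ \in _); last by rewrite mul0r.
  by rewrite mul1r (le_trans (ler_norm _))// hb.
have gpos (D : set 'rV[R]_n) x : (0 < \1_D x * g x -> D x /\ 0 < g x)%R.
  by rewrite indicE; have [/set_mem xD|_] := boolP (_ \in _); rewrite ?mul0r ?ltxx ?mul1r.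
have gin (D : set 'rV[R]_n) x : D x -> (\1_D x * g x = g x)%R.
  by move=> Dx; rewrite indicE mem_set// mul1r.
have mD (D : set 'rV[R]_n) : measurable D -> measurable_fun setT (fun x => \1_D x * g x)%R.
  by move=> mD; apply: measurable_funM; [exact: measurable_indic|exact: measurable_g].
rewrite -[X in (_ `^ X)%:E]invrK.
apply: (@bbl R n p r^-1%R M bb bb a b (fun x => \1_A x * g x)%R (fun x => \1_B x * g x)%R) => //.
- by rewrite invrK.
- exact: mD.
- exact: mD.
- exact: measurable_gm_fun.
- by move=> x; exact: gb.
- by move=> x; exact: gb.
- by move=> x; exact: gm_fun_ge0.
- by move=> x /gpos[/AM].
- by move=> x /gpos[/BM].
move=> x y /gpos[Ax gx] /gpos[By gy].
by rewrite !gin// ?lee_fin; [exact: g_superadd|exact: ABC].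
Qed.

Hypothesis n2 : (2 <= n)%N.

Let r1 : (1 < r)%R. Proof. exact: homogeneity_gt1. Qed.
Let r0 : (0 < r)%R. Proof. by move: r1; lra. Qed.

(** First-order consequence for an enlargement by a ball of radius [e], whose measure is e^r b:
    [powR_bernoulli] expands (a^q + e b^q)^r from below to first order in [e]. *)
Lemma gm_brunn_minkowski_ball (M a b e : R) (A C : set 'rV[R]_n) : (1 <= M)%R ->
  measurable A -> measurable C -> A `<=` box M ->
  (0 < e <= 1)%R ->
  (forall x y, A x -> nv y <= e -> C (x + y))%R ->
  gm A = a%:E -> gm (@ball2 R n) = b%:E -> (0 < a)%R -> (0 < b)%R ->
  (a + e * (r * a `^ (1 - r^-1) * b `^ r^-1))%:E <= gm C.
Proof.
move=> M1 mA mC AM /andP[e0 e1] AC gA gB a0 b0.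
have mB := @measurable_ball2 R n.
have gE : gm (dil e (@ball2 R n)) = (e `^ r * b)%:E by rewrite gm_dil// gB.
have eb0 : (0 < e `^ r * b)%R by rewrite mulr_gt0// powR_gt0.
have q0 : r^-1%R != 0%R by rewrite invr_eq0 gt_eqF.
apply: le_trans (@gm_brunn_minkowski M a _ A _ C _ mA (measurable_dil e0 mB) mC AM _ _ gA gE a0 eb0).
- rewrite lee_fin powRM ?powR_ge0 ?(ltW b0)// powRK ?gt_eqF ?(ltW e0)//.
  have := @powR_bernoulli R (a `^ r^-1) (e * b `^ r^-1) r r1 (powR_ge0 _ _).
  rewrite mulr_ge0 ?powR_ge0 ?(ltW e0)// => /(_ isT).
  rewrite powRVK ?(ltW a0) ?gt_eqF// -powRrM.
  have -> : (r^-1 * (r - 1) = 1 - r^-1)%R by field; rewrite gt_eqF.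
  by apply: le_trans; rewrite lerD2l le_eqVlt; apply/orP; left; apply/eqP; ring.
- by apply: le_trans M1.
- move=> _ [x /ball2E x1 <-] i; rewrite mxE normrM gtr0_norm//.
  apply: le_trans M1; rewrite mulr_ile1 ?(ltW e0)//.
  exact: le_trans (coord_nv _ _) _.
- move=> x _ Ax [y /ball2E y1 <-]; apply: AC => //.
  by rewrite nvZ gtr0_norm// ger_pMr.
Qed.

(* Rearrangement: among the sets of given [g]-measure the centred ball
   maximizes the integral of [1 / |x|]. *)
Lemma gm_bathtub (a b : R) (A : set 'rV[R]_n) : measurable A ->
  gm A = a%:E -> gm (@ball2 R n) = b%:E -> (0 < b)%R ->
  \int[vol R n]_x (\1_A x * g x * (nv x)^-1)%:E <=
  ((1 - r^-1)^-1 * a `^ (1 - r^-1) * b `^ r^-1)%:E.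
Proof.
move=> mA gA gB b0.
have a0 : (0 <= a)%R by rewrite -lee_fin -gA gm_ge0.
have mV := @measurable_nvV R n.
have V0 (x : 'rV[R]_n) : (0 <= (nv x)^-1)%R by rewrite invr_ge0 nv_ge0.
have q1 : (0 < 1 - r^-1)%R by rewrite subr_gt0 invf_lt1.
have gVm (D : set 'rV[R]_n) : measurable D -> measurable_fun setT (fun x => (\1_D x * g x * (nv x)^-1)%:E).
  move=> mD; apply/measurable_EFinP; apply: measurable_funM => //.
  by apply: measurable_funM; [exact: measurable_indic|exact: measurable_g].
have gV0 (D : set 'rV[R]_n) x : 0 <= (\1_D x * g x * (nv x)^-1)%:E.
  by rewrite lee_fin mulr_ge0// mulr_ge0.
move: a0; rewrite le_eqVlt => /orP[/eqP a00|a0].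
  rewrite -a00 powR0 ?gt_eqF// mulr0 mul0r.
  rewrite (_ : \int[_]_x _ = 0)//.
  have mgA := measurable_gm_fun mA.
  have : ae_eq (vol R n) setT (fun x => (\1_A x * g x)%:E) (cst 0).
    apply/ae_eq_integral_abs => //.
    rewrite -[RHS]/(0%R%:E) a00 -gA; apply: eq_integral => x _.
    by rewrite gee0_abs// gm_fun_ge0.
  move=> h; transitivity (\int[vol R n]_x (cst 0 x : \bar R)); last exact: integral0.
  apply: ge0_ae_eq_integral => //; first exact: gVm.
  apply: filterS h => x h _; have [->] : (\1_A x * g x)%:E = 0%:E := h I.
  by rewrite mul0r.
(* Radius of the centred ball of [g]-measure [a]; measure scales with exponent [r]. *)
pose s : R := ((a / b) `^ r^-1)%R.
have s0 : (0 < s)%R by rewrite powR_gt0// divr_gt0.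
pose S : set 'rV[R]_n := [set x | (nv x <= s)%R].
have mS : measurable S.
  rewrite (_ : S = setT `&` (@nv R n) @^-1` `]-oo, s]).
    by apply: measurable_nv => //; exact: measurable_itv.
  by rewrite setTI; apply/seteqP; split => x /=; rewrite in_itv.
have sr : (s `^ r = a / b)%R by rewrite /s powRVK ?gt_eqF// divr_ge0 ?ltW.
have IS : gm S = (a)%:E.
  have := hom_integral_nball measurable_g g0 hg s0.
  by rewrite -[X in X = _]/(gm S) -[X in _ * X]/(gm (@ball2 R n)) gB => ->; rewrite -/r sr -EFinM divfK// gt_eqF.
pose gV x := (g x * (nv x)^-1)%R.
have mgV : measurable_fun setT gV by apply: measurable_funM => //; exact: measurable_g.
have gV0' x : (0 <= gV x)%R by rewrite mulr_ge0.
have hgV c x : (0 < c)%R -> gV (c *: x)%R = (c `^ (p^-1 - 1) * gV x)%R.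
  move=> c0; rewrite /gV hg// nvZ gtr0_norm// invfM mulrACA; congr (_ * _)%R.
  by rewrite gt0_powRD// powR_inv1// ltW.
have ISV : \int[vol R n]_x (\1_S x * g x * (nv x)^-1)%:E = (a / s * (1 - r^-1)^-1)%:E.
  have := hom_integral_nball mgV gV0' hgV s0.
  have := @hom_integral_neg R n p^-1%R g measurable_g g0 g_at0 hg 1%R ltr01.
  (* The dimension enters here: n >= 2 makes the exponent n + 1/p - 2 nonnegative. *)
  have -> : (0 <= n%:R + p^-1 - 1 - 1 :> R)%R by have := n2; rewrite -(ler_nat R) => n2R; move: n2R (p0); rewrite -invr_gt0; lra.
  move=> /(_ isT).
  have -> : \int[vol R n]_x (\1_(@ball2 R n) x * g x * nv x `^ (-1))%:E =
            \int[vol R n]_x (\1_(@ball2 R n) x * gV x)%:E.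
    by apply: eq_integral => x _; rewrite /gV mulrA powR_inv1// nv_ge0.
  move=> ->; rewrite -[X in _ = _ * (_ * X)]/(gm (@ball2 R n)) gB -!EFinM.
  rewrite (_ : (_ * ((n%:R + p^-1) / (n%:R + p^-1 - 1) * b) = a / s * (1 - r^-1)^-1)%R).
    by move=> <-; apply: eq_integral => x _; rewrite /gV mulrA.
  rewrite addrA -/r gt0_powRD// sr powR_inv1 ?(ltW s0)//; field.
  by rewrite ?gt_eqF//= ?subr_gt0//.
(* Both copies of a / s are read as integrals of g / s, over [S] on the left and over [A] on the
   right. Then the inequality is pointwise, namely (1_A - 1_S) (1/|x| - 1/s) <= 0, and no possibly
   infinite integral is subtracted. *)
have key : \int[vol R n]_x (\1_A x * g x * (nv x)^-1)%:E + (a / s)%:E <=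
    (a / s)%:E + (a / s * (1 - r^-1)^-1)%:E.
  have gs (D : set 'rV[R]_n) : measurable D -> gm D = a%:E -> (a / s)%:E = \int[vol R n]_x (s^-1%:E * (\1_D x * g x)%:E).
    move=> mD gD; rewrite ge0_integralZl//; [|exact: measurable_gm_fun|by move=> x _; exact: gm_fun_ge0|].
      by rewrite -/(gm D) gD -EFinM mulrC.
    by rewrite lee_fin invr_ge0 ltW.
  have ms (D : set 'rV[R]_n) : measurable D -> measurable_fun setT (fun x => s^-1%:E * (\1_D x * g x)%:E).
    by move=> mD; apply: emeasurable_funM => //; exact: measurable_gm_fun.
  have ps (D : set 'rV[R]_n) x : 0 <= s^-1%:E * (\1_D x * g x)%:E.
    by rewrite mule_ge0// ?gm_fun_ge0// lee_fin invr_ge0 ltW.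
  rewrite -ISV {1}(gs S)// (gs A)// -!ge0_integralD//; try exact: ms; try exact: gVm.
  apply: ge0_le_integral => //.
  - by move=> x _; rewrite adde_ge0.
  - by apply: emeasurable_funD; [exact: gVm|exact: ms].
  - by apply: emeasurable_funD; [exact: ms|exact: gVm].
  move=> x _; rewrite -!EFinM -!EFinD lee_fin.
  have [->|x0] := eqVneq x 0%R; first by rewrite g_at0 !mulr0 !mul0r.
  have nx : (0 < nv x)%R by rewrite nv_gt0.
  have gx := g0 x.
  have hS : \1_S x = (nv x <= s)%R%:R :> R.
    by rewrite indicE; congr ((nat_of_bool _)%:R); apply/idP/idP => [/set_mem//|h]; exact/mem_set.
  have hA : (0 <= (\1_A x : R) <= 1)%R by rewrite indicE; case: (_ \in _); rewrite ?lexx ?ler01.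
  rewrite hS; have [xs|xs] := leP (nv x) s.
    have : (s^-1 <= (nv x)^-1)%R by rewrite lef_pV2.
    rewrite mulr1n; move: (nv x)^-1%R s^-1%R => u v uv.
    move: hA => /andP[_]; move: (\1_A x : R) => c c1.
    have : (0 <= (1 - c) * g x * (u - v))%R by rewrite !mulr_ge0 ?subr_ge0.
    by lra.
  have : ((nv x)^-1 <= s^-1)%R by rewrite lef_pV2// ltW.
  rewrite mulr0n; move: (nv x)^-1%R s^-1%R => u v uv.
  move: hA => /andP[+ _]; move: (\1_A x : R) => c c1.
  have : (0 <= c * g x * (v - u))%R by rewrite !mulr_ge0 ?subr_ge0.
  by lra.
move: key; rewrite addeC leeD2lE// => /le_trans; apply.
rewrite lee_fin mulrC -mulrA ler_pM2l ?invr_gt0//.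
rewrite gt0_powRD// powRr1 ?(ltW a0)// powRN -mulrA ler_pM2l//.
rewrite /s powRM ?invr_ge0 ?(ltW a0) ?(ltW b0)// invfM mulrC.
by rewrite -[(b^-1)%R]powR_inv1 ?(ltW b0)// -powRrM mulN1r powRN invrK mulrC.
Qed.

End gmeasure.

(** * Hyperplane sections *)

Section limn_einf_bounds.
Local Open Scope ereal_scope.
Variable R : realType.

Lemma limn_einf_le (u : (\bar R)^nat) C : (forall j, u j <= C) -> limn_einf u <= C.
Proof.
move=> uC; rewrite limn_einf_lim; apply: lime_le; first exact: is_cvg_einfs.
apply: nearW => j; apply: le_trans (uC j).
by apply: ereal_inf_lbound; exists j => /=.
Qed.

Lemma limn_einf_ge (u : (\bar R)^nat) C : (forall j, C <= u j) -> C <= limn_einf u.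
Proof.
move=> uC; rewrite limn_einf_lim; apply: lime_ge; first exact: is_cvg_einfs.
by apply: nearW => j; apply: le_ereal_inf_tmp => _ [i _ <-].
Qed.

Lemma measurable_limn_einf d (T : measurableType d) (f : (T -> \bar R)^nat) :
  (forall j, measurable_fun setT (f j)) ->
  measurable_fun setT (fun x => limn_einf (f ^~ x)).
Proof.
move=> mf; apply: (measurableT_comp (@oppe_measurable R setT)).
apply: (measurable_fun_limn_esup (f := fun j x => - f j x)) => j.
exact: (measurableT_comp (@oppe_measurable R setT)).
Qed.

End limn_einf_bounds.

Section hyperplane_sections.
Local Open Scope ereal_scope.
Variables (R : realType) (k : nat).

Lemma measurable_rcons0T d (T : measurableType d) (a : T -> R) (b : T -> 'rV[R]_k) :
  measurable_fun setT a -> measurable_fun setT b ->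
  measurable_fun setT (fun t => rcons0 (a t) (b t)).
Proof.
move=> ma mb; apply: measurable_fun_rVP => i.
case: (unliftP ord0 i) => [j|] ->.
  under eq_fun do rewrite rcons0S.
  exact: measurable_coordT.
by under eq_fun do rewrite rcons00.
Qed.

(** For a unit vector the choice in [perp_param] has a witness, so its default value is not
    taken. *)
Lemma orth_lastP (th : 'rV[R]_k.+1) : sqnorm th = 1%R ->
  orth_last th (xget 1%:M [set U | orth_last th U]).
Proof.
move=> th1; apply: (@xgetPex _ 1%:M [set U | orth_last th U]).
have [U UU Uth] := exists_orthomat_row ord_max th1.
exists U; split => // j jn; rewrite -Uth; congr (row _ U).
exact: val_inj.
Qed.

(** [perp_param] has the normal as last row of its frame, while [rcons0] splits off the first
    coordinate. The permutation [sg] of the rows reconciles the two, so that Tonelli separates the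
    normal coordinate. *)
Lemma perp_param_frame (th : 'rV[R]_k.+1) : sqnorm th = 1%R ->
  exists V : 'M[R]_k.+1, [/\ orthomat V, row ord0 V = th &
    forall s y, rcons0 s y *m V = (s *: th + perp_param th y)%R].
Proof.
move=> th1; have [] := orth_lastP th1; rewrite /perp_param.
move: (xget _ _) => U UU Uth.
pose sg (i : 'I_k.+1) : 'I_k.+1 :=
  if unlift ord0 i is Some j then widen_ord (leqnSn k) j else ord_max.
have sg0 : sg ord0 = ord_max by rewrite /sg unlift_none.
have sgS j : sg (lift ord0 j) = widen_ord (leqnSn k) j by rewrite /sg liftK.
have sg_inj : injective sg.
  move=> i j; case: (unliftP ord0 i) => [i'|] ->; case: (unliftP ord0 j) => [j'|] ->;
    rewrite ?sg0 ?sgS // => /(congr1 val) /= h.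
  - by congr (lift _ _); exact: val_inj.
  - by have := ltn_ord i'; rewrite h ltnn.
  - by have := ltn_ord j'; rewrite -h ltnn.
pose V : 'M[R]_k.+1 := \matrix_(i, j) U (sg i) j.
have rV i : row i V = row (sg i) U by apply/rowP => j; rewrite !mxE.
exists V; split.
- apply/matrixP => i j.
  have -> : (V *m V^T)%R i j = (U *m U^T)%R (sg i) (sg j).
    by rewrite !mxE; apply: eq_bigr => l _; rewrite !mxE.
  by rewrite UU !mxE (inj_eq sg_inj).
- by rewrite rV sg0; exact: Uth.
move=> s y; rewrite !mulmx_sum_row big_ord_recl rcons00 rV sg0 Uth//.
congr (_ + _)%R; rewrite big_ord_recr /= [X in (_ + X *: _)%R]mxE insubF ?ltnn// scale0r addr0.
apply: eq_bigr => j _; rewrite rcons0S rV sgS mxE /=; congr (_ *: _)%R.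
by case: insubP => [j' _ /val_inj -> //|]; rewrite ltn_ord.
Qed.

Lemma measurable_perp_param (th : 'rV[R]_k.+1) : measurable_fun setT (@perp_param R k.+1 th).
Proof.
apply: measurable_mulmxT; apply: measurable_fun_rVP => i; under eq_fun do rewrite mxE.
case: insubP => [j _ _|_]; last exact: measurable_cst.
exact: measurable_coord.
Qed.

Variables (g : 'rV[R]_k.+1 -> R) (L : set 'rV[R]_k.+1) (t0 : R).
Hypotheses (g0 : forall x, (0 <= g x)%R) (cg : continuous g) (g00 : g 0%R = 0%R)
  (sL : star_body L) (t0_itv : (0 < t0 < 1)%R).

(* The indicator of the interior of [L] is lower semicontinuous, as Fatou
   needs, and star-shapedness puts [t0 *: L] inside that interior. *)
Definition starint (x : 'rV[R]_k.+1) : R := (\1_(L°) (t0 *: x) * g x)%R.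

(** The normalization (j+1)/2 does not depend on [th], whereas the slab has width 2/((j+1)|th|): the
    weight 1/|th| arises by itself. *)
Definition slabavg (j : nat) (th : 'rV[R]_k.+1) : \bar R :=
  \int[vol R k.+1]_x (j.+1%:R / 2 * \1_[set y | (`|dotv th y| <= j.+1%:R^-1)%R] x * starint x)%:E.

Lemma measurable_starint : measurable_fun setT starint.
Proof.
apply: measurable_funM; last exact: continuous_measurable_rV.
have mL : measurable (L°) by apply: open_measurable_rV; exact: open_interior.
apply: (measurableT_comp (measurable_indic mL)).
by apply: measurable_rVZ => //; exact: measurable_id.
Qed.

Lemma starint_ge0 x : (0 <= starint x)%R. Proof. by rewrite mulr_ge0. Qed.

Lemma measurable_slabavg_fun j :
  measurable_fun setT (fun z : 'rV[R]_k.+1 * 'rV[R]_k.+1 =>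
    (j.+1%:R / 2 * \1_[set y | (`|dotv z.2 y| <= j.+1%:R^-1)%R] z.1 * starint z.1)%:E).
Proof.
apply/measurable_EFinP; apply: measurable_funM; last exact: (measurableT_comp measurable_starint measurable_fst).
apply: measurable_funM => //.
have mabs : measurable_fun setT (fun z : 'rV[R]_k.+1 * 'rV[R]_k.+1 => `|dotv z.2 z.1|)%R.
  apply: (measurableT_comp (@normr_measurable R setT)).
  by apply: measurable_dotv; [exact: measurable_snd|exact: measurable_fst].
rewrite (_ : (fun z => _) = \1_(setT `&` (fun z : 'rV[R]_k.+1 * 'rV[R]_k.+1 => `|dotv z.2 z.1|)%R @^-1` `]-oo, (j.+1%:R^-1)%R])).
  by apply: measurable_indic; apply: mabs => //; exact: measurable_itv.
apply/funext => z; apply: indic_eq; rewrite setTI /= in_itv /=; exact: iff_refl.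
Qed.

Lemma slabavg_fun_ge0 j (z : 'rV[R]_k.+1 * 'rV[R]_k.+1) :
  0 <= (j.+1%:R / 2 * \1_[set y | (`|dotv z.2 y| <= j.+1%:R^-1)%R] z.1 * starint z.1)%:E.
Proof. by rewrite lee_fin !mulr_ge0// ?starint_ge0. Qed.

Lemma measurable_slabavg j : measurable_fun setT (slabavg j).
Proof.
exact: (measurable_fun_fubini_tonelli_G (m1 := vol R k.+1) _ (measurable_slabavg_fun j) (slabavg_fun_ge0 j)).
Qed.

Lemma slabavg_ge0 j th : 0 <= slabavg j th.
Proof. by apply: integral_ge0 => x _; exact: (slabavg_fun_ge0 j (x, th)). Qed.

(** Past Fatou the bound is uniform in [j]. For fixed [x] the directions in the ball with |<x,th>|
    <= 1/(j+1) have volume at most 2 omega_k / ((j+1)|x|), which cancels the factor (j+1)/2. At x =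
    0 the density vanishes. *)
Lemma integral_slabavg_le :
  \int[vol R k.+1]_(th in @ball2 R k.+1) limn_einf (slabavg ^~ th) <=
  (omega R k)%:E * \int[vol R k.+1]_x (starint x * (nv x)^-1)%:E.
Proof.
have mB := @measurable_ball2 R k.+1.
apply: le_trans (fatou _ mB _ _) _.
- by move=> j; apply: measurable_funTS; exact: measurable_slabavg.
- by move=> j th _; exact: slabavg_ge0.
have mV : measurable_fun setT (fun x : 'rV[R]_k.+1 => (nv x)^-1)%R.
  rewrite (_ : (fun x => _) = fun x => (nv x `^ (-1))%R).
    by apply: (measurableT_comp (measurable_powR _)); exact: measurable_nv.
  by apply/funext => x; rewrite powR_inv1// nv_ge0.
have V0 (x : 'rV[R]_k.+1) : (0 <= (nv x)^-1)%R by rewrite invr_ge0 nv_ge0.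
have mSV : measurable_fun setT (fun x => (starint x * (nv x)^-1)%:E).
  by apply/measurable_EFinP; apply: measurable_funM => //; exact: measurable_starint.
apply: limn_einf_le => j.
pose G (z : 'rV[R]_k.+1 * 'rV[R]_k.+1) : \bar R := (\1_(@ball2 R k.+1) z.2)%:E *
  (j.+1%:R / 2 * \1_[set y | (`|dotv z.2 y| <= j.+1%:R^-1)%R] z.1 * starint z.1)%:E.
have mG : measurable_fun setT G.
  apply: emeasurable_funM; last exact: measurable_slabavg_fun.
  apply/measurable_EFinP; apply: (measurableT_comp (measurable_indic mB)).
  exact: measurable_snd.
have G0 z : 0 <= G z by rewrite mule_ge0// slabavg_fun_ge0.
have -> : \int[vol R k.+1]_(th in @ball2 R k.+1) slabavg j th =
    \int[vol R k.+1]_th \int[vol R k.+1]_x G (x, th).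
  rewrite integral_mkcond; apply: eq_integral => th _; rewrite patchE.
  have [thB|thB] := boolP (th \in _).
    by apply: eq_integral => x _; rewrite /G /= [\1_(@ball2 R k.+1) th]indicE thB mul1e.
  by apply/esym; apply: integral0_eq => x _; rewrite /G /= [\1_(@ball2 R k.+1) th]indicE (negbTE thB) mul0e.
rewrite -fubini_tonelli// -ge0_integralZl//; first last.
- by rewrite lee_fin ltW// omega_gt0.
- by move=> x _; rewrite lee_fin mulr_ge0// starint_ge0.
apply: ge0_le_integral => //.
- by move=> x _; exact: integral_ge0.
- exact: (measurable_fun_fubini_tonelli_F (m2 := vol R k.+1) G).
- exact: emeasurable_funM.
move=> x _.
have [x0|x0] := eqVneq x 0%R.
  rewrite [X in X <= _](_ : _ = 0).
    by rewrite -EFinM lee_fin mulr_ge0// ?mulr_ge0// ?starint_ge0// ltW// omega_gt0.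
  by apply: integral0_eq => th _; rewrite /G /= /starint x0 g00 !mulr0 mule0.
have mS := measurable_slab x (j.+1%:R^-1)%R.
have j0 : (0 < j.+1%:R :> R)%R by [].
apply: (@le_trans _ _ ((j.+1%:R / 2 * starint x)%:E * vol R k.+1 (@ball2 R k.+1 `&` [set y | (`|dotv x y| <= j.+1%:R^-1)%R]))).
  rewrite vol_indic; last exact: measurableI.
  rewrite -ge0_integralZl//; first last.
  - by rewrite lee_fin mulr_ge0// starint_ge0.
  - by apply: measurable_Eindic; exact: measurableI.
  rewrite le_eqVlt; apply/orP; left; apply/eqP; apply: eq_integral => th _.
  rewrite /G /= -!EFinM indicI /=.
  have -> : (\1_[set y | (`|dotv th y| <= j.+1%:R^-1)%R] x = \1_[set y | (`|dotv x y| <= j.+1%:R^-1)%R] th :> R)%R.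
    by apply: indic_eq; rewrite /= dotvC.
  by congr (_%:E); ring.
apply: (@le_trans _ _ ((j.+1%:R / 2 * starint x)%:E * (2 * j.+1%:R^-1 * (nv x)^-1 * omega R k)%:E)).
  rewrite lee_wpmul2l//; first by rewrite lee_fin mulr_ge0// starint_ge0.
  by apply: vol_ball2_slab => //; rewrite invr_ge0.
rewrite -!EFinM lee_fin le_eqVlt; apply/orP; left; apply/eqP.
have nx0 : nv x != 0%R by rewrite nv_eq0.
have ja : (j.+1%:R : R)%R != 0%R by [].
move: (starint x) (nv x) nx0 (j.+1%:R : R)%R ja => b c c0 a a0; field.
by rewrite a0 c0.
Qed.

(** In a frame adapted to [u] = th/|th|, rescaling the normal coordinate turns the slab into the
    fixed range [-1, 1] and leaves integrands [f j] to which Fatou applies. For a section point [x0]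
    in [L] the point t0 x0 is interior, so the points [xj j], which tend to [x0], are eventually
    counted; off [L] the limit integrand is 0. *)
Lemma hypmeas_le_slabavg (th : 'rV[R]_k.+1) : th != 0%R ->
  (nv th)^-1%:E * hypmeas g L ((nv th)^-1 *: th)%R <= limn_einf (slabavg ^~ th).
Proof.
move=> th0; have nth0 : (0 < nv th)%R by rewrite nv_gt0.
pose u := ((nv th)^-1 *: th)%R.
have u1 : sqnorm u = 1%R by rewrite sqnormZ exprVn -sqr_nv mulVf// sqrf_eq0 gt_eqF.
have thE : th = (nv th *: u)%R by rewrite scalerA divff ?gt_eqF// scale1r.
have [V [VV V0 Vu]] := perp_param_frame u1.
have cL : compact L by case: sL.
have mL : measurable L by exact: compact_measurable_rV.
have mg := continuous_measurable_rV cg.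
pose D : set R := `[(-1)%R, 1%R]%classic.
have mD : measurable D by exact: measurable_itv.
pose f (j : nat) (z : 'rV[R]_k.+1) : \bar R := ((2 * nv th)^-1 * (\1_D (z ord0 ord0) *
  starint (rcons0 (j.+1%:R^-1 / nv th * z ord0 ord0) (rtail z) *m V)))%:E.
have i2 : (0 <= (2 * nv th)^-1)%R by rewrite invr_ge0 mulr_ge0// ltW.
have f0 j z : 0 <= f j z by rewrite lee_fin !mulr_ge0// starint_ge0.
have mz : measurable_fun setT (fun z : 'rV[R]_k.+1 => \1_D (z ord0 ord0) : R).
  by apply: (measurableT_comp (measurable_indic mD)); exact: measurable_coord.
have mf j : measurable_fun setT (f j).
  apply/measurable_EFinP; apply: measurable_funM => //; apply: measurable_funM => //.
  apply: (measurableT_comp measurable_starint); apply: measurable_mulmxT.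
  apply: measurable_rcons0T; last exact: measurable_rtail.
  by apply: measurable_funM => //; exact: measurable_coord.
have slabE j : slabavg j th = \int[vol R k.+1]_z f j z.
  have j0 : (0 < j.+1%:R^-1 / nv th :> R)%R by rewrite divr_gt0// invr_gt0.
  rewrite /slabavg -(@integral_vol_orthomat _ _ V _ VV); last 2 first.
  - exact: (measurableT_comp (measurable_slabavg_fun j) (measurable_pair2 th)).
  - by move=> x; exact: (slabavg_fun_ge0 j (x, th)).
  pose F (z : 'rV[R]_k.+1) : \bar R := (j.+1%:R / 2 * (\1_D (nv th * j.+1%:R * z ord0 ord0) *
    starint (z *m V)))%:E.
  have F0 z : 0 <= F z by rewrite lee_fin !mulr_ge0// starint_ge0.
  have mF : measurable_fun setT F.
    apply/measurable_EFinP; apply: measurable_funM => //; apply: measurable_funM.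
      apply: (measurableT_comp (measurable_indic mD)); apply: measurable_funM => //.
      exact: measurable_coord.
    by apply: (measurableT_comp measurable_starint); apply: measurable_mulmxT; exact: measurable_id.
  transitivity (\int[vol R k.+1]_z F z).
    apply: eq_integral => z _; rewrite /F -mulrA; congr ((_ * (_ * _))%:E).
    apply: indic_eq; rewrite /D /= in_itv/= -ler_norml.
    have -> : dotv th (z *m V) = (nv th * z ord0 ord0)%R.
      rewrite {1}thE dotvZl -V0 rowE dotv_orthomat// dotvC dotv_delta//.
    have -> : (nv th * j.+1%:R * z ord0 ord0 = nv th * z ord0 ord0 * j.+1%:R)%R by ring.
    by rewrite [X in _ <-> (X <= _)%R]normrM [`|j.+1%:R|%R]gtr0_norm// -ler_pdivlMr// div1r.
  rewrite integral_volS// (@integral_leb1_affine R (j.+1%:R^-1 / nv th) 0%R)//; last 2 first.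
  - exact: measurable_slice.
  - by move=> x; exact: integral_ge0.
  rewrite integral_volS// -ge0_integralZl//; first last.
  - by rewrite lee_fin ltW.
  - by move=> x _; exact: integral_ge0.
  - have mF' : measurable_fun setT (fun z : 'rV[R]_k.+1 =>
        F (rcons0 (j.+1%:R^-1 / nv th * z ord0 ord0 + 0) (rtail z))%R).
      apply: (measurableT_comp mF); apply: measurable_rcons0T; last exact: measurable_rtail.
      by apply: measurable_funD => //; apply: measurable_funM => //; exact: measurable_coord.
    have := measurable_slice mF' (fun=> F0 _).
    by congr measurable_fun; apply/funext => x; apply: eq_integral => y _; rewrite rcons00 rtail_cons.
  apply: eq_integral => s _.
  rewrite -ge0_integralZl//; first last.
  - by rewrite lee_fin ltW.
  - exact: (measurableT_comp mF (measurable_rcons0 _)).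
  apply: eq_integral => y _; rewrite /f /F -EFinM rcons00 rtail_cons rcons00 addr0.
  have -> : (nv th * j.+1%:R * (j.+1%:R^-1 / nv th * s) = s)%R.
    by field; rewrite gt_eqF//= gt_eqF.
  congr (_%:E); move: (starint _) (\1_D s : R) => b c.
  field; by rewrite gt_eqF//= gt_eqF.
apply: (@le_trans _ _ (\int[vol R k.+1]_z limn_einf (f ^~ z))); last first.
  rewrite (_ : slabavg ^~ th = fun j => \int[vol R k.+1]_z f j z); last exact/funext.
  exact: fatou.
pose h (y : 'rV[R]_k) : R := (\1_L (perp_param u y) * g (perp_param u y))%R.
have h0 y : (0 <= h y)%R by rewrite mulr_ge0.
have mh : measurable_fun setT h.
  apply: measurable_funM; last exact: (measurableT_comp mg (measurable_perp_param u)).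
  exact: (measurableT_comp (measurable_indic mL) (measurable_perp_param u)).
(* Limit integrand: the range [-1, 1] contributes a factor 2, which leaves 1/|th| times the
   section. *)
pose f' (z : 'rV[R]_k.+1) : \bar R := ((2 * nv th)^-1 * (\1_D (z ord0 ord0) * h (rtail z)))%:E.
have f'0 z : 0 <= f' z by rewrite lee_fin !mulr_ge0.
have mf' : measurable_fun setT f'.
  apply/measurable_EFinP; apply: measurable_funM => //; apply: measurable_funM => //.
  exact: (measurableT_comp mh (@measurable_rtail R k)).
apply: (@le_trans _ _ (\int[vol R k.+1]_z f' z)).
  rewrite integral_volS//.
  have -> : hypmeas g L u = \int[vol R k]_y (h y)%:E.
    by rewrite /hypmeas lebintE//; exact/measurable_EFinP.
  set H := \int[_]_y _; have H0 : 0 <= H by apply: integral_ge0 => y _; rewrite lee_fin.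
  rewrite le_eqVlt; apply/orP; left; apply/eqP.
  transitivity (\int[@leb1 R]_s ((\1_D s)%:E * ((2 * nv th)^-1%:E * H))).
    rewrite ge0_integralZr//; last 2 first.
    - exact: measurable_Eindic.
    - by apply: mule_ge0 => //; rewrite lee_fin.
    rewrite integral_indic// setIT [X in _ = X * _](@leb1_itv R _ _ true false); last by lra.
    rewrite muleA -EFinM; congr (_%:E * _); field; exact: lt0r_neq0.
  apply: eq_integral => s _; rewrite muleA -EFinM /H -ge0_integralZl//; first last.
 - by rewrite lee_fin mulr_ge0.
  - by move=> y _; rewrite lee_fin.
  - exact/measurable_EFinP.
  apply: eq_integral => y _; rewrite /f' rcons00 rtail_cons -EFinM; congr (_%:E); ring.
apply: ge0_le_integral => //.
- exact: measurable_limn_einf.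
move=> z _; have [zD|zD] := boolP (z ord0 ord0 \in D); last first.
  by rewrite {1}/f' [\1_D _]indicE (negbTE zD) mul0r mulr0; exact: limn_einf_ge.
have [/set_mem zL|zL] := boolP (perp_param u (rtail z) \in L); last first.
  by rewrite {1}/f' /h [\1_L _]indicE (negbTE zL) mul0r !mulr0; exact: limn_einf_ge.
set x0 := perp_param u (rtail z) in zL.
pose xj (j : nat) : 'rV[R]_k.+1 := ((j.+1%:R^-1 / nv th * z ord0 ord0) *: u + x0)%R.
have cvx : xj j @[j --> \oo] --> x0.
  rewrite -[X in _ --> X](add0r x0); apply: cvgD; last exact: cvg_cst.
  rewrite -[X in _ --> X](scale0r u); apply: cvgZr_tmp.
  rewrite -[X in _ --> X](mul0r (z ord0 ord0)); apply: cvgMr_tmp.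
  rewrite -[X in _ --> X](mul0r (nv th)^-1%R); apply: cvgMr_tmp.
  exact: cvg_harmonic.
have o : (L°) (t0 *: x0)%R.
  by case: sL => _; apply => //; move: t0_itv => /andP[t00 ->]; rewrite ltW.
have ev : \forall j \near \oo, starint (xj j) = g (xj j).
  have ct : (t0 *: xj j)%R @[j --> \oo] --> (t0 *: x0)%R by exact: cvgZl_tmp.
  have : \forall j \near \oo, (L°) (t0 *: xj j)%R.
    by apply: ct; apply: open_nbhs_nbhs; split => //; exact: open_interior.
  by apply: filterS => j hj; rewrite /starint indicE mem_set// mul1r.
have cvf : (f ^~ z) @ \oo --> f' z.
  have -> : f ^~ z = fun j => ((2 * nv th)^-1 * starint (xj j))%:E.
    by apply/funext => j; rewrite /f [\1_D _]indicE zD mul1r Vu.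
  have -> : f' z = ((2 * nv th)^-1 * g x0)%:E.
    by rewrite /f' /h [\1_D _]indicE zD mul1r indicE mem_set// mul1r.
  apply: cvg_EFin; first exact: nearW.
  have c1 : starint (xj j) @[j --> \oo] --> g x0.
    have c2 : g (xj j) @[j --> \oo] --> g x0 by apply: continuous_cvg => //; exact: cg.
    apply: cvg_trans c2; apply: near_eq_cvg.
    by apply: filterS ev => j ->.
  exact: (cvgMl_tmp c1).
by have [-> _] := cvg_limn_einf_sup cvf.
Qed.

End hyperplane_sections.

(** * Mollified indicators and projections *)

Section bump.
Variables (R : realType) (k : nat) (d : R).
Hypothesis d0 : 0 < d.

(** A squared positive part suffices: it is continuously differentiable, with a Lipschitz gradient
    given by a formula, and all estimates remain algebraic. *)
Definition bump_fun (z : 'rV[R]_k) : R := Num.max 0 (d ^+ 2 - sqnorm z) ^+ 2.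

Definition bump_grad (z : 'rV[R]_k) : 'rV[R]_k :=
  (- 4 * Num.max 0 (d ^+ 2 - sqnorm z)) *: z.

Lemma bump_eq0 z : d <= nv z -> bump_fun z = 0.
Proof.
move=> dz; rewrite /bump_fun max_l ?expr0n// subr_le0 -sqr_nv.
by rewrite ler_sqr ?nnegrE ?nv_ge0// ltW.
Qed.

Lemma bump_grad_eq0 z : d <= nv z -> bump_grad z = 0.
Proof.
move=> dz; rewrite /bump_grad max_l ?mulr0 ?scale0r// subr_le0 -sqr_nv.
by rewrite ler_sqr ?nnegrE ?nv_ge0// ltW.
Qed.

Lemma bump_ge0 z : 0 <= bump_fun z. Proof. exact: sqr_ge0. Qed.

Lemma bump_le z : bump_fun z <= (d ^+ 2) ^+ 2.
Proof.
rewrite /bump_fun ler_sqr ?nnegrE ?le_max ?lexx ?sqr_ge0//.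
by rewrite ge_max sqr_ge0 /= lerBlDr lerDl sqnorm_ge0.
Qed.

Lemma bump_grad_le z i : `|bump_grad z ord0 i| <= 4 * d ^+ 2 * d.
Proof.
have [dz|zd] := leP d (nv z).
  by rewrite bump_grad_eq0// mxE normr0 !mulr_ge0// ltW.
rewrite mxE normrM; apply: ler_pM => //; last exact: le_trans (coord_nv _ _) (ltW zd).
rewrite normrM normrN (@ger0_norm _ 4)// ger0_norm ?le_max ?lexx//.
apply: ler_wpM2l => //.
by rewrite ge_max sqr_ge0 /= lerBlDr lerDl sqnorm_ge0.
Qed.

(** The derivative 2 max(0, t) of max(0, t)^2 is 2-Lipschitz, so the first-order remainder is at
    most (b - a)^2. The proof goes through the four sign patterns. *)
Let cutoff_sqr_taylor (a b : R) :
  `|Num.max 0 b ^+ 2 - Num.max 0 a ^+ 2 - 2 * Num.max 0 a * (b - a)| <= (b - a) ^+ 2.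
Proof.
rewrite ler_norml !expr2.
have sq := sqr_ge0 (b - a); rewrite expr2 in sq.
have [a0|a0] := leP a 0; have [b0|b0] := leP b 0.
- by apply/andP; split; lra.
- have ab : 0 <= - a * b by rewrite mulr_ge0 ?oppr_ge0// ltW.
  have bb : 0 <= b * b by rewrite mulr_ge0// ltW.
  by apply/andP; split; nra.
- have ab : 0 <= a * - b by rewrite mulr_ge0 ?oppr_ge0// ltW.
  have bb : 0 <= a * a by rewrite mulr_ge0// ltW.
  by apply/andP; split; nra.
by apply/andP; split; nra.
Qed.

(** For |z| <= d + 1 the quantity d^2 - |z|^2 changes by at most (2 (d + 1) + 1) |v|, whose square
    is the first part of the constant; the term |v|^2 in that change, multiplied by twice the
    cutoff, gives the part 2 d^2. For larger |z| all terms vanish. *)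
Lemma bump_taylor z v : nv v <= 1 ->
  `|bump_fun (z + v) - bump_fun z - dotv (bump_grad z) v| <=
    ((2 * d + 3) ^+ 2 + 2 * d ^+ 2) * nv v ^+ 2.
Proof.
move=> v1; have v0 := nv_ge0 v.
have [zd|dz] := leP (nv z) (d + 1); last first.
  have h : d <= nv (z + v).
    have := nv_triangle (z + v) (- v); rewrite addrK nvN; lra.
  rewrite (bump_eq0 h) (@bump_eq0 z); last by lra.
  rewrite (@bump_grad_eq0 z); last by lra.
  by rewrite dot0v !subr0 normr0 mulr_ge0 ?addr_ge0 ?sqr_ge0// mulr_ge0// sqr_ge0.
have := cutoff_sqr_taylor (d ^+ 2 - sqnorm z) (d ^+ 2 - sqnorm (z + v)).
rewrite -/(bump_fun z) -/(bump_fun (z + v)) /bump_grad dotvZl sqnormD -(sqr_nv v).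
set m := Num.max _ _ => H.
have m0 : 0 <= m by rewrite le_max lexx.
have md : m <= d ^+ 2 by rewrite ge_max sqr_ge0 /= lerBlDr lerDl sqnorm_ge0.
have t : `|dotv z v| <= (d + 1) * nv v.
  apply: le_trans (cauchy_schwarz _ _) _; exact: ler_wpM2r.
move: H t; move: (dotv z v) (nv v) v0 v1 (bump_fun (z + v)) (bump_fun z) => t w w0 w1 B b H ht.
have e : (d ^+ 2 - (sqnorm z + 2 * t + w ^+ 2) - (d ^+ 2 - sqnorm z)) = - (2 * t + w ^+ 2) by ring.
move: H; rewrite e => H.
have -> : B - b - - 4 * m * t = (B - b - 2 * m * - (2 * t + w ^+ 2)) - 2 * m * w ^+ 2 by ring.
apply: le_trans (ler_normB _ _) _; rewrite [X in _ <= X]mulrDl; apply: lerD.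
  apply: le_trans H _; rewrite sqrrN -exprMn -real_normK ?num_real//.
  rewrite ler_sqr ?nnegrE ?mulr_ge0//; last by rewrite addr_ge0// mulr_ge0// ltW.
  apply: le_trans (ler_normD _ _) _; rewrite normrM [`|2|]ger0_norm// [`|w ^+ 2|]ger0_norm ?sqr_ge0//.
  by nra.
rewrite ger0_norm ?mulr_ge0 ?sqr_ge0//.
by apply: ler_wpM2r; rewrite ?sqr_ge0// ler_pM2l.
Qed.

Lemma continuous_bump : continuous bump_fun.
Proof.
move=> z; apply: (@continuous_comp _ _ _ (fun z => Num.max 0 (d ^+ 2 - sqnorm z)) (fun t => t ^+ 2)).
  apply: (@continuous_comp _ _ _ (fun z => d ^+ 2 - sqnorm z) (fun t => Num.max 0 t)).
    by apply: continuousB; [exact: cst_continuous|exact: continuous_sqnorm].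
  rewrite (_ : (fun t => Num.max 0 t) = fun t : R => (t + `|t|) / 2).
    apply: cvgM; last exact: cvg_cst.
    by apply: cvgD; [exact: cvg_id|exact: norm_continuous].
  apply/funext => t; have [t0|t0] := leP t 0.
    by rewrite ler0_norm// subrr mul0r.
  by rewrite gtr0_norm//; field.
exact: exprn_continuous.
Qed.

Lemma measurable_bump : measurable_fun setT bump_fun.
Proof. exact: (continuous_measurable_rV continuous_bump). Qed.

Lemma measurable_bump_grad_coord i : measurable_fun setT (fun z => bump_grad z ord0 i).
Proof.
apply: measurable_coordT; apply: measurable_rVZ; last exact: measurable_id.
apply: measurable_funM => //; apply: measurable_maxr => //.
by apply: measurable_funB => //; exact: measurable_sqnorm.
Qed.

End bump.

Section mollify.
Variables (R : realType) (k : nat) (d : R) (K : set 'rV[R]_k).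
Hypotheses (d0 : 0 < d) (mK : measurable K) (K_lty : (vol R k K < +oo)%E).

Definition moll (x : 'rV[R]_k) : R := \int[vol R k]_(y in K) bump_fun d (x - y).

(** Integral of the gradient of the bump, coordinate by coordinate. That this is the gradient of
    [moll] is the content of [moll_taylor], without differentiation under the integral sign. *)
Definition moll_grad (x : 'rV[R]_k) : 'rV[R]_k :=
  \row_i \int[vol R k]_(y in K) bump_grad d (x - y) ord0 i.

Definition bump_mass : R := \int[vol R k]_y bump_fun d y.

Let msub (x : 'rV[R]_k) : measurable_fun setT (fun y : 'rV[R]_k => x - y).
Proof. by apply: measurable_rVD => //; apply: measurable_rVN; exact: measurable_id. Qed.

Lemma integrable_bump x : (vol R k).-integrable K (EFin \o (fun y => bump_fun d (x - y))).
Proof.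
apply: measurable_bounded_integrable => //.
  by apply: measurable_funTS; apply: (measurableT_comp (@measurable_bump R k d)); exact: msub.
exists ((d ^+ 2) ^+ 2); split; rewrite ?num_real// => M dM y _ /=.
by rewrite ger0_norm ?bump_ge0// (le_trans (bump_le _ _))// ltW.
Qed.

Lemma integrable_bump_grad x i :
  (vol R k).-integrable K (EFin \o (fun y => bump_grad d (x - y) ord0 i)).
Proof.
apply: measurable_bounded_integrable => //.
  apply: measurable_funTS; apply: (measurableT_comp (@measurable_bump_grad_coord R k d i)); exact: msub.
exists (4 * d ^+ 2 * d); split; rewrite ?num_real// => M dM y _ /=.
by rewrite (le_trans (bump_grad_le _ _ _))// ltW.
Qed.

Lemma integral_vol_reflect (x : 'rV[R]_k) (f : 'rV[R]_k -> \bar R) : measurable_fun setT f ->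
  (forall y, 0 <= f y)%E -> (\int[vol R k]_y f (x - y)%R = \int[vol R k]_y f y)%E.
Proof.
move=> mf f0.
have o : orthomat (- 1%:M : 'M[R]_k) by rewrite /orthomat linearN /= trmx1 mulNmx mulmxN mulmx1 opprK.
rewrite -[RHS](integral_vol_shift x)// -[RHS](integral_vol_orthomat o).
- by apply: eq_integral => y _; rewrite mulmxN mulmx1 addrC.
- by apply: (measurableT_comp mf); apply: measurable_rVD => //; exact: measurable_id.
- by [].
Qed.

Lemma mollE x : (moll x)%:E = (\int[vol R k]_y (bump_fun d y * \1_K (x - y)%R)%:E)%E.
Proof.
rewrite /moll /Rintegral fineK; last exact: integrable_fin_num (integrable_bump x).
rewrite integral_setE -(@integral_vol_reflect x); last 2 first.
- apply/measurable_EFinP; apply: measurable_funM; first exact: measurable_bump.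
  exact: (measurableT_comp (measurable_indic mK) (msub x)).
- by move=> y; rewrite lee_fin mulr_ge0// bump_ge0.
by apply: eq_integral => y _; rewrite opprB addrCA subrr addr0 mulrC.
Qed.

Lemma moll_ge0 x : 0 <= moll x.
Proof. by apply: Rintegral_ge0 => y _; exact: bump_ge0. Qed.

Lemma measurable_moll : measurable_fun setT moll.
Proof.
rewrite (_ : moll = fun x => fine (\int[vol R k]_y (bump_fun d y * \1_K (x - y)%R)%:E)%E); last first.
  by apply/funext => x; rewrite -mollE.
apply: (measurableT_comp (@fine_measurable R setT measurableT)).
pose F (z : 'rV[R]_k * 'rV[R]_k) := (bump_fun d z.2 * \1_K (z.1 - z.2)%R)%:E.
apply: (measurable_fun_fubini_tonelli_F (m2 := vol R k) F).
  apply/measurable_EFinP; apply: measurable_funM.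
    exact: (measurableT_comp (@measurable_bump R k d) measurable_snd).
  apply: (measurableT_comp (measurable_indic mK)).
  by apply: measurable_rVD => //; apply: measurable_rVN; exact: measurable_snd.
by move=> z; rewrite lee_fin mulr_ge0// bump_ge0.
Qed.

Lemma bump_massE : (bump_mass%:E = \int[vol R k]_y (bump_fun d y)%:E)%E.
Proof.
rewrite /bump_mass /Rintegral fineK// ge0_fin_numE; last first.
  by apply: integral_ge0 => y _; rewrite lee_fin bump_ge0.
apply: (@le_lt_trans _ _ ((d ^+ 2) ^+ 2 * (2 * d) ^+ k)%:E); last exact: ltry.
apply: integral_box_le => //; first exact: ltW.
- exact: measurable_bump.
- by move=> x; rewrite bump_ge0 bump_le.
move=> x; have [dx|xd _ i] := leP d (nv x); first by rewrite bump_eq0// ltxx.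
exact: le_trans (coord_nv _ _) (ltW xd).
Qed.

Lemma bump_mass_gt0 : 0 < bump_mass.
Proof.
rewrite -lte_fin bump_massE.
(* On the ball of radius d / 2 the bump is at least the constant [m]. *)
pose c := d / 2; have c0 : 0 < c by rewrite divr_gt0.
pose m := (3 / 4 * d ^+ 2) ^+ 2; have m0 : 0 < m by rewrite exprn_gt0// mulr_gt0// exprn_gt0.
have mB := @measurable_ball2 R k.
have mD := measurable_dil c0 mB.
pose D : set 'rV[R]_k := dil c (@ball2 R k).
apply: (@lt_le_trans _ _ (\int[vol R k]_y (m%:E * (\1_D y : R)%:E))%E); last first.
  apply: ge0_le_integral => //.
  - by move=> y _; rewrite -EFinM lee_fin mulr_ge0// ltW.
  - by apply: emeasurable_funM => //; exact: measurable_Eindic.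
  - by apply/measurable_EFinP; exact: measurable_bump.
  move=> y _; rewrite -EFinM lee_fin indicE.
  have [/set_mem [z /ball2E z1 <-]|_] := boolP (_ \in _); last by rewrite mulr0 bump_ge0.
  rewrite mulr1 /m /bump_fun ler_sqr ?nnegrE ?le_max ?lexx ?mulr_ge0 ?(ltW d0)//.
  apply/orP; right; rewrite sqnormZ -sqr_nv.
  have z2 : nv z ^+ 2 <= 1 by rewrite expr_le1// nv_ge0.
  have c2 : c ^+ 2 = d ^+ 2 / 4 by rewrite /c expr_div_n; congr (_ / _); ring.
  have : c ^+ 2 * nv z ^+ 2 <= c ^+ 2 by rewrite ler_piMr ?sqr_ge0.
  by rewrite c2; lra.
rewrite (@ge0_integralZl _ _ _ (vol R k) _ measurableT (fun y => (\1_D y : R)%:E))//; last 2 first.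
- exact: measurable_Eindic.
- by rewrite lee_fin ltW.
rewrite mule_gt0 ?lte_fin//.
rewrite (@integral_vol_scale _ _ c)//; last exact: measurable_Eindic.
rewrite mule_gt0 ?lte_fin ?exprn_gt0//.
rewrite (eq_integral (fun x => (\1_(@ball2 R k) x)%:E)); last first.
  by move=> x _; congr (_%:E); apply: indic_eq; rewrite /D dilE//= scalerA mulVf ?gt_eqF// scale1r.
by rewrite -vol_indic// vol_ball2_gt0.
Qed.

Lemma moll_le x : moll x <= bump_mass.
Proof.
rewrite -lee_fin mollE bump_massE; apply: ge0_le_integral => //.
- by move=> y _; rewrite lee_fin mulr_ge0// bump_ge0.
- apply/measurable_EFinP; apply: measurable_funM; first exact: measurable_bump.
  exact: (measurableT_comp (measurable_indic mK) (msub x)).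
- by apply/measurable_EFinP; exact: measurable_bump.
by move=> y _; rewrite lee_fin ler_piMr ?bump_ge0.
Qed.

Lemma moll_inner x : (forall y, nv y < d -> K (x - y)) -> moll x = bump_mass.
Proof.
move=> Kx; suff : (moll x)%:E = bump_mass%:E by case.
rewrite mollE bump_massE; apply: eq_integral => y _.
have [dy|yd] := leP d (nv y); first by rewrite bump_eq0// mul0r.
by rewrite indicE mem_set ?mulr1//; exact: Kx.
Qed.

Lemma moll_outer x : (forall y, nv y < d -> ~ K (x - y)) -> moll x = 0.
Proof.
move=> Kx; suff : (moll x)%:E = 0%:E by case.
rewrite mollE; apply: integral0_eq => y _.
have [dy|yd] := leP d (nv y); first by rewrite bump_eq0// mul0r.
by rewrite indicE memNset ?mulr0//; exact: Kx.
Qed.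

Lemma moll_grad_outer x : (forall y, nv y < d -> ~ K (x - y)) -> moll_grad x = 0.
Proof.
move=> Kx; apply/rowP => i; rewrite !mxE /Rintegral.
rewrite [X in fine X](_ : _ = 0%E)//; apply: integral0_eq => y Ky.
rewrite bump_grad_eq0 ?mxE// leNgt; apply/negP => /Kx; apply.
by rewrite opprB addrCA subrr addr0.
Qed.

Let measurable_bump_indic x : measurable_fun setT (fun y => (bump_fun d y * \1_K (x - y)%R)%:E).
Proof.
apply/measurable_EFinP; apply: measurable_funM; first exact: measurable_bump.
exact: (measurableT_comp (measurable_indic mK) (msub x)).
Qed.

Lemma measurable_bump_diff a b : measurable_fun setT
  (fun y => (bump_fun d y * `|\1_K (a - y)%R - \1_K (b - y)%R|)%:E).
Proof.
apply/measurable_EFinP; apply: measurable_funM; first exact: measurable_bump.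
apply: (measurableT_comp (@normr_measurable R setT)); apply: measurable_funB.
  exact: (measurableT_comp (measurable_indic mK) (msub a)).
exact: (measurableT_comp (measurable_indic mK) (msub b)).
Qed.

Lemma moll_diff_le a b : (`|moll a - moll b|%:E <=
  \int[vol R k]_y (bump_fun d y * `|\1_K (a - y)%R - \1_K (b - y)%R|)%:E)%E.
Proof.
have half u v : ((moll u)%:E <= (moll v)%:E +
    \int[vol R k]_y (bump_fun d y * `|\1_K (u - y)%R - \1_K (v - y)%R|)%:E)%E.
  rewrite !mollE -ge0_integralD//.
  - apply: ge0_le_integral => //.
    + by move=> y _; rewrite lee_fin mulr_ge0// bump_ge0.
    + by apply: emeasurable_funD => //; exact: measurable_bump_diff.
    move=> y _; rewrite -EFinD lee_fin -mulrDr ler_wpM2l ?bump_ge0//.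
    by rewrite -lerBlDl ler_norm.
  - by move=> y _; rewrite lee_fin mulr_ge0// bump_ge0.
  - by move=> y _; rewrite lee_fin mulr_ge0// bump_ge0.
  - exact: measurable_bump_diff.
have [ab|ba] := leP (moll b) (moll a).
  by rewrite ger0_norm ?subr_ge0// EFinB leeBlDl.
rewrite ltr0_norm ?subr_lt0// opprB EFinB leeBlDl//.
by rewrite (eq_integral (fun y => (bump_fun d y * `|\1_K (b - y)%R - \1_K (a - y)%R|)%:E))// => y _; rewrite distrC.
Qed.

(** The remainder bound of [bump_taylor] integrated over [K]; [int_sum] carries the finite sum in
    the scalar product through the integral, together with integrability. *)
Lemma moll_taylor x v : nv v <= 1 ->
  `|moll (x + v) - moll x - dotv (moll_grad x) v| <=
  ((2 * d + 3) ^+ 2 + 2 * d ^+ 2) * fine (vol R k K) * nv v ^+ 2.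
Proof.
move=> v1; set C := (2 * d + 3) ^+ 2 + 2 * d ^+ 2.
have C0 : 0 <= C by rewrite addr_ge0 ?sqr_ge0// mulr_ge0 ?sqr_ge0.
have I1 i : (vol R k).-integrable K (EFin \o (fun y => bump_grad d (x - y) ord0 i * v ord0 i)).
  apply: (eq_integrable mK _ _ _ (integrableZr mK (v ord0 i) (integrable_bump_grad x i))) => y _ /=.
  by rewrite EFinM.
have int_sum (s : seq 'I_k) :
    (vol R k).-integrable K (EFin \o (fun y => \sum_(i <- s) bump_grad d (x - y) ord0 i * v ord0 i)) /\
    \sum_(i <- s) moll_grad x ord0 i * v ord0 i =
      \int[vol R k]_(y in K) \sum_(i <- s) bump_grad d (x - y) ord0 i * v ord0 i.
  elim: s => [|i s [IH1 IH2]].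
    under eq_Rintegral do rewrite big_nil.
    split; last by rewrite big_nil Rintegral_cst// mul0r.
    by apply: (eq_integrable mK _ _ _ (integrable0 _ _)) => y _ /=; rewrite big_nil.
  split.
    apply: (eq_integrable mK _ _ _ (integrableD mK (I1 i) IH1)) => y _ /=.
    by rewrite big_cons EFinD.
  rewrite big_cons IH2 mxE -RintegralZr//; last exact: integrable_bump_grad.
  rewrite -RintegralD//; apply: eq_Rintegral => y _; by rewrite big_cons.
have [int_dot gradE] : (vol R k).-integrable K (EFin \o (fun y => dotv (bump_grad d (x - y)) v)) /\
    dotv (moll_grad x) v = \int[vol R k]_(y in K) dotv (bump_grad d (x - y)) v.
  exact: int_sum (index_enum 'I_k).
rewrite gradE /moll -RintegralB//; try exact: integrable_bump.
have int_diff : (vol R k).-integrable K (EFin \o (fun y => bump_fun d (x + v - y) - bump_fun d (x - y))).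
  apply: (eq_integrable mK _ _ _ (integrableB mK (integrable_bump (x + v)) (integrable_bump x))) => y _ /=.
  by rewrite EFinB.
rewrite -RintegralB//.
apply: le_trans (le_normr_Rintegral mK _) _.
  apply: (eq_integrable mK _ _ _ (integrableB mK int_diff int_dot)) => y _ /=.
  by rewrite EFinB.
rewrite [X in _ <= X](_ : _ = \int[vol R k]_(y in K) (C * nv v ^+ 2)); last first.
  by rewrite Rintegral_cst// mulrAC.
apply: le_Rintegral => //.
- apply: (eq_integrable mK _ _ _ (integrable_abse (integrableB mK int_diff int_dot))) => y _ /=.
  by rewrite -?EFinB.
- apply: measurable_bounded_integrable => //.
  exists (C * nv v ^+ 2); split; first exact: num_real.
  move=> M CM y _; have ge : 0 <= C * nv v ^+ 2 by rewrite mulr_ge0 ?sqr_ge0.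
  by apply: le_trans (ltW CM); rewrite ger0_norm.
move=> y Ky /=; have := @bump_taylor R k d d0 (x - y) v v1.
by rewrite (addrAC x (- y) v).
Qed.

(** Each coordinate is a pointwise limit of difference quotients of [moll] with step 1/(m+1), by the
    Taylor bound. *)
Lemma measurable_moll_grad : measurable_fun setT moll_grad.
Proof.
apply: measurable_fun_rVP => i.
pose C := ((2 * d + 3) ^+ 2 + 2 * d ^+ 2) * fine (vol R k K).
have C0 : 0 <= C.
  by rewrite mulr_ge0 ?fine_ge0// addr_ge0 ?sqr_ge0// mulr_ge0// sqr_ge0.
pose h (m : nat) x := (moll (x + m.+1%:R^-1 *: delta_mx ord0 i) - moll x) * m.+1%:R.
apply: (@measurable_fun_cvg _ _ _ setT h) => [m|x _].
  apply: measurable_funM => //; apply: measurable_funB; last exact: measurable_moll.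
  apply: (measurableT_comp measurable_moll).
  by apply: measurable_rVD => //; exact: measurable_id.
apply/cvgrPdist_le => e e0.
near=> m.
have m0 : 0 < m.+1%:R :> R by [].
set v := m.+1%:R^-1 *: delta_mx ord0 i : 'rV[R]_k.
have nvv : nv v = m.+1%:R^-1.
  by rewrite nvZ ger0_norm ?invr_ge0// [nv (delta_mx _ _)]/nv sqnorm_delta sqrtr1 mulr1.
have v1 : nv v <= 1 by rewrite nvv invf_le1// ler1n.
have := moll_taylor x v1; rewrite nvv dotvC dotvZl dotvC dotv_delta -/C => H.
rewrite /h -/v distrC.
rewrite (_ : _ - _ = (moll (x + v) - moll x - m.+1%:R^-1 * moll_grad x ord0 i) * m.+1%:R); last first.
  by rewrite [RHS]mulrBl mulrAC mulVf ?gt_eqF// mul1r.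
rewrite normrM (@ger0_norm _ m.+1%:R)//.
apply: le_trans (ler_wpM2r (ltW m0) H) _.
rewrite -mulrA expr2 mulfVK ?gt_eqF//.
rewrite ler_pdivrMr// mulrC -ler_pdivrMr//.
apply: le_trans (_ : m%:R <= _); last by rewrite ler_nat.
near: m; exact: nbhs_infty_ger.
Unshelve. all: by end_near.
Qed.

End mollify.

(** * Translates of a symmetric convex body *)

Section symmetric_body.
Variables (R : realType) (k : nat).
Implicit Types (K : set 'rV[R]_k) (x y v : 'rV[R]_k).

(** Around an interior point [x0] and, by symmetry, around its opposite there are balls in [K]; a
    short vector [z] is the midpoint of z + x0 and z - x0. *)
Lemma symmetric_body_ball K : convex_body K -> origin_symmetric K ->
  exists2 r : R, 0 < r & forall x, nv x <= r -> K x.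
Proof.
move=> [_ [[x0 Kx0] cK]] sK.
have /nbhs_ballP [e /= e0 eK] : nbhs x0 K by exact: Kx0.
have near0 v : nv v <= e / 2 -> K (x0 + v).
  move=> ve; apply: eK; rewrite -ball_normE /= opprD addrA subrr sub0r normrN.
  rewrite /Num.norm/= mx_normrE; apply/bigmax_ltP; split => // -[i j] _ /=.
  rewrite (ord1 i); apply: le_lt_trans (coord_nv _ _) _; apply: le_lt_trans ve _.
  by rewrite ltr_pdivrMr// ltr_pMr// ltr1n.
exists (e / 2); first by rewrite divr_gt0.
move=> z ze.
apply: (convex_midpoint (y := - x0) cK); first by rewrite opprK addrC; exact: near0.
by rewrite -opprB; apply/sK/near0; rewrite nvN.
Qed.

(** The vector [v] lies in t K, and K + t K is contained in (1 + t) K by convexity. The case v = 0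
    is separate because [t] may be 0. *)
Lemma convex_dil_add K (r t : R) x v : 0 < r -> (forall x, nv x <= r -> K x) ->
  (forall x y l, K x -> K y -> 0 <= l <= 1 -> K (l *: x + (1 - l) *: y)) ->
  0 <= t -> K x -> nv v <= t * r -> dil (1 + t) K (x + v).
Proof.
move=> r0 Kr cK t0 Kx vt.
have t1 : 0 < 1 + t by rewrite ltr_wpDr.
exists ((1 + t)^-1 *: (x + v)); last by rewrite scalerA divff ?scale1r// gt_eqF.
have [->|tn] := eqVneq v 0.
  rewrite addr0 (_ : _ *: _ = (1 + t)^-1 *: x + (1 - (1 + t)^-1) *: 0); last by rewrite scaler0 addr0.
  apply: cK => //; first by apply: Kr; rewrite nv0 ltW.
  by rewrite invr_ge0 ltW//= invf_le1// lerDl.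
have tp : 0 < t.
  by rewrite lt_neqAle t0 andbT; apply: contraTneq vt => <-; rewrite mul0r -ltNge nv_gt0.
rewrite (_ : _ *: _ = (1 + t)^-1 *: x + (1 - (1 + t)^-1) *: (t^-1 *: v)); last first.
  rewrite scalerDr scalerA; congr (_ + _ *: _).
  by field; rewrite !gt_eqF.
apply: cK => //; last by rewrite invr_ge0 ltW//= invf_le1// lerDl.
by apply: Kr; rewrite nvZ ger0_norm ?invr_ge0// mulrC ler_pdivrMr// mulrC.
Qed.

Definition shift_diff K v x : R := `|\1_K (x - v) - \1_K x|.

Lemma shift_diff_ge0 K v x : 0 <= shift_diff K v x. Proof. exact: normr_ge0. Qed.

Lemma measurable_shift_diff K v : measurable K -> measurable_fun setT (shift_diff K v).
Proof.
move=> mK; apply: (measurableT_comp (@normr_measurable R setT)).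
apply: measurable_funB; last exact: measurable_indic.
apply: (measurableT_comp (measurable_indic mK)).
by apply: measurable_rVD => //; exact: measurable_id.
Qed.

Lemma vol_dil K (c : R) : 0 < c -> measurable K ->
  vol R k (dil c K) = ((c ^+ k)%:E * vol R k K)%E.
Proof.
move=> c0 mK; have mD := measurable_dil c0 mK.
rewrite !vol_indic// (@integral_vol_scale _ _ c)//; last exact: measurable_Eindic.
congr (_ * _)%E; apply: eq_integral => x _; congr (_%:E); apply: indic_eq.
by rewrite dilE//= scalerA mulVf ?gt_eqF// scale1r.
Qed.

(** Chord bound on [0, 1] for the convex function e |-> (1 + e a)^n; it makes the volume growth of
    dilates linear in [e]. *)
Let expr_convex (a e : R) n : 0 <= a -> 0 <= e <= 1 ->
  (1 + e * a) ^+ n <= 1 + e * ((1 + a) ^+ n - 1).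
Proof.
move=> a0 /andP[e0 e1]; elim: n => [|n IH]; first by rewrite !expr0 subrr mulr0 addr0.
have D0 : 0 <= (1 + a) ^+ n - 1 by rewrite subr_ge0 exprn_ege1// lerDl.
have e2 : e * e * (a * ((1 + a) ^+ n - 1)) <= e * (a * ((1 + a) ^+ n - 1)).
  by rewrite ler_wpM2r ?mulr_ge0// ler_piMr.
rewrite !exprSr; apply: (@le_trans _ _ ((1 + e * ((1 + a) ^+ n - 1)) * (1 + e * a))).
  by rewrite ler_wpM2r// addr_ge0// mulr_ge0.
move: e2; nra.
Qed.

(** A bound linear in the step, so that an error [w] in the density costs O(w e). If a point lies in
    [K] or in its translate, it lies in (1 + e/r) K and in the translate of that dilate. *)
Lemma integral_shift_diff_le K (r : R) v (e : R) : 0 < r -> (forall x, nv x <= r -> K x) ->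
  (forall x y l, K x -> K y -> 0 <= l <= 1 -> K (l *: x + (1 - l) *: y)) ->
  measurable K -> (vol R k K < +oo)%E -> 0 <= e <= 1 -> nv v <= e ->
  (\int[vol R k]_x (shift_diff K v x)%:E <=
     (2 * ((1 + r^-1) ^+ k - 1) * fine (vol R k K) * e)%:E)%E.
Proof.
move=> r0 Kr cK mK K_lty /andP[e0 e1] ve.
pose c := 1 + e / r; have c1 : 1 <= c by rewrite lerDl divr_ge0// ltW.
have c0 : 0 < c by exact: lt_le_trans c1.
have mD := measurable_dil c0 mK.
pose D : set 'rV[R]_k := dil c K.
have addK x w : K x -> nv w <= e -> D (x + w).
  move=> Kx we; apply: (@convex_dil_add _ r) => //; first by rewrite divr_ge0// ltW.
  by rewrite divfK// gt_eqF.
have KD x : K x -> D x by move=> Kx; rewrite -(addr0 x); apply: addK => //; rewrite nv0.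
have VE : vol R k K = (fine (vol R k K))%:E by rewrite fineK// ge0_fin_numE.
have ms : measurable_fun setT (fun x => x - v).
  by apply: measurable_rVD => //; exact: measurable_id.
have mI (A : set 'rV[R]_k) : measurable A -> measurable_fun setT (fun x => (\1_A (x - v)%R : R)%:E).
  by move=> mA; apply/measurable_EFinP; exact: (measurableT_comp (measurable_indic mA) ms).
have volS (A : set 'rV[R]_k) : measurable A -> (\int[vol R k]_x (\1_A (x - v)%R : R)%:E)%E = vol R k A.
  move=> mA; rewrite vol_indic// (@integral_vol_shift _ _ (- v) (fun x => (\1_A x : R)%:E))//.
  exact: measurable_Eindic.
have mE (A : set 'rV[R]_k) : measurable A -> measurable_fun setT (fun x => (\1_A x : R)%:E).
  exact: measurable_Eindic.
have mS : measurable_fun setT (fun x => (shift_diff K v x)%:E).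
  by apply/measurable_EFinP; exact: measurable_shift_diff.
(* Pointwise, |1_(K+v) - 1_K| + 1_K + 1_(K+v) <= 1_D + 1_(D+v); the translates have the same
   volumes. *)
have : (\int[vol R k]_x (shift_diff K v x)%:E + (vol R k K + vol R k K) <= vol R k D + vol R k D)%E.
  rewrite -{2}(volS K)// -{2}(volS D)// !vol_indic// -!ge0_integralD//; try exact: mE; try exact: mI; last first.
  - by apply: emeasurable_funD; [exact: mE|exact: mI].
  - by move=> x _; rewrite -EFinD lee_fin addr_ge0.
  - by move=> x _; rewrite lee_fin shift_diff_ge0.
  apply: ge0_le_integral => //.
  - by move=> x _; rewrite -!EFinD lee_fin !addr_ge0// shift_diff_ge0.
  - by apply: emeasurable_funD => //; apply: emeasurable_funD; [exact: mE|exact: mI].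
  - by apply: emeasurable_funD; [exact: mE|exact: mI].
  move=> x _; rewrite -!EFinD lee_fin /shift_diff.
  have [Kx|nKx] := pselect (K x); have [Kxv|nKxv] := pselect (K (x - v)).
  - have Dx := KD _ Kx; have Dxv := KD _ Kxv.
    by rewrite !indicE (mem_set Kx) (mem_set Kxv) (mem_set Dx) (mem_set Dxv) subrr normr0 add0r.
  - have Dx := KD _ Kx.
    have Dxv : D (x - v) by apply: addK => //; rewrite nvN.
    by rewrite !indicE (mem_set Kx) (memNset nKxv) (mem_set Dx) (mem_set Dxv) sub0r normrN normr1 addr0.
  - have Dxv := KD _ Kxv.
    have Dx : D x by rewrite -(subrK v x); exact: addK.
    by rewrite !indicE (memNset nKx) (mem_set Kxv) (mem_set Dx) (mem_set Dxv) subr0 normr1 add0r.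
  - by rewrite !indicE (memNset nKx) (memNset nKxv) subrr normr0 !add0r addr_ge0.
rewrite /D vol_dil// VE -EFinM -!EFinD -leeBrDr// -EFinB => /le_trans; apply.
rewrite lee_fin; have V0 : 0 <= fine (vol R k K) by rewrite fine_ge0.
have := @expr_convex r^-1 e k; rewrite invr_ge0 (ltW r0) e0 e1 => /(_ isT isT).
rewrite -/c; move: V0; move: (fine _) (c ^+ k) ((1 + r^-1) ^+ k) => V C D' V0 H; rewrite /=.
have H' : (C - 1) * V <= e * (D' - 1) * V by rewrite ler_wpM2r// lerBlDl.
lra.
Qed.

End symmetric_body.

Section uniform_modulus.
Variables (R : realType) (k : nat).

Lemma box_add (M c : R) (x v : 'rV[R]_k) : box M x -> nv v <= c -> box (M + c) (x + v).
Proof.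
move=> xM vc i; rewrite mxE; apply: le_trans (ler_normD _ _) _; apply: lerD => //.
exact: le_trans (coord_nv _ _) vc.
Qed.

(** Uniform continuity on a compact box, in the one-sided form in which errors of the density are
    charged. *)
Lemma modulus_box (g : 'rV[R]_k -> R) (M w : R) : continuous g -> 0 < w ->
  exists2 d : R, 0 < d <= 1 &
    forall x y, box M x -> nv y <= d -> g (x + y) <= g x + w.
Proof.
move=> cg w0.
have := @compact_box R k M; rewrite compact_near_coveringP => cB.
have /nbhs_ballP [e /= e0 eP] : \forall y \near (0 : 'rV[R]_k), @box R k M `<=` (fun x => g (x + y) <= g x + w).
  apply: (cB _ (nbhs (0 : 'rV[R]_k)) (fun y x => g (x + y) <= g x + w) _) => x _.
  have ch : {for (x, 0 : 'rV[R]_k), continuous (fun z : 'rV[R]_k * 'rV[R]_k => g (z.1 + z.2) - g z.1)}.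
    apply: continuousB; last exact: (@continuous_comp _ _ _ fst g _ cvg_fst (cg _)).
    by apply: (@continuous_comp _ _ _ (fun z : 'rV[R]_k * 'rV[R]_k => z.1 + z.2) g); [exact: add_continuous|exact: cg].
  have := ch; rewrite /prop_for /continuous_at /= addr0 subrr => /cvgr_lt /(_ w w0).
  by apply: filterS => -[a b] /=; rewrite ltrBlDl => /ltW.
exists (Num.min 1 (e / 2)); first by rewrite lt_min ltr01 divr_gt0//= ge_min lexx.
move=> x y xM; rewrite le_min => /andP[_ ye]; apply: eP => //.
rewrite -ball_normE /= sub0r normrN /Num.norm/= mx_normrE; apply/bigmax_ltP; split => // -[i j] _ /=.
rewrite (ord1 i); apply: le_lt_trans (coord_nv _ _) _; apply: le_lt_trans ye _.
by rewrite ltr_pdivrMr// ltr_pMr// ltr1n.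
Qed.

(* Qualified because MathComp-Analysis's [msum] is the sum of measures. *)
Lemma compact_msum_seg (K : set 'rV[R]_k) (e : R) (th : 'rV[R]_k) : compact K ->
  compact (Defs.msum K (dil e (seg th))).
Proof.
move=> cK.
rewrite (_ : Defs.msum _ _ = (fun z : 'rV[R]_k * R => z.1 + e *: (z.2 *: th)) @` (K `*` `[-1, 1]%classic)).
  apply: continuous_compact; last by apply: compact_setX => //; exact: segment_compact.
  apply: continuous_subspaceT => z; apply: cvgD; first exact: cvg_fst.
  by apply: cvgZr; apply: cvgZl; exact: cvg_snd.
apply/seteqP; split => [y [a Ka [b [c [t t1 tc] cb] by_]]|y [[a t] /= [Ka]]].
  by exists (a, t); rewrite /= ?tc ?cb.
rewrite in_itv/= => t1 ay; rewrite -ay; exists a => //; exists (e *: (t *: th)) => //.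
by exists (t *: th) => //; exists t.
Qed.

Lemma msum_seg_mem (K : set 'rV[R]_k) (e t : R) (x th : 'rV[R]_k) : K x -> `|t| <= 1 ->
  Defs.msum K (dil e (seg th)) (x + t * e *: th).
Proof.
move=> Kx t1; exists x => //; exists (e *: (t *: th)); last by rewrite scalerA mulrC.
by exists (t *: th) => //; exists t => //=; rewrite -ler_norml.
Qed.

End uniform_modulus.

(** * First variation along a segment *)

Section projection_bound.
Variables (R : realType) (k : nat) (g : 'rV[R]_k -> R) (K : set 'rV[R]_k) (M d w : R).
Hypotheses (g0 : forall x, 0 <= g x) (cg : continuous g).
Hypotheses (cptK : compact K) (KM : K `<=` box M).
Hypothesis cK : forall x y l, K x -> K y -> 0 <= l <= 1 -> K (l *: x + (1 - l) *: y).
Hypotheses (d0 : 0 < d) (d1 : d <= 1) (w0 : 0 <= w).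
Hypothesis gw : forall x y, box (M + 1) x -> nv y <= d -> g (x + y) <= g x + w.

Let mK : measurable K. Proof. exact: compact_measurable_rV. Qed.

Let K_lty : (vol R k K < +oo)%E. Proof. exact: vol_compact_lty. Qed.
Let mg : measurable_fun setT g. Proof. exact: measurable_g. Qed.

Let ms v : measurable_fun setT (fun x : 'rV[R]_k => x - v).
Proof. by apply: measurable_rVD => //; exact: measurable_id. Qed.

Let shift_diff_box v x : nv v <= 1 -> ~ box (M + 1) x -> shift_diff K v x = 0.
Proof.
move=> v1 xM; rewrite /shift_diff !indicE !memNset ?subrr ?normr0//.
  by move=> /KM Kx; apply: xM => i; apply: le_trans (Kx i) _; rewrite lerDl.
by move=> /KM Kx; apply: xM; rewrite -(subrK v x); exact: box_add.
Qed.

(** An increment of [moll] is an average, over shifts [y] shorter than [d], of increments of the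
    indicator of [K]. Undoing the shift moves it into [g], which costs [w]. *)
Lemma integral_moll_shift_le v : nv v <= 1 ->
  (\int[vol R k]_x (`|moll d K (x - v) - moll d K x| * g x)%:E <=
   (bump_mass k d)%:E * \int[vol R k]_x (shift_diff K v x * (g x + w))%:E)%E.
Proof.
move=> v1.
pose F (z : 'rV[R]_k * 'rV[R]_k) : \bar R := (bump_fun d z.2 * shift_diff K v (z.1 - z.2) * g z.1)%:E.
have F0 z : (0 <= F z)%E by rewrite /F lee_fin mulr_ge0// mulr_ge0 ?bump_ge0 ?shift_diff_ge0.
have mF : measurable_fun setT F.
  apply/measurable_EFinP; apply: measurable_funM; last exact: (measurableT_comp mg measurable_fst).
  apply: measurable_funM.
    exact: (measurableT_comp (@measurable_bump R k d) measurable_snd).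
  apply: (measurableT_comp (@measurable_shift_diff R k K v mK)).
  by apply: measurable_rVD => //; apply: measurable_rVN; exact: measurable_snd.
apply: (@le_trans _ _ (\int[vol R k]_x \int[vol R k]_y F (x, y))%E).
  apply: ge0_le_integral => //.
  - by move=> x _; rewrite lee_fin mulr_ge0.
  - apply/measurable_EFinP; apply: measurable_funM => //.
    apply: (measurableT_comp (@normr_measurable R setT)); apply: measurable_funB.
      exact: (measurableT_comp (measurable_moll d mK K_lty) (ms v)).
    exact: measurable_moll.
  - exact: (measurable_fun_fubini_tonelli_F (m2 := vol R k) F).
  move=> x _; rewrite EFinM.
  apply: (@le_trans _ _ ((\int[vol R k]_y (bump_fun d y * shift_diff K v (x - y))%:E) * (g x)%:E)%E).
    apply: lee_wpmul2r; first by rewrite lee_fin.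
    apply: le_trans (moll_diff_le d mK K_lty _ _) _.
    rewrite (eq_integral (fun y => (bump_fun d y * shift_diff K v (x - y))%:E))// => y _.
    by rewrite /shift_diff (addrAC x (- y)).
  rewrite -ge0_integralZr//.
  - by apply/measurable_EFinP; apply: measurable_funM; [exact: measurable_bump|
      apply: (measurableT_comp (@measurable_shift_diff R k K v mK));
      apply: measurable_rVD => //; apply: measurable_rVN; exact: measurable_id].
  - by move=> y _; rewrite lee_fin mulr_ge0 ?bump_ge0 ?shift_diff_ge0.
  - by rewrite lee_fin.
rewrite fubini_tonelli//.
have mSw : measurable_fun setT (fun x => (shift_diff K v x * (g x + w))%:E).
  apply/measurable_EFinP; apply: measurable_funM; first exact: measurable_shift_diff.
  exact: measurable_funD.
have Sw0 x : (0 <= (shift_diff K v x * (g x + w))%:E)%E.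
  by rewrite lee_fin mulr_ge0 ?shift_diff_ge0// addr_ge0.
rewrite bump_massE// -ge0_integralZr//; last 3 first.
- by apply/measurable_EFinP; exact: measurable_bump.
- by move=> y _; rewrite lee_fin bump_ge0.
- exact: integral_ge0.
apply: ge0_le_integral => //.
- by move=> y _; exact: integral_ge0.
- exact: (measurable_fun_fubini_tonelli_G (m1 := vol R k) F).
- apply: emeasurable_funM => //; apply/measurable_EFinP; exact: measurable_bump.
move=> y _.
have [dy|yd] := leP d (nv y).
  rewrite bump_eq0// mul0e integral0_eq// => x _.
  by rewrite /F /= bump_eq0// !mul0r.
(* Translation by [y], of length below [d]: where the integrand is nonzero [g] grows by at most
   [w]. *)
rewrite -(@integral_vol_shift _ _ y (fun x => F (x, y))) //; last first.
  exact: (measurableT_comp mF (pair2_measurable y)).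
rewrite -ge0_integralZl//; last by rewrite lee_fin bump_ge0.
apply: ge0_le_integral => //.
- have mF' : measurable_fun setT (fun x => F (x, y)).
    exact: (measurableT_comp mF (pair2_measurable y)).
  apply: (measurableT_comp mF').
  by apply: measurable_rVD => //; exact: measurable_id.
- exact: emeasurable_funM.
move=> x _; rewrite /F /= addrK -EFinM lee_fin -mulrA ler_wpM2l ?bump_ge0//.
have [xM|xM] := pselect (box (M + 1) x); last by rewrite shift_diff_box// !mul0r.
by rewrite ler_wpM2l ?shift_diff_ge0//; apply: gw => //; exact: ltW.
Qed.

(* If [x] is outside [K], convexity forbids both [x - e th] and [x + e th] to be
   in [K], so the two outer layers are disjoint in [K + e seg th]. *)
Lemma gm_msum_seg_ge (e : R) (th : 'rV[R]_k) : 0 <= e <= d -> nv th <= 1 ->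
  (\int[vol R k]_x (shift_diff K (e *: th) x * g x)%:E + gm g K <=
   gm g (Defs.msum K (dil e (seg th))) + w%:E * \int[vol R k]_x (shift_diff K (e *: th) x)%:E)%E.
Proof.
move=> /andP[e0 ed] th1; pose v := e *: th; rewrite -/v.
have ve : nv v <= e by rewrite nvZ ger0_norm// ler_piMr.
pose E : set 'rV[R]_k := Defs.msum K (dil e (seg th)); rewrite -/E.
have mE : measurable E by apply: compact_measurable_rV; exact: compact_msum_seg.
have KE x : K x -> E x.
  by move=> Kx; have := @msum_seg_mem _ _ K e 0 x th Kx; rewrite normr0 ler01 mul0r scale0r addr0; apply.
have KvE x : K (x - v) -> E x.
  by move=> Kx; have := @msum_seg_mem _ _ K e 1 _ th Kx; rewrite normr1 lexx mul1r -/v subrK; apply.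
have KVE x : K (x + v) -> E x.
  move=> Kx; have := @msum_seg_mem _ _ K e (-1) _ th Kx.
  by rewrite normrN normr1 lexx mulN1r scaleNr -/v addrK; apply.
(* With K + v the translate, [a1] is the indicator of (K + v) minus K and [a2] that of K minus (K +
   v). Moved by -v the latter becomes (K - v) minus K, at a cost [w] in the density. *)
pose a1 (x : 'rV[R]_k) : R := \1_K (x - v) * (1 - \1_K x).
pose a2 (x : 'rV[R]_k) : R := \1_K x * (1 - \1_K (x - v)).
have a10 x : 0 <= a1 x by rewrite mulr_ge0// subr_ge0.
have a20 x : 0 <= a2 x by rewrite mulr_ge0// subr_ge0.
have ma1 : measurable_fun setT a1.
  apply: measurable_funM; first exact: (measurableT_comp (measurable_indic mK) (ms v)).
  by apply: measurable_funB => //; exact: measurable_indic.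
have ma2 : measurable_fun setT a2.
  apply: measurable_funM; first exact: measurable_indic.
  by apply: measurable_funB => //; exact: (measurableT_comp (measurable_indic mK) (ms v)).
have mp : measurable_fun setT (fun x : 'rV[R]_k => x + v).
  by apply: measurable_rVD => //; exact: measurable_id.
have ma2v : measurable_fun setT (fun x : 'rV[R]_k => a2 (x + v)) by exact: (measurableT_comp ma2 mp).
have sdE x : shift_diff K v x = a1 x + a2 x.
  rewrite /shift_diff /a1 /a2 !indicE.
  by do 2![case: (_ \in _)]; rewrite /= ?(subrr, subr0, sub0r, normrN, normr1, normr0, mul1r, mul0r, addr0, add0r).
have GG := measurable_weight cg.
have split_sd : (\int[vol R k]_x (shift_diff K v x * g x)%:E =
    \int[vol R k]_x (a1 x * g x)%:E + \int[vol R k]_x (a2 x * g x)%:E)%E.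
  rewrite -ge0_integralD//; try exact: GG.
  - by apply: eq_integral => x _; rewrite sdE mulrDl EFinD.
  - by move=> x _; rewrite lee_fin mulr_ge0.
  - by move=> x _; rewrite lee_fin mulr_ge0.
have a2_le : (\int[vol R k]_x (a2 x * g x)%:E <= \int[vol R k]_x (a2 (x + v)%R * g x)%:E +
    w%:E * \int[vol R k]_x (shift_diff K v x)%:E)%E.
  rewrite -(@integral_vol_shift _ _ v); last 2 first.
  - exact: GG.
  - by move=> x; rewrite lee_fin mulr_ge0.
  apply: (@le_trans _ _ (\int[vol R k]_x ((a2 (x + v)%R * g x)%:E + w%:E * (a2 (x + v)%R)%:E))%E).
    apply: ge0_le_integral => //.
    - by move=> x _; rewrite lee_fin mulr_ge0.
    - by apply/measurable_EFinP; apply: (measurableT_comp (measurable_funM ma2 mg) mp).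
    - apply: emeasurable_funD; first exact: GG.
      by apply: emeasurable_funM => //; apply/measurable_EFinP.
    move=> x _; rewrite -EFinM -EFinD lee_fin (mulrC w) -mulrDr.
    have [Kxv|nKxv] := pselect (K (x + v)); last by rewrite /a2 indicE (memNset nKxv) !mul0r.
    apply: ler_wpM2l => //; apply: gw; last exact: le_trans ve _.
    rewrite -(addrK v x); apply: box_add; first exact: KM.
    by rewrite nvN (le_trans ve)// (le_trans ed).
  rewrite ge0_integralD//; last 4 first.
  - by move=> x _; rewrite lee_fin mulr_ge0.
  - exact: GG.
  - by move=> x _; rewrite -EFinM lee_fin mulr_ge0.
  - by apply: emeasurable_funM => //; apply/measurable_EFinP.
  apply: leeD2l; rewrite ge0_integralZl//; last first.
  - by move=> x _; rewrite lee_fin.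
  - by apply/measurable_EFinP.
  apply: lee_wpmul2l; first by rewrite lee_fin.
  rewrite (@integral_vol_shift _ _ v (fun x => (a2 x)%:E)); last 2 first.
  - by apply/measurable_EFinP.
  - by move=> x; rewrite lee_fin.
  apply: ge0_le_integral => //.
  - by move=> x _; rewrite lee_fin.
  - by apply/measurable_EFinP.
  - by apply/measurable_EFinP; exact: measurable_shift_diff.
  by move=> x _; rewrite lee_fin sdE lerDr.
have sum_le : (\int[vol R k]_x (a1 x * g x)%:E + \int[vol R k]_x (a2 (x + v)%R * g x)%:E + gm g K <= gm g E)%E.
  have h1 x : (0 <= (a1 x * g x)%:E)%E by rewrite lee_fin mulr_ge0.
  have h2 x : (0 <= (a2 (x + v)%R * g x)%:E)%E by rewrite lee_fin mulr_ge0.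
  have h3 := measurable_gm_fun cg mK.
  have m1 := GG _ ma1; have m2 := GG _ ma2v.
  have h4 x : (0 <= (\1_K x * g x)%:E)%E by exact: gm_fun_ge0.
  have h12 x : (0 <= (a1 x * g x)%:E + (a2 (x + v)%R * g x)%:E)%E by rewrite adde_ge0.
  have m12 := emeasurable_funD m1 m2.
  rewrite /gm -ge0_integralD// -ge0_integralD//.
  apply: ge0_le_integral => //.
  - by move=> x _; rewrite adde_ge0 ?adde_ge0// gm_fun_ge0.
  - by apply: emeasurable_funD => //; exact: emeasurable_funD.
  - exact: measurable_gm_fun.
  move=> x _; rewrite -!EFinD -!mulrDl lee_fin ler_wpM2r// /a1 /a2 addrK.
  have [Kx|nKx] := pselect (K x).
    by rewrite !indicE (mem_set Kx) (mem_set (KE _ Kx)) subrr !mulr0 !add0r.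
  have [Kxv|nKxv] := pselect (K (x - v)).
    have nKxp : ~ K (x + v).
      by move=> Kxp; apply: nKx; exact: (convex_midpoint cK Kxv Kxp).
    rewrite !indicE (memNset nKx) (memNset nKxp) (mem_set Kxv) (mem_set (KvE _ Kxv)).
    by rewrite subr0 mul0r !addr0 mulr1.
  have [Kxp|nKxp] := pselect (K (x + v)).
    rewrite !indicE (memNset nKx) (memNset nKxv) (mem_set Kxp) (mem_set (KVE _ Kxp)).
    by rewrite subr0 mul0r !addr0 add0r mulr1.
  by rewrite !indicE (memNset nKx) (memNset nKxv) (memNset nKxp) !mul0r !addr0.
rewrite split_sd.
apply: (@le_trans _ _ (\int[vol R k]_x (a1 x * g x)%:E + (\int[vol R k]_x (a2 (x + v)%R * g x)%:E +
    w%:E * \int[vol R k]_x (shift_diff K v x)%:E) + gm g K)%E).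
  by apply: leeD2r; apply: leeD2l.
by rewrite addeA addeAC; apply: leeD2r.
Qed.

Let taylor_const := ((2 * d + 3) ^+ 2 + 2 * d ^+ 2) * fine (vol R k K).

Let taylor_const_ge0 : 0 <= taylor_const.
Proof. by rewrite mulr_ge0 ?fine_ge0// addr_ge0 ?sqr_ge0// mulr_ge0 ?sqr_ge0. Qed.

(** Outside the box of half-side M + 2 the values of [moll] at both points and the gradient vanish,
    since d <= 1 and |v| <= 1; thus the remainder has a finite [g]-integral. *)
Lemma moll_taylor_box x v : nv v <= 1 ->
  `|moll d K (x + v) - moll d K x - dotv (moll_grad d K x) v| <=
  taylor_const * nv v ^+ 2 * \1_(@box R k (M + 2)) x.
Proof.
move=> v1; have [xM|xM] := pselect (box (M + 2) x).
  by rewrite indicE mem_set// mulr1; exact: moll_taylor.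
have far y : nv y < d -> ~ K (x - y).
  move=> yd /KM Kx; apply: xM; rewrite -(subrK y x) => i.
  apply: le_trans (box_add Kx (ltW (lt_le_trans yd d1)) i) _.
  by rewrite lerD2l ler1n.
have far' y : nv y < d -> ~ K (x + v - y).
  move=> yd /KM Kx; apply: xM; rewrite -(addrK v x) -(subrK y (x + v)).
  have h : nv (y - v) <= 2.
    apply: le_trans (nv_triangle _ _) _; rewrite nvN; move: (lt_le_trans yd d1) v1; lra.
  by rewrite -addrA; exact: box_add Kx h.
rewrite (moll_outer d0 mK K_lty far) (moll_outer d0 mK K_lty far').
by rewrite (moll_grad_outer d0 far) dot0v !subr0 normr0 mulr_ge0// mulr_ge0// sqr_ge0.
Qed.

(** Three comparisons for the increment v = e th: [h1] passes from the directional derivative to the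
    increment of [moll] (Taylor remainder), [h2] to the increment of the indicator of [K] (cost w
    S0), and [h3] to the growth of measure along the segment (again w S0). The two equal costs are
    the term [2 * w * S * e]. *)
Lemma moll_directional_le (e S : R) (th : 'rV[R]_k) : 0 < e <= d -> nv th <= 1 ->
  (\int[vol R k]_x (shift_diff K (e *: th) x)%:E <= (S * e)%:E)%E ->
  ((e * (bump_mass k d)^-1)%:E * \int[vol R k]_x (`|dotv (moll_grad d K x) th| * g x)%:E + gm g K <=
   gm g (Defs.msum K (dil e (seg th))) +
   (2 * w * S * e + (bump_mass k d)^-1 * taylor_const * e ^+ 2 * fine (gm g (@box R k (M + 2))))%:E)%E.
Proof.
move=> /andP[e0 ed] th1 sdS.
pose v := e *: th.
have ve : nv v <= e by rewrite nvZ ger0_norm ?(ltW e0)// ler_piMr// ltW.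
have v1 : nv v <= 1 by rewrite (le_trans ve)// (le_trans ed).
set kap := bump_mass k d; have kap0 : 0 < kap by exact: bump_mass_gt0.
pose T := (\int[vol R k]_x (`|dotv (moll_grad d K x) th| * g x)%:E)%E.
pose D := (\int[vol R k]_x (`|moll d K (x - v) - moll d K x| * g x)%:E)%E.
pose I := (\int[vol R k]_x (shift_diff K v x * g x)%:E)%E.
pose S0 := (\int[vol R k]_x (shift_diff K v x)%:E)%E.
pose Bx : set 'rV[R]_k := @box R k (M + 2).
have mBx : measurable Bx by exact: measurable_box.
have GE : gm g Bx = (fine (gm g Bx))%:E.
  by rewrite fineK// ge0_fin_numE ?gm_ge0//; exact: (gm_lty g0 cg mBx (@subset_refl _ _)).
set G := fine _ in GE.
have mu : measurable_fun setT (moll d K) by exact: measurable_moll.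
have mD : measurable_fun setT (fun x : 'rV[R]_k => `|moll d K (x - v) - moll d K x|).
  apply: (measurableT_comp (@normr_measurable R setT)); apply: measurable_funB => //.
  exact: (measurableT_comp mu (ms v)).
have mT : measurable_fun setT (fun x : 'rV[R]_k => `|dotv (moll_grad d K x) th|).
  apply: (measurableT_comp (@normr_measurable R setT)); apply: measurable_dotv => //.
  exact: measurable_moll_grad.
have mS : measurable_fun setT (shift_diff K v) by exact: measurable_shift_diff.
have GG := measurable_weight cg.
have h1 : (e%:E * T <= D + (taylor_const * e ^+ 2)%:E * gm g Bx)%E.
  rewrite /T /D /gm -ge0_integralZl//;
    try (by rewrite lee_fin ltW);
    try (by move=> x _; rewrite lee_fin mulr_ge0);
    try (exact: GG).
  rewrite -ge0_integralZl//;
    try (by rewrite lee_fin mulr_ge0 ?sqr_ge0);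
    try (by move=> x _; exact: gm_fun_ge0);
    try (exact: measurable_gm_fun).
  rewrite -ge0_integralD//;
    try (by apply: emeasurable_funM => //; exact: measurable_gm_fun);
    try (by move=> x _; rewrite mule_ge0 ?gm_fun_ge0// lee_fin mulr_ge0 ?sqr_ge0);
    try (exact: GG);
    try (by move=> x _; rewrite lee_fin mulr_ge0).
  apply: ge0_le_integral => //.
  - by move=> x _; rewrite -EFinM lee_fin !mulr_ge0// ltW.
  - by apply: emeasurable_funM => //; exact: GG.
  - by apply: emeasurable_funD; [exact: GG|apply: emeasurable_funM => //; exact: measurable_gm_fun].
  move=> x _; rewrite -!EFinM -EFinD lee_fin mulrA [X in _ + X]mulrA -mulrDl ler_wpM2r//.
  have := @moll_taylor_box x (- v); rewrite nvN => /(_ v1) H.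
  have -> : e * `|dotv (moll_grad d K x) th| = `|dotv (moll_grad d K x) (- v)|.
    by rewrite dotvNr normrN dotvZr normrM (ger0_norm (ltW e0)).
  apply: (@le_trans _ _ (`|moll d K (x - v) - moll d K x| +
      `|moll d K (x - v) - moll d K x - dotv (moll_grad d K x) (- v)|)).
    rewrite -[X in `|X| <= _](subKr (moll d K (x - v) - moll d K x)).
    exact: ler_normB.
  rewrite lerD2l; apply: le_trans H _; apply: ler_wpM2r => //; apply: ler_wpM2l => //.
  by rewrite ler_sqr ?nnegrE ?nv_ge0// ltW.
have h2 : (D <= kap%:E * (I + w%:E * S0))%E.
  have h : (D <= kap%:E * \int[vol R k]_x (shift_diff K v x * (g x + w))%:E)%E.
    exact: integral_moll_shift_le.
  apply: le_trans h _; apply: lee_wpmul2l; first by rewrite lee_fin ltW.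
  rewrite (eq_integral (fun x => (shift_diff K v x * g x)%:E + w%:E * (shift_diff K v x)%:E)%E); last first.
    by move=> x _; rewrite mulrDr EFinD -EFinM (mulrC w).
  rewrite ge0_integralD//;
    try (by apply: emeasurable_funM => //; apply/measurable_EFinP);
    try (by move=> x _; rewrite -EFinM lee_fin mulr_ge0 ?shift_diff_ge0);
    try (exact: GG);
    try (by move=> x _; rewrite lee_fin mulr_ge0 ?shift_diff_ge0).
  rewrite ge0_integralZl//;
    try (by move=> x _; rewrite lee_fin shift_diff_ge0);
    try (by apply/measurable_EFinP).
have h3 : (I + gm g K <= gm g (Defs.msum K (dil e (seg th))) + w%:E * S0)%E.
  by apply: gm_msum_seg_ge => //; rewrite (ltW e0).
have T0 : (0 <= T)%E by apply: integral_ge0 => x _; rewrite lee_fin mulr_ge0.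
have I0 : (0 <= I)%E by apply: integral_ge0 => x _; rewrite lee_fin mulr_ge0 ?shift_diff_ge0.
have S00 : (0 <= S0)%E by apply: integral_ge0 => x _; rewrite lee_fin shift_diff_ge0.
have D0 : (0 <= D)%E by apply: integral_ge0 => x _; rewrite lee_fin mulr_ge0.
rewrite -/T; move: (gm g (Defs.msum _ _)) (gm_ge0 g0 K) h3 => E gmK0 h3.
have w0E : (0 <= w%:E :> \bar R)%E by rewrite lee_fin.
have wS : (w%:E * S0 <= (w * (S * e))%:E)%E by rewrite EFinM; exact: lee_wpmul2l.
have h4 : ((e * kap^-1)%:E * T <= I + (w * (S * e) + kap^-1 * taylor_const * e ^+ 2 * G)%:E)%E.
  have ik : (0 <= kap^-1%:E :> \bar R)%E by rewrite lee_fin invr_ge0 ltW.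
  rewrite mulrC EFinM -muleA; apply: le_trans (lee_wpmul2l ik h1) _.
  rewrite ge0_muleDr//; last by rewrite mule_ge0 ?gm_ge0// lee_fin mulr_ge0 ?sqr_ge0.
  rewrite EFinD addeA; apply: leeD; last first.
    by rewrite GE -!EFinM lee_fin !mulrA.
  apply: le_trans (lee_wpmul2l ik h2) _.
  by rewrite muleA -EFinM mulVf ?gt_eqF// mul1e; exact: leeD2l.
apply: le_trans (leeD2r _ h4) _.
rewrite addeAC; apply: le_trans (leeD2r _ h3) _.
rewrite -addeA; apply: leeD2l.
apply: le_trans (leeD2r _ wS) _.
rewrite -EFinD lee_fin -/Bx -/G; move: (kap^-1 * _ * _ * G) => z; lra.
Qed.

End projection_bound.

(** * Lower bound for the weighted integral of the gradient *)

Lemma measurable_layer_weight (R : realType) d (T : measurableType d)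
    (m : {sigma_finite_measure set T -> \bar R}) (w : T -> R) (f : T -> \bar R) (c : R) :
  measurable_fun setT w -> (forall x, 0 <= w x) -> measurable_fun setT f ->
  measurable_fun setT (fun s : R => \int[m]_x (\1_(superlevel f (c * s)) x * w x)%:E)%E.
Proof.
move=> mw w0 mf.
pose E := [set z : T * R | ((c * z.2)%R%:E < f z.1)%E].
have mE : measurable E by exact: measurable_subgraph.
pose G (z : T * R) : \bar R := (\1_E z * w z.1)%:E.
have mG : measurable_fun setT G.
  apply/measurable_EFinP; apply: measurable_funM; first exact: measurable_indic.
  exact: (measurableT_comp mw measurable_fst).
have G0 z : (0 <= G z)%E by rewrite lee_fin mulr_ge0.
have := measurable_fun_fubini_tonelli_G (m1 := m) G mG G0.
congr (measurable_fun _ _); apply/funext => s; apply: eq_integral => x _.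
Qed.

Section gradient_bound.
Variables (R : realType) (n : nat) (g : 'rV[R]_n -> R) (p : R).
Variables (K : set 'rV[R]_n) (M d r0 rho : R).
Hypotheses (g0 : forall x, 0 <= g x) (cg : continuous g).
Hypotheses (p0 : 0 < p) (hg : homogeneous p^-1 g) (pg : pconcave p g) (n2 : (2 <= n)%N).
Hypotheses (cptK : compact K) (KM : K `<=` box M) (M1 : 1 <= M).
Hypothesis cK : forall x y l, K x -> K y -> 0 <= l <= 1 -> K (l *: x + (1 - l) *: y).
Hypotheses (r00 : 0 < r0) (Kr : forall x, nv x <= r0 -> K x).
Hypotheses (d0 : 0 < d) (d1 : d <= 1) (rho01 : 0 < rho < 1) (drho : d <= (1 - rho) * r0).

Let r : R := n%:R + p^-1.
Let mK : measurable K. Proof. exact: compact_measurable_rV. Qed.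
Let K_lty : (vol R n K < +oo)%E. Proof. exact: vol_compact_lty. Qed.

(* [u(x) <= u(z) + e |grad u(z)| + C e^2] for [|x - z| <= e], so the [e]-enlargement
   of [{u > s}] lies in a superlevel set of the right-hand side; divide by [e]
   after integrating over [s].  The set [rho K] is where [u] is maximal. *)
Lemma moll_gradient_bound (a b : R) : gm g K = a%:E -> gm g (@ball2 R n) = b%:E ->
  0 < a -> 0 < b ->
  ((bump_mass n d * (r * (rho `^ r * a) `^ (1 - r^-1) * b `^ r^-1))%:E <=
   \int[vol R n]_x (nv (moll_grad d K x) * g x)%:E)%E.
Proof.
move=> gK gB a0 b0; have /andP[rho0 rho1] := rho01.
set kap := bump_mass n d; have kap0 : 0 < kap by exact: bump_mass_gt0.
set c0 := r * _ * _.
pose u := moll d K; pose N x := nv (moll_grad d K x).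
have u0 x : 0 <= u x by exact: moll_ge0.
have N0 x : 0 <= N x by exact: nv_ge0.
have mg : measurable_fun setT g by exact: measurable_g.
have mu : measurable_fun setT u by exact: measurable_moll.
have mN : measurable_fun setT N.
  by apply: (measurableT_comp (@measurable_nv R n)); exact: measurable_moll_grad.
pose Bx : set 'rV[R]_n := @box R n (M + 2).
have mBx : measurable Bx by exact: measurable_box.
pose C := ((2 * d + 3) ^+ 2 + 2 * d ^+ 2) * fine (vol R n K).
have C0 : 0 <= C by rewrite mulr_ge0 ?fine_ge0// addr_ge0 ?sqr_ge0// mulr_ge0 ?sqr_ge0.
have r1 : 1 < r by exact: homogeneity_gt1.
have rp : 0 < r by exact: lt_trans r1.
have q0 : 0 <= 1 - r^-1 by rewrite subr_ge0 invf_le1// ltW.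
have c00 : 0 <= c0 by rewrite /c0 !mulr_ge0 ?powR_ge0// ltW.
have gmBx : (gm g Bx < +oo)%E by exact: (gm_lty g0 cg mBx (@subset_refl _ _)).
have GE : gm g Bx = (fine (gm g Bx))%:E by rewrite fineK// ge0_fin_numE ?gm_ge0.
set G := fine _ in GE.
have G0 : 0 <= G by rewrite fine_ge0// gm_ge0.
have outer1 x : ~ box (M + 1) x -> u x = 0.
  move=> xM; apply: moll_outer => // y yd /KM Kx; apply: xM; rewrite -(subrK y x).
  exact: box_add Kx (ltW (lt_le_trans yd d1)).
have outer x : ~ Bx x -> u x = 0.
  move=> xM; apply: outer1 => x1; apply: xM => i; apply: le_trans (x1 i) _.
  by rewrite lerD2l ler1n.
(* For |y| < d the point rho z - y is a convex combination of [z] and a point of the ball of radius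
   [r0], by the choice of [d]. *)
have inner x : dil rho K x -> u x = kap.
  move=> [z Kz <-]; apply: moll_inner => // y yd.
  have -> : rho *: z - y = rho *: z + (1 - rho) *: ((1 - rho)^-1 *: - y).
    by rewrite scalerA divff ?scale1r// subr_eq0 gt_eqF.
  apply: cK => //; last by rewrite (ltW rho0) ltW.
  have rr : 0 < 1 - rho by rewrite subr_gt0.
  apply: Kr; rewrite nvZ nvN ger0_norm ?invr_ge0 ?(ltW rr)// mulrC ler_pdivrMr// mulrC.
  exact: le_trans (ltW yd) drho.
have GG := measurable_weight cg.
(* Finiteness allows this integral to be cancelled from both sides of [step]. *)
have ug_fin : (\int[vol R n]_x (u x * g x)%:E)%E \is a fin_num.
  rewrite ge0_fin_numE; last by apply: integral_ge0 => x _; rewrite lee_fin mulr_ge0.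
  apply: (@le_lt_trans _ _ (kap%:E * gm g Bx)%E); last by rewrite GE -EFinM ltry.
  rewrite /gm -ge0_integralZl//;
    try (by rewrite lee_fin ltW); try (by move=> x _; exact: gm_fun_ge0); try exact: measurable_gm_fun.
  apply: ge0_le_integral => //.
  - by move=> x _; rewrite lee_fin mulr_ge0.
  - exact: GG.
  - by apply: emeasurable_funM => //; exact: measurable_gm_fun.
  move=> x _; rewrite -EFinM lee_fin mulrA ler_wpM2r//.
  have [xM|xM] := pselect (Bx x); last by rewrite outer// mulr_ge0// ltW.
  by rewrite indicE mem_set// mulr1; exact: moll_le.
have superE (f : 'rV[R]_n -> R) t : superlevel (EFin \o f) t = [set x | t < f x].
  by apply/seteqP; split => x; rewrite /superlevel/= lte_fin.
have msuper (f : 'rV[R]_n -> R) t : measurable_fun setT f -> measurable (superlevel (EFin \o f) t).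
  move=> mf; rewrite superE (_ : mkset _ = setT `&` f @^-1` `]t, +oo[).
    by apply: mf => //; exact: measurable_itv.
  by rewrite setTI; apply/seteqP; split => x /=; rewrite in_itv/= andbT.
pose I := (\int[vol R n]_x (u x * g x)%:E)%E.
pose J := (\int[vol R n]_x (N x * g x)%:E)%E.
have J0 : (0 <= J)%E by apply: integral_ge0 => x _; rewrite lee_fin mulr_ge0.
have step e : 0 < e <= 1 -> (I + (kap * (e * c0))%:E <= I + (e%:E * J + (C * e ^+ 2 * G)%:E))%E.
  move=> /andP[e0 e1].
  (* The quadratic remainder is restricted to the box outside which [u] vanishes, so its
     [g]-integral is finite. *)
  pose h x := u x + e * N x + C * e ^+ 2 * \1_Bx x.
  have h0 x : 0 <= h x.
    apply: addr_ge0; first by apply: addr_ge0 => //; rewrite mulr_ge0// ltW.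
    by apply: mulr_ge0 => //; rewrite mulr_ge0 ?sqr_ge0.
  have mh : measurable_fun setT h.
    apply: measurable_funD; last by apply: measurable_funM => //; exact: measurable_indic.
    by apply: measurable_funD => //; exact: measurable_funM.
  have uh x y : nv y <= e -> Bx (x + y) -> u x <= h (x + y).
    move=> ye xyM; have y1 : nv (- y) <= 1 by rewrite nvN (le_trans ye).
    have := moll_taylor d0 mK K_lty (x + y) y1; rewrite addrK -/u -/C.
    rewrite /h indicE (mem_set xyM) mulr1 => H.
    have t1 : dotv (moll_grad d K (x + y)) (- y) <= e * N (x + y).
      apply: le_trans (ler_norm _) _; apply: le_trans (cauchy_schwarz _ _) _.
      by rewrite mulrC nvN ler_wpM2r// nv_ge0.
    have t2 : C * nv (- y) ^+ 2 <= C * e ^+ 2.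
      by rewrite ler_wpM2l// nvN ler_sqr ?nnegrE ?nv_ge0// ltW.
    have H2 := le_trans (ler_norm _) H.
    by move: H2 t1 t2; lra.
  have BM s : s \in `]0, 1[ ->
      (gm g (superlevel (EFin \o u) (kap * s)) + (e * c0)%:E <= gm g (superlevel (EFin \o h) (kap * s)))%E.
    rewrite in_itv/= => /andP[s0 s1].
    set A := superlevel _ _; set E := superlevel _ _.
    have mA : measurable A by exact: msuper.
    have ABx : A `<=` Bx.
      move=> x; rewrite /A superE /= => ux; apply: contrapT => /outer ux0.
      by move: ux; rewrite ux0 ltNge mulr_ge0// ltW.
    (* Every level below [kap] has a superlevel set that contains rho K. This bounds its measure
       from below independently of the level, and [c0] is formed with that bound. *)
    have KA : dil rho K `<=` A.
      by move=> x /inner ux; rewrite /A superE /= ux gtr_pMr.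
    have gA : gm g A = (fine (gm g A))%:E.
      rewrite fineK// ge0_fin_numE ?gm_ge0//; apply: le_lt_trans gmBx; exact: le_gm.
    have aA : (rho `^ r * a <= fine (gm g A)).
      rewrite -lee_fin -gA EFinM -gK -(gm_dil g0 cg hg rho0 mK).
      by apply: le_gm => //; exact: measurable_dil.
    have ra0 : 0 < rho `^ r * a by rewrite mulr_gt0 ?powR_gt0.
    have A0 : 0 < fine (gm g A) by exact: lt_le_trans aA.
    apply: le_trans (@gm_brunn_minkowski_ball _ _ g g0 cg p p0 hg pg n2 (M + 2)
      (fine (gm g A)) b e A E _ mA _ ABx _ _ gA gB A0 b0) => //.
    - rewrite gA -EFinD lee_fin lerD2l -/r /c0 ler_wpM2l ?(ltW e0)// ler_wpM2r ?powR_ge0//.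
      rewrite ler_wpM2l ?(ltW rp)// ge0_ler_powR// ?nnegrE; exact: ltW.
    - by rewrite (le_trans M1)// lerDl.
    - exact: msuper.
    - by rewrite e0.
    move=> x y; rewrite /A /E !superE /= => ux ye; apply: (lt_le_trans ux); apply: uh => //.
    have x1 : box (M + 1) x.
      apply: contrapT => /outer1 ux0; move: ux; rewrite ux0 ltNge mulr_ge0// ltW//.
    have := box_add x1 (le_trans ye e1).
    by rewrite -addrA (_ : 1 + 1 = 2).
  have lcu : (I = kap%:E * \int[@leb1 R]_(s in `]0%R, 1%R[) gm g (superlevel (EFin \o u) (kap * s)))%E.
    rewrite /gm -(@layer_cake_weight _ _ _ (vol R n) g (EFin \o u) kap)//; last by apply/measurable_EFinP.
    apply: eq_integral => x _; rewrite /= EFinM; congr (_ * _)%E.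
    by rewrite min_l// lee_fin; exact: moll_le.
  have lch : (kap%:E * \int[@leb1 R]_(s in `]0%R, 1%R[) gm g (superlevel (EFin \o h) (kap * s)) <=
      \int[vol R n]_x (h x * g x)%:E)%E.
    rewrite /gm -(@layer_cake_weight _ _ _ (vol R n) g (EFin \o h) kap)//; last by apply/measurable_EFinP.
    apply: ge0_le_integral => //.
    - by move=> x _; rewrite mule_ge0// ?lee_fin// le_min !lee_fin h0 ltW.
    - apply: emeasurable_funM; last by apply/measurable_EFinP.
      by apply: measurable_mine => //; apply/measurable_EFinP.
    - exact: GG.
    by move=> x _; rewrite EFinM lee_wpmul2r ?lee_fin// ge_min lexx.
  have hE : (\int[vol R n]_x (h x * g x)%:E = I + (e%:E * J + (C * e ^+ 2 * G)%:E))%E.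
    have Ce0 : 0 <= C * e ^+ 2 by rewrite mulr_ge0 ?sqr_ge0.
    rewrite EFinM -GE /I /J /gm.
    rewrite -(@ge0_integralZl _ _ _ (vol R n) _ measurableT (fun x => (N x * g x)%:E))//;
      try (by rewrite lee_fin ltW); try (by move=> x _; rewrite lee_fin mulr_ge0); try exact: GG.
    rewrite -(@ge0_integralZl _ _ _ (vol R n) _ measurableT (fun x => (\1_Bx x * g x)%:E))//;
      try (by move=> x _; exact: gm_fun_ge0); try exact: measurable_gm_fun.
    have mI : measurable_fun setT (fun x => (\1_Bx x * g x)%:E) by exact: measurable_gm_fun.
    have mNg := GG _ mN; have mug := GG _ mu.
    rewrite -ge0_integralD//; last first.
    - by apply: emeasurable_funM.
    - by move=> x _; rewrite mule_ge0 ?gm_fun_ge0.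
    - by apply: emeasurable_funM.
    - by move=> x _; rewrite -EFinM lee_fin !mulr_ge0// ltW.
    rewrite -ge0_integralD//; last first.
    - by apply: emeasurable_funD; apply: emeasurable_funM.
    - by move=> x _; rewrite adde_ge0// ?mule_ge0 ?gm_fun_ge0// lee_fin ?mulr_ge0// ltW.
    - by move=> x _; rewrite lee_fin mulr_ge0.
    apply: eq_integral => x _; rewrite /h -!EFinM -!EFinD; congr (_%:E); ring.
  rewrite -hE; apply: le_trans lch.
  have mEu : measurable_fun setT (EFin \o u) by apply/measurable_EFinP.
  have mEh : measurable_fun setT (EFin \o h) by apply/measurable_EFinP.
  have mlu := measurable_layer_weight (vol R n) kap mg g0 (f := EFin \o u) mEu.
  have mlh := measurable_layer_weight (vol R n) kap mg g0 (f := EFin \o h) mEh.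
  have m01 : measurable (`]0, 1[%classic : set R) by exact: measurable_itv.
  have int1 : (\int[@leb1 R]_(s in `]0%R, 1%R[) (e * c0)%:E = (e * c0)%:E)%E.
    rewrite integral_cst//; have := @leb1_itv R 0 1 false true; rewrite subr0.
    by move=> /(_ ler01); rewrite /= => ->; rewrite mule1.
  rewrite {1}lcu EFinM -int1 -ge0_muleDr; last 2 first.
  - by apply: integral_ge0 => s _; exact: gm_ge0.
  - by apply: integral_ge0 => s _; rewrite lee_fin mulr_ge0// ltW.
  apply: lee_wpmul2l; first by rewrite lee_fin ltW.
  have ec0 : 0 <= e * c0 by rewrite mulr_ge0// ltW.
  rewrite -ge0_integralD//.
  - apply: ge0_le_integral => //.
    + by move=> s _; rewrite adde_ge0// gm_ge0.
    + by apply: emeasurable_funD => //; exact: measurable_funTS.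
    + exact: measurable_funTS.
  - by move=> s _; exact: gm_ge0.
  - exact: measurable_funTS.
have [Jfin|] := boolP (J \is a fin_num); last first.
  by rewrite ge0_fin_numE// -leNgt leye_eq => /eqP; rewrite -/J => ->; rewrite leey.
rewrite -/J -(fineK Jfin) lee_fin; set j := fine J.
(* The zeroth-order terms cancel and the rest is divided by [e]; the remaining error is linear in
   [e]. *)
have key e : 0 < e <= 1 -> kap * c0 <= j + C * G * e.
  move=> e01; have := step e e01; have /andP[e0 _] := e01.
  rewrite leeD2lE// -(fineK Jfin) -/j -EFinM -EFinD lee_fin => H.
  rewrite -(ler_pM2l e0); apply: le_trans (_ : _ <= e * j + C * e ^+ 2 * G) _; last by lra.
  by rewrite mulrCA.
apply/ler_addgt0Pr => t t0.
have CG0 : 0 <= C * G by rewrite mulr_ge0.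
pose e := Num.min 1 (t / (C * G + 1)).
have CG1 : 0 < C * G + 1 by rewrite ltr_wpDl.
have e0 : 0 < e by rewrite lt_min ltr01 divr_gt0.
apply: le_trans (key e _) _; first by rewrite e0 ge_min lexx.
rewrite lerD2l; apply: (@le_trans _ _ ((C * G + 1) * e)).
  by rewrite ler_wpM2r ?(ltW e0)// lerDl.
by rewrite mulrC -ler_pdivlMr// ge_min lexx orbT.
Qed.

End gradient_bound.

(* No measurability: needed for [t |-> mixed1 g (dil t K) B]. *)
Lemma ge0_le_integral_any d (T : measurableType d) (R : realType)
    (m : {measure set T -> \bar R}) (D : set T) (f g : T -> \bar R) :
  (forall x, D x -> 0 <= f x)%E -> (forall x, D x -> f x <= g x)%E ->
  (\int[m]_(x in D) f x <= \int[m]_(x in D) g x)%E.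
Proof.
move=> f0 fg; rewrite !ge0_integralE//; last by move=> x Dx; exact: le_trans (f0 _ Dx) (fg _ Dx).
apply: le_ereal_sup => _ [h /= hf <-]; exists h => //= x.
apply: le_trans (hf x) _; rewrite !patchE; case: ifPn => // /set_mem; exact: fg.
Qed.

(** * Mixed measures and the projection *)

Section mixed.
Variables (R : realType) (n : nat) (g : 'rV[R]_n -> R) (p : R) (K : set 'rV[R]_n).
Hypotheses (g0 : forall x, 0 <= g x) (cg : continuous g).
Hypotheses (p0 : 0 < p) (hg : homogeneous p^-1 g) (n2 : (2 <= n)%N).
Hypothesis cptK : compact K.

Let r : R := n%:R + p^-1.
Let r1 : 1 < r. Proof. exact: homogeneity_gt1. Qed.

Lemma compact_dil (t : R) (A : set 'rV[R]_n) : compact A -> compact (dil t A).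
Proof.
move=> cA; apply: continuous_compact => //.
by apply: continuous_subspaceT => x; exact: scaler_continuous.
Qed.

Lemma gm_compact_fin (A : set 'rV[R]_n) : compact A -> gm g A \is a fin_num.
Proof.
move=> cA; have [M _ AM] := compact_box_sub cA.
rewrite ge0_fin_numE ?gm_ge0//; apply: (gm_lty g0 cg _ AM); exact: compact_measurable_rV.
Qed.

(** A bound on the difference quotients for all steps below one threshold [d] bounds the infimum at
    that threshold, hence the lower limit; finiteness of the measure of [A] permits the
    subtraction. *)
Lemma mixed1_ge (A : set 'rV[R]_n) (th : 'rV[R]_n) (d c : R) : compact A -> 0 < d ->
  (forall e : R, (0 < e < d)%R -> (c * e)%:E + gm g A <= gm g (Defs.msum A (dil e (seg th))))%E ->
  (c%:E <= mixed1 g A (seg th))%E.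
Proof.
move=> cA d0 H; have mA := compact_measurable_rV cA.
apply: le_trans; last by apply: ereal_sup_ubound; exists d.
apply: le_ereal_inf_tmp => _ [e /= ed <-]; have /andP[e0 _] := ed.
have mE := compact_measurable_rV (@compact_msum_seg _ _ _ e th cA).
rewrite !dmeasE// -[X in (X <= _)%E]mule1 -(divff (lt0r_neq0 e0)) EFinM muleA.
apply: lee_wpmul2r; first by rewrite lee_fin invr_ge0 ltW.
by rewrite leeBrDr ?gm_compact_fin// -EFinM; exact: H.
Qed.

Lemma mixed1_ge0 (A : set 'rV[R]_n) (th : 'rV[R]_n) : compact A -> (0 <= mixed1 g A (seg th))%E.
Proof.
move=> cA; apply: (@mixed1_ge _ _ 1) => // e _; rewrite mul0r add0e.
apply: le_gm => //; [exact: compact_measurable_rV|exact: compact_measurable_rV (@compact_msum_seg _ _ _ e th cA)|].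
move=> x Ax; have := @msum_seg_mem _ _ A e 0 x th Ax.
by rewrite normr0 ler01 mul0r scale0r addr0; apply.
Qed.

Lemma msum_dil_seg (t e : R) (th : 'rV[R]_n) : 0 < t ->
  Defs.msum (dil t K) (dil e (seg th)) = dil t (Defs.msum K (dil (e / t) (seg th))).
Proof.
move=> t0; apply/seteqP; split => x.
  move=> [_ [a Ka <-] [_ [y sy <-] <-]].
  exists (a + (e / t) *: y); last by rewrite scalerDr scalerA mulrCA divff ?mulr1// gt_eqF.
  by exists a => //; exists ((e / t) *: y) => //; exists y.
move=> [_ [a Ka [_ [y sy <-] <-]] <-].
exists (t *: a); first by exists a.
exists (e *: y); first by exists y.
by rewrite scalerDr scalerA mulrCA divff ?mulr1// gt_eqF.
Qed.

(** The sum of t K and e [-th, th] is t times the sum of K and (e/t) [-th, th]. Hence homogeneity of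
    degree [r] gives slope m t^(r-1) at t K, for steps below d t, and t^(r-1) integrates to 1/r over
    [0, 1]. *)
Lemma muproj_ge (th : 'rV[R]_n) (d m : R) : 0 < d ->
  (forall e : R, (0 < e < d)%R -> (m * e)%:E + gm g K <= gm g (Defs.msum K (dil e (seg th))))%E ->
  ((n%:R / 2 * r^-1 * m)%:E <= muproj g K th)%E.
Proof.
move=> d0 H; have r0 : 0 < r by exact: lt_trans r1.
(* The comparison of integrals below takes a nonnegative minorant; for m <= 0 nonnegativity of the
   mixed measure is enough. *)
have [m0|m0] := leP m 0.
  apply: (@le_trans _ _ 0%E).
    by rewrite lee_fin mulr_ge0_le0// mulr_ge0 ?invr_ge0 ?(ltW r0)// mulr_ge0.
  by rewrite mule_ge0// integral_ge0// => t _; apply: mixed1_ge0; exact: compact_dil.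
rewrite /muproj -mulrA EFinM; apply: lee_wpmul2l; first by rewrite lee_fin.
rewrite (_ : mkset _ = `[0, 1]%classic); last first.
  by apply/seteqP; split => x /=; rewrite in_itv.
apply: (@le_trans _ _ (\int[lebesgue_measure]_(t in `[0%R, 1%R]) (m * t `^ (r - 1))%:E)%E).
  have mP : measurable_fun (`[0, 1]%classic : set R) (fun t : R => (m * t `^ (r - 1))%:E).
    apply: measurable_funTS; apply/measurable_EFinP; apply: measurable_funM => //; exact: measurable_powR.
  rewrite integral_leb1//; last by move=> x _; rewrite lee_fin mulr_ge0 ?powR_ge0// ltW.
  under eq_integral do rewrite EFinM.
  rewrite ge0_integralZl//;
    try (by rewrite lee_fin ltW); try (by move=> x _; rewrite lee_fin powR_ge0); try exact: measurable_EpowR.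
  have e : r - 1 + 1 = r by rewrite subrK.
  by rewrite integral_powR01 ?subr_ge0 ?(ltW r1)// e -EFinM mulrC.
apply: ge0_le_integral_any => t.
  by move=> _; rewrite lee_fin mulr_ge0 ?powR_ge0// ltW.
rewrite /= in_itv/= => /andP[t0 t1].
(* At t = 0 the minorant vanishes because r > 1. *)
have [->|tn] := eqVneq t 0.
  rewrite powR0 ?mulr0; last by rewrite subr_eq0 gt_eqF.
  by apply: mixed1_ge0; exact: compact_dil.
have tp : 0 < t by rewrite lt_neqAle eq_sym tn.
apply: (@mixed1_ge _ _ (d * t)); [exact: compact_dil|by rewrite mulr_gt0|].
move=> e /andP[e0 ed].
have mK : measurable K by exact: compact_measurable_rV.
have mE := compact_measurable_rV (@compact_msum_seg _ _ _ (e / t) th cptK).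
rewrite msum_dil_seg// !(gm_dil g0 cg hg)// -/r.
have h : 0 < e / t < d by rewrite divr_gt0//= ltr_pdivrMr.
apply: le_trans (lee_wpmul2l _ (H _ h)); last by rewrite lee_fin powR_ge0.
have me0 : (0 <= (m * (e / t))%:E :> \bar R)%E by rewrite lee_fin mulr_ge0 ?divr_ge0// ltW.
rewrite (ge0_muleDr _ me0 (gm_ge0 g0 K)).
apply: leeD2r; rewrite -EFinM lee_fin.
have -> : t `^ r = t `^ (r - 1) * t by rewrite -[X in _ * X]powRr1// -powRD ?subrK// tn implybT.
by rewrite mulrCA; rewrite le_eqVlt; apply/orP; left; apply/eqP; field.
Qed.

End mixed.

Section directional_muproj.
Variables (R : realType) (n : nat) (g : 'rV[R]_n -> R) (p : R) (K : set 'rV[R]_n).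
Variables (M d w r0 : R).
Hypotheses (g0 : forall x, 0 <= g x) (cg : continuous g).
Hypotheses (p0 : 0 < p) (hg : homogeneous p^-1 g) (n2 : (2 <= n)%N).
Hypotheses (cptK : compact K) (KM : K `<=` box M).
Hypothesis cK : forall x y l, K x -> K y -> 0 <= l <= 1 -> K (l *: x + (1 - l) *: y).
Hypotheses (r00 : 0 < r0) (Kr : forall x, nv x <= r0 -> K x).
Hypotheses (d0 : 0 < d) (d1 : d <= 1) (w0 : 0 < w).
Hypothesis gw : forall x y, box (M + 1) x -> nv y <= d -> g (x + y) <= g x + w.

Let r : R := n%:R + p^-1.
Let S : R := 2 * ((1 + r0^-1) ^+ n - 1) * fine (vol R n K).

(** The error in [moll_directional_le] is 2 w S e plus a multiple [Dc] of e^2. For small [e] the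
    quadratic part is at most w e, so [muproj_ge] applies with a slope that falls short of the
    wanted one by (2 S + 1) w. *)
Lemma directional_le_muproj (th : 'rV[R]_n) : nv th <= 1 ->
  ((n%:R / 2 * r^-1 * (bump_mass n d)^-1)%:E *
     \int[vol R n]_x (`|dotv (moll_grad d K x) th| * g x)%:E <=
   muproj g K th + (n%:R / 2 * r^-1 * ((2 * S + 1) * w))%:E)%E.
Proof.
move=> th1; have mK : measurable K by exact: compact_measurable_rV.
have K_lty := vol_compact_lty cptK.
set kap := bump_mass n d; have kap0 : 0 < kap by exact: bump_mass_gt0.
set T := (\int[vol R n]_x _)%E.
have T0 : (0 <= T)%E by apply: integral_ge0 => x _; rewrite lee_fin mulr_ge0.
pose Dc := kap^-1 * (((2 * d + 3) ^+ 2 + 2 * d ^+ 2) * fine (vol R n K)) *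
   fine (gm g (@box R n (M + 2))).
have Dc0 : 0 <= Dc.
  rewrite !mulr_ge0 ?invr_ge0 ?(ltW kap0) ?fine_ge0// ?gm_ge0// addr_ge0 ?sqr_ge0//.
  by rewrite mulr_ge0 ?sqr_ge0.
have H e : 0 < e <= d -> ((e * kap^-1)%:E * T + gm g K <=
    gm g (Defs.msum K (dil e (seg th))) + (2 * w * S * e + Dc * e ^+ 2)%:E)%E.
  move=> ed; have /andP[e0 e1] := ed.
  have := @moll_directional_le R n g K M d w g0 cg cptK KM cK d0 d1 (ltW w0) gw e S th ed th1.
  rewrite -/kap -/T (_ : _ * e ^+ 2 * _ = Dc * e ^+ 2); last by rewrite /Dc; ring.
  apply; apply: (@integral_shift_diff_le R n K r0) => //.
  - by rewrite (ltW e0) (le_trans e1).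
  by rewrite nvZ ger0_norm ?(ltW e0)// ler_piMr// ltW.
have Efin e : gm g (Defs.msum K (dil e (seg th))) \is a fin_num.
  by apply: gm_compact_fin => //; exact: compact_msum_seg.
have Kfin : gm g K \is a fin_num by exact: gm_compact_fin.
(* The inequality at the single step e = d already bounds [T] by finite measures. *)
have Tfin : T \is a fin_num.
  have := H d; rewrite d0 lexx => /(_ isT).
  rewrite ge0_fin_numE// ltey; case: eqP => // ->.
  rewrite gt0_muley; last by rewrite lte_fin divr_gt0.
  by rewrite -(fineK Kfin) -(fineK (Efin d)).
set t := fine T; have TE : T = t%:E by rewrite fineK.
pose m := kap^-1 * t - 2 * w * S - w.
(* Below this threshold Dc e^2 <= w e. *)
pose d' := Num.min d (w / (Dc + 1)).
have Dc1 : 0 < Dc + 1 by rewrite ltr_wpDl.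
have d'0 : 0 < d' by rewrite lt_min d0 divr_gt0.
have mle : ((n%:R / 2 * r^-1 * m)%:E <= muproj g K th)%E.
  apply: (@muproj_ge _ _ _ _ _ g0 cg p0 hg n2 cptK _ d') => // e /andP[e0].
  rewrite lt_min => /andP[ed]; rewrite ltr_pdivlMr// => ew.
  have := H e; rewrite e0 (ltW ed) => /(_ isT).
  rewrite TE -(fineK Kfin) -(fineK (Efin e)) -EFinM -!EFinD !lee_fin.
  have : Dc * e ^+ 2 <= w * e.
    rewrite expr2 mulrA ler_pM2r// mulrC; apply: le_trans (ltW ew).
    by rewrite ler_pM2l// lerDl.
  have -> : m * e = e * kap^-1 * t - 2 * w * S * e - w * e by rewrite /m; ring.
  by lra.
apply: le_trans (leeD2r _ mle); rewrite TE -EFinM -EFinD lee_fin.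
by rewrite le_eqVlt; apply/orP; left; apply/eqP; rewrite /m; ring.
Qed.

End directional_muproj.

(** * Integration over directions *)

Section integrate_directions.
Local Open Scope ereal_scope.
Variables (R : realType) (k : nat) (g : 'rV[R]_k.+2 -> R) (L : set 'rV[R]_k.+2).
Hypotheses (g0 : forall x, (0 <= g x)%R) (cg : continuous g) (g00 : g 0%R = 0%R)
  (sL : star_body L).

(** Stated for a general field [F], later the gradient of [moll]. The section is replaced by the
    lower limit of [slabavg] before integrating: that function is measurable in the direction,
    whereas [hypmeas] depends on a chosen frame. *)
Lemma integrate_directions (F : 'rV[R]_k.+2 -> 'rV[R]_k.+2) (c e t0 : R) :
  measurable_fun setT F -> (0 <= c)%R -> (0 <= e)%R -> (0 < t0 < 1)%R ->
  (forall th, sqnorm th = 1%R ->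
    c%:E * \int[vol R k.+2]_x (`|dotv (F x) th| * g x)%:E <= hypmeas g L th + e%:E) ->
  (c * (2 / k.+1%:R * omega R k.+1))%:E * \int[vol R k.+2]_x (nv (F x) * g x)%:E <=
  (omega R k.+1)%:E * \int[vol R k.+2]_x (starint g L t0 x * (nv x)^-1)%:E +
  (e * (k.+2%:R / k.+1%:R * omega R k.+2))%:E.
Proof.
move=> mF c0 e0 t01 H.
have mB := @measurable_ball2 R k.+2.
have mg : measurable_fun setT g by exact: measurable_g.
(* One factor 1/|th| is the weight, the other normalizes [th] inside the scalar product; together
   they give the inverse of [sqnorm]. *)
pose G (z : 'rV[R]_k.+2 * 'rV[R]_k.+2) : \bar R :=
  (\1_(@ball2 R k.+2) z.1 * `|dotv (F z.2) z.1| * (sqnorm z.1)^-1 * g z.2)%:E.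
have G0 z : 0 <= G z.
  by rewrite lee_fin mulr_ge0// mulr_ge0 ?invr_ge0 ?sqnorm_ge0// mulr_ge0.
have mG : measurable_fun setT G.
  apply/measurable_EFinP; apply: measurable_funM; last exact: (measurableT_comp mg measurable_snd).
  apply: measurable_funM; last first.
    exact: (measurableT_comp (@measurable_sqnormV R k.+2) measurable_fst).
  apply: measurable_funM; first exact: (measurableT_comp (measurable_indic mB) measurable_fst).
  apply: (measurableT_comp (@normr_measurable R setT)); apply: measurable_dotv; last exact: measurable_fst.
  exact: (measurableT_comp mF measurable_snd).
have lhsE : (2 / k.+1%:R * omega R k.+1)%:E * \int[vol R k.+2]_x (nv (F x) * g x)%:E =
    \int[vol R k.+2]_th \int[vol R k.+2]_x G (th, x).
  rewrite fubini_tonelli// -ge0_integralZl//; last first.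
  - by rewrite lee_fin mulr_ge0// ltW// omega_gt0.
  - by move=> x _; rewrite lee_fin mulr_ge0 ?nv_ge0.
  - by apply/measurable_EFinP; apply: measurable_funM => //; exact: (measurableT_comp (@measurable_nv R k.+2) mF).
  apply: eq_integral => x _.
  rewrite (_ : _ * _ = (2 / k.+1%:R * omega R k.+1 * nv (F x))%:E * (g x)%:E); last first.
    by rewrite -!EFinM !mulrA.
  rewrite -integral_ball2_dotv -ge0_integralZr//; last first.
  - by rewrite lee_fin.
  - by move=> y _; rewrite lee_fin mulr_ge0 ?invr_ge0 ?sqnorm_ge0// mulr_ge0.
  - apply/measurable_EFinP; apply: measurable_funM; last exact: measurable_sqnormV.
    apply: measurable_funM; first exact: measurable_indic.
    by apply: (measurableT_comp (@normr_measurable R setT)); apply: measurable_dotv => //; exact: measurable_id.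
rewrite EFinM -muleA lhsE.
have mT := measurable_fun_fubini_tonelli_F (m2 := vol R k.+2) G mG G0.
have T0 th : 0 <= \int[vol R k.+2]_x G (th, x) by apply: integral_ge0 => x _; exact: G0.
have msl j : measurable_fun setT (slabavg g L t0 j) by exact: measurable_slabavg.
have lim0 th : 0 <= limn_einf (slabavg g L t0 ^~ th).
  by apply: limn_einf_ge => j; exact: slabavg_ge0.
have mlim : measurable_fun setT (fun th => limn_einf (slabavg g L t0 ^~ th)).
  exact: measurable_limn_einf.
have nv0E th : 0 <= (e * (nv th)^-1)%:E by rewrite lee_fin mulr_ge0 ?invr_ge0 ?nv_ge0.
have mnv : measurable_fun setT (fun th : 'rV[R]_k.+2 => (e * (nv th)^-1)%:E).
  by apply/measurable_EFinP; apply: measurable_funM => //; exact: measurable_nvV.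
rewrite -ge0_integralZl//.
apply: (@le_trans _ _ (\int[vol R k.+2]_(th in @ball2 R k.+2)
    (limn_einf (slabavg g L t0 ^~ th) + (e * (nv th)^-1)%:E))); last first.
  rewrite ge0_integralD//; try exact: measurable_funTS.
  apply: leeD; first exact: integral_slabavg_le.
  rewrite integral_setE (eq_integral (fun x => e%:E * (\1_(@ball2 R k.+2) x * (nv x)^-1)%:E)); last first.
    by move=> x _; rewrite -EFinM mulrCA.
  rewrite ge0_integralZl//; last first.
  - by move=> x _; rewrite lee_fin mulr_ge0 ?invr_ge0 ?nv_ge0.
  - by apply/measurable_EFinP; apply: measurable_funM; [exact: measurable_indic|exact: measurable_nvV].
  by rewrite integral_ball2_nvV// EFinM.
rewrite (_ : \int[_]_th _ = \int[vol R k.+2]_(th in @ball2 R k.+2) (c%:E * \int[vol R k.+2]_x G (th, x))); last first.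
  rewrite [RHS]integral_mkcond; apply: eq_integral => th _; rewrite patchE.
  case: ifPn => // thB; rewrite integral0_eq ?mule0// => x _.
  by rewrite /G indicE (negbTE thB) !mul0r.
apply: ge0_le_integral => //.
- by move=> th _; rewrite mule_ge0.
- by apply: measurable_funTS; apply: emeasurable_funM.
- by apply: measurable_funTS; apply: emeasurable_funD.
move=> th thB.
have [->|th0] := eqVneq th 0%R.
  rewrite integral0_eq ?mule0 ?adde_ge0// => x _.
  by rewrite /G /= dotvC dot0v normr0 mulr0 !mul0r.
have nth0 : (0 < nv th)%R by rewrite nv_gt0.
pose u := ((nv th)^-1 *: th)%R.
have u1 : sqnorm u = 1%R by rewrite sqnormZ exprVn -sqr_nv mulVf// sqrf_eq0 gt_eqF.
apply: le_trans (leeD2r _ (hypmeas_le_slabavg g0 cg sL t01 th0)).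
rewrite mulrC EFinM -muleDr ?fin_num_adde_defl//.
apply: le_trans (lee_wpmul2l _ (H u u1)); last by rewrite lee_fin invr_ge0 nv_ge0.
rewrite muleCA le_eqVlt; apply/orP; left; apply/eqP; congr (_ * _).
rewrite -ge0_integralZl//; last first.
- by rewrite lee_fin invr_ge0 nv_ge0.
- by move=> x _; rewrite lee_fin mulr_ge0.
- apply/measurable_EFinP; apply: measurable_funM => //.
  by apply: (measurableT_comp (@normr_measurable R setT)); apply: measurable_dotv.
apply: eq_integral => x _; rewrite /G /= -EFinM indicE (mem_set thB) mul1r; congr (_%:E).
rewrite dotvZr normrM (@ger0_norm _ (nv th)^-1) ?invr_ge0 ?nv_ge0//.
by rewrite -sqr_nv; field; rewrite gt_eqF.
Qed.

End integrate_directions.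

(** * Removal of the approximation parameters *)

Section main.
Variables (R : realType) (k : nat) (p : R) (g : 'rV[R]_k.+2 -> R).
Variables (K L : set 'rV[R]_k.+2) (eps : R).
Hypotheses (p0 : 0 < p) (g0 : forall x, 0 <= g x) (cg : continuous g).
Hypotheses (pg : pconcave p g) (hg : homogeneous p^-1 g).
Hypotheses (bK : convex_body K) (sK : origin_symmetric K) (sL : star_body L).
Hypotheses (eps0 : 0 <= eps).
Hypothesis comparison : forall th : 'rV[R]_k.+2, sqnorm th = 1 ->
  (muproj g K th <= hypmeas g L th + eps%:E)%E.

Let n2 : (2 <= k.+2)%N. Proof. by []. Qed.
Let r : R := k.+2%:R + p^-1.
Let r1 : 1 < r. Proof. exact: homogeneity_gt1. Qed.

(** Three parameters remain: [eta] absorbs the errors of the projection bound, [rho] stems from the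
    maximum set of [moll], and [t] from [starint]. The bump radius has disappeared together with its
    mass. *)
Lemma volume_comparison_approx (a b l rho t eta : R) :
  gm g K = a%:E -> gm g (@ball2 R k.+2) = b%:E -> gm g L = l%:E -> 0 < a -> 0 < b ->
  0 < rho < 1 -> 0 < t < 1 -> 0 < eta ->
  k.+2%:R / k.+1%:R * omega R k.+1 * (rho `^ r * a) `^ (1 - r^-1) * b `^ r^-1 <=
  omega R k.+1 * ((1 - r^-1)^-1 * (t^-1 `^ r * l) `^ (1 - r^-1) * b `^ r^-1) +
  (eps + eta) * (k.+2%:R / k.+1%:R * omega R k.+2).
Proof.
move=> gK gB gL a0 b0 rho01 t01 eta0.
have [cptK [_ cK]] := bK; have [r0 r00 Kr] := symmetric_body_ball bK sK.
have [M' M'0 KM'] := compact_box_sub cptK.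
pose M := M' + 1.
have KM : K `<=` box M by move=> x /KM' xM i; apply: le_trans (xM i) _; rewrite lerDl.
have M1 : 1 <= M by rewrite lerDr ltW.
have rp : 0 < r by exact: lt_trans r1.
have mK := compact_measurable_rV cptK.
pose c := k.+2%:R / 2 * r^-1 : R.
have c0 : 0 < c by rewrite mulr_gt0 ?invr_gt0// divr_gt0.
pose S := 2 * ((1 + r0^-1) ^+ k.+2 - 1) * fine (vol R k.+2 K).
have S0 : 0 <= S.
  rewrite !mulr_ge0 ?fine_ge0// subr_ge0 exprn_ege1// lerDl invr_ge0 ltW//.
have S1 : 0 < 2 * S + 1 by rewrite ltr_wpDl// mulr_ge0.
(* Chosen so that the error of [directional_le_muproj] is exactly [eta]; the radius [d] below
   depends on this [w] and on [rho]. *)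
pose w := eta / (c * (2 * S + 1)).
have w0 : 0 < w by rewrite divr_gt0// mulr_gt0.
have [d1 /andP[d10 d11] gw1] := modulus_box (M + 1) cg w0.
have /andP[rho0 rho1] := rho01.
pose d := Num.min d1 ((1 - rho) * r0).
have d0 : 0 < d by rewrite lt_min d10 mulr_gt0// subr_gt0.
have dd1 : d <= d1 by rewrite ge_min lexx.
have dle : d <= 1 by exact: le_trans d11.
have drho : d <= (1 - rho) * r0 by rewrite ge_min lexx orbT.
have gw x y : box (M + 1) x -> nv y <= d -> g (x + y) <= g x + w.
  by move=> xM yd; apply: gw1 => //; exact: le_trans dd1.
set kap := bump_mass k.+2 d; have kap0 : 0 < kap by exact: bump_mass_gt0.
have K_lty := vol_compact_lty cptK.
have dir (th : 'rV[R]_k.+2) : sqnorm th = 1 -> ((c * kap^-1)%:E *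
    \int[vol R k.+2]_x (`|dotv (moll_grad d K x) th| * g x)%:E <= hypmeas g L th + (eps + eta)%:E)%E.
  move=> th1; have nth : nv th <= 1 by rewrite le_nv// th1 expr1n.
  have := @directional_le_muproj R k.+2 g p K M d w r0 g0 cg p0 hg n2 cptK KM cK r00 Kr d0 dle w0 gw th nth.
  rewrite -/r -/c -/kap -/S => h; apply: le_trans h _.
  have -> : c * ((2 * S + 1) * w) = eta.
    by rewrite /w; field; rewrite !gt_eqF.
  by rewrite EFinD addeA; apply: leeD2r; exact: comparison.
have ck0 : 0 <= c * kap^-1 by rewrite mulr_ge0 ?invr_ge0 ?ltW.
have ee0 : 0 <= eps + eta by rewrite addr_ge0// ltW.
have := integrate_directions g0 cg (g_at0 g0 p0 hg) sL (measurable_moll_grad d0 mK K_lty) ck0 ee0 t01 dir.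
have low := moll_gradient_bound g0 cg p0 hg pg n2 cptK KM M1 cK Kr d0 dle rho01 drho gK gB a0 b0.
have w1 : 0 <= 2 / k.+1%:R * omega R k.+1 by rewrite mulr_ge0// ltW// omega_gt0.
have /andP[t0 t1] := t01.
have tV : 0 < t^-1 by rewrite invr_gt0.
have mL := compact_measurable_rV sL.1.
(* If t x is interior to [L], then [x] lies in the dilate of [L] by 1/t, to which the rearrangement
   bound applies. *)
have up : (\int[vol R k.+2]_x (starint g L t x * (nv x)^-1)%:E <=
    ((1 - r^-1)^-1 * (t^-1 `^ r * l) `^ (1 - r^-1) * b `^ r^-1)%:E)%E.
  have gD : gm g (dil t^-1 L) = (t^-1 `^ r * l)%:E by rewrite (gm_dil g0 cg hg)// gL.
  have mD := measurable_dil tV mL.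
  apply: le_trans (gm_bathtub g0 cg p0 hg n2 mD gD gB b0).
  apply: ge0_le_integral_any => x _.
    by rewrite lee_fin mulr_ge0 ?starint_ge0// invr_ge0 nv_ge0.
  rewrite lee_fin ler_wpM2r ?invr_ge0 ?nv_ge0// /starint ler_wpM2r// !indicE.
  have [iL|iL] := pselect ((L°) (t *: x)); last by rewrite (memNset iL).
  by rewrite (mem_set iL) mem_set// dilE//= invrK; exact: interior_subset iL.
move=> H; have := le_trans (lee_wpmul2l _ low) H.
rewrite lee_fin mulr_ge0// => /(_ isT) /le_trans H2.
have om : (0 <= (omega R k.+1)%:E :> \bar R)%E by rewrite lee_fin ltW// omega_gt0.
have := H2 _ (leeD2r _ (lee_wpmul2l om up)).
rewrite -!EFinM -!EFinD lee_fin => H3; apply: le_trans H3.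
(* Here [u] is [r] and [v] is the mass [kap]; both cancel, and so does the 2 of the projection
   against the 2 of the ball moment. *)
have fld (x y u v A B O : R) : 0 < y -> 0 < u -> 0 < v ->
    x / y * O * A * B = x / 2 * u^-1 * v^-1 * (2 / y * O) * (v * (u * A * B)).
  by move=> y0 u0 v0; field; rewrite !gt_eqF.
by rewrite le_eqVlt; apply/orP; left; apply/eqP; exact: fld.
Qed.

(** Take rho = t = s. Multiplied by s^(r-1), the inequality has s^(2(r-1)) on the left, while on the
    right the power of 1/s is cancelled. The exponents are r - 1 because r (1 - 1/r) = r - 1. *)
Lemma volume_comparison (a b l : R) :
  gm g K = a%:E -> gm g (@ball2 R k.+2) = b%:E -> gm g L = l%:E -> 0 < a -> 0 < b ->
  k.+2%:R / k.+1%:R * omega R k.+1 * a `^ (1 - r^-1) * b `^ r^-1 <=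
  omega R k.+1 * ((1 - r^-1)^-1 * l `^ (1 - r^-1) * b `^ r^-1) +
  eps * (k.+2%:R / k.+1%:R * omega R k.+2).
Proof.
move=> gK gB gL a0 b0.
have rp : 0 < r by exact: lt_trans r1.
have l0 : 0 <= l by rewrite -lee_fin -gL gm_ge0.
have rE : r * (1 - r^-1) = r - 1 by rewrite mulrBr mulr1 divff// gt_eqF.
have om1 : 0 < omega R k.+1 by exact: omega_gt0.
have om2 : 0 < omega R k.+2 by exact: omega_gt0.
have q0 : 0 < 1 - r^-1 by rewrite subr_gt0 invf_lt1.
set A := k.+2%:R / k.+1%:R * _ * _ * _; set B := omega R k.+1 * (_ * _ * _).
set C := k.+2%:R / k.+1%:R * omega R k.+2.
have C0 : 0 < C by rewrite mulr_gt0// divr_gt0.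
have A0 : 0 < A by rewrite !mulr_gt0 ?powR_gt0 ?invr_gt0.
have pw1 (x : R) : 1 `^ x = 1 :> R by rewrite powR1.
have main sg eta : 0 < sg < 1 -> 0 < eta -> sg * A <= B + (eps + eta) * C.
  move=> /andP[sg0 sg1] eta0.
  (* Normalized so that s^(2(r-1)) is the prescribed factor [sg]. *)
  pose s := sg `^ ((r - 1) *+ 2)^-1.
  have s0 : 0 < s by rewrite powR_gt0.
  have rr0 : 0 < (r - 1) *+ 2 by rewrite mulrn_wgt0// subr_gt0.
  have s1 : s < 1.
    rewrite -[X in _ < X](pw1 ((r - 1) *+ 2)^-1); apply: gt0_ltr_powR => //; rewrite ?nnegrE ?invr_gt0//.
    exact: ltW.
  have s01 : 0 < s < 1 by rewrite s0.
  have : s `^ (r - 1) * s `^ (r - 1) = sg.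
    rewrite -powRD; last by rewrite gt_eqF ?implybT.
    by rewrite -mulr2n /s -powRrM mulVf ?gt_eqF// powRr1// ltW.
  clearbody s => zz.
  have := volume_comparison_approx gK gB gL a0 b0 s01 s01 eta0.
  rewrite -/r !powRM ?powR_ge0 ?(ltW a0)// -!powRrM rE -/C.
  set z := s `^ (r - 1) in zz *; set z' := s^-1 `^ (r - 1) => H.
  have z0 : 0 < z by rewrite powR_gt0.
  have z1 : z <= 1.
    rewrite -[X in _ <= X](pw1 (r - 1)) ge0_ler_powR ?nnegrE ?(ltW s0) ?(ltW s1)// subr_ge0 ltW//.
  have zz' : z * z' = 1.
    by rewrite /z /z' -powRM ?invr_ge0 ?(ltW s0)// divff ?powR1// gt_eqF.
  have := ler_wpM2l (ltW z0) H.
  rewrite [X in X <= _ -> _](_ : _ = sg * A); last first.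
    rewrite -zz; have h (x u v : R) : z * (x * (z * u) * v) = z * z * (x * u * v) by ring.
    exact: h.
  rewrite [X in _ <= X -> _](_ : _ = z * z' * B + z * ((eps + eta) * C)); last first.
    have h (x u v y c : R) : z * (x * (u * (z' * v) * y) + c) = z * z' * (x * (u * v * y)) + z * c by ring.
    exact: h.
  rewrite zz' mul1r => H2; apply: le_trans H2 _; rewrite lerD2l ler_piMl//.
  by rewrite mulr_ge0 ?(ltW C0)// addr_ge0// ltW.
apply/ler_addgt0Pr => e e0.
(* This factor costs at most e / 2, since (A - e/2)(A + e/2) <= A^2; the other half of [e] pays for
   [eta]. *)
pose sg := A / (A + e / 2).
have e2 : 0 < e / 2 by rewrite divr_gt0.
have Ae : 0 < A + e / 2 by rewrite addr_gt0.
have sg01 : 0 < sg < 1 by rewrite divr_gt0//= ltr_pdivrMr// mul1r ltrDl.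
have eta0 : 0 < e / 2 / C by rewrite divr_gt0.
have := main _ _ sg01 eta0; rewrite mulrDl divfK ?gt_eqF// => H.
have : A - e / 2 <= sg * A.
  rewrite /sg mulrAC ler_pdivlMr// -subr_ge0.
  rewrite (_ : _ - _ = (e / 2) * (e / 2)); last by ring.
  by rewrite mulr_ge0// ltW.
by move: H; move: (sg * A) (eps * C) => x y; lra.
Qed.

End main.

Theorem theorem1p4 (R : realType) (n : nat) (p : R) (g : 'rV[R]_n -> R)
  (K L : set 'rV[R]_n) (eps : R) :
  (2 <= n)%N -> 0 < p ->
  (forall x, 0 <= g x) -> continuous g ->
  pconcave p g -> homogeneous p^-1 g ->
  convex_body K -> origin_symmetric K -> star_body L ->
  0 <= eps ->
  (forall th : 'rV[R]_n, sqnorm th = 1 ->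
     (muproj g K th <= hypmeas g L th + eps%:E)%E) ->
  let q := (n%:R + p^-1)^-1 in
  powR (fine (dmeas g K)) (1 - q)
    <= ((1 - n%:R^-1) / (1 - q)) * powR (fine (dmeas g L)) (1 - q)
       + omega R n / (powR (fine (dmeas g (@ball2 R n))) q * omega R n.-1) * eps.
Proof.
case: n g K L => [|[|k]] // g K L _ p0 g0 cg pg hg bK sK sL eps0 comparison; cbv zeta.
have [[cK [_ _]] [cL _]] := (bK, sL).
have mB := @measurable_ball2 R k.+2.
have mK := compact_measurable_rV cK; have mL := compact_measurable_rV cL.
rewrite !dmeasE// -[k.+2.-1]/k.+1.
have fK := gm_compact_fin g0 cg cK; have fL := gm_compact_fin g0 cg cL.
have B1 : @ball2 R k.+2 `<=` @box R k.+2 1.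
  by move=> x /ball2E x1 i; exact: le_trans (coord_nv _ _) x1.
have fB : gm g (@ball2 R k.+2) \is a fin_num.
  by rewrite ge0_fin_numE ?gm_ge0//; exact: gm_lty B1.
set r : R := k.+2%:R + p^-1.
have r1 : 1 < r by exact: homogeneity_gt1.
have rp : 0 < r by exact: lt_trans r1.
have q1 : 0 < 1 - r^-1 by rewrite subr_gt0 invf_lt1.
have om1 : 0 < omega R k.+1 by exact: omega_gt0.
have om2 : 0 < omega R k.+2 by exact: omega_gt0.
have := fineK fK; have := fineK fL; have := fineK fB.
have : 0 <= fine (gm g K) by rewrite fine_ge0// gm_ge0.
have : 0 <= fine (gm g (@ball2 R k.+2)) by rewrite fine_ge0// gm_ge0.
move: (fine (gm g K)) (fine (gm g L)) (fine (gm g (@ball2 R k.+2))) => a l b b0 a0 gB gL gK.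
have n1 : 0 <= 1 - k.+2%:R^-1 :> R by rewrite subr_ge0 invf_le1// ler1n.
(* If mu(K) = 0 the left side is 0, the exponent 1 - q being positive, and the right side is
   nonnegative. *)
have [ap|] := ltP 0 a; last first.
  move=> a0'; have -> : a = 0 by apply/eqP; rewrite eq_le a0'.
  rewrite powR0 ?gt_eqF// addr_ge0//.
    by rewrite mulr_ge0 ?powR_ge0// divr_ge0// ltW.
  by rewrite mulr_ge0// divr_ge0 ?(ltW om2)// mulr_ge0 ?powR_ge0// ltW.
(* Were mu(B) zero, all dilates of the ball would be null by homogeneity, and one of them contains
   [K]. *)
have bp : 0 < b.
  rewrite lt_neqAle b0 andbT eq_sym; apply/eqP => bE.
  have [M M0 KM] := compact_box_sub cK.
  have c0 : 0 < k.+2%:R * M by rewrite mulr_gt0.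
  have KB : K `<=` dil (k.+2%:R * M) (@ball2 R k.+2).
    move=> x /KM xM; rewrite dilE//=; apply/ball2E.
    by rewrite nvZ ger0_norm ?invr_ge0 ?(ltW c0)// mulrC ler_pdivrMr// mul1r nv_le_box.
  have := le_gm g0 cg mK (measurable_dil c0 mB) KB.
  by rewrite (gm_dil g0 cg hg)// -gK -gB bE mule0 lee_fin leNgt ap.
have := volume_comparison p0 g0 cg pg hg bK sK sL eps0 comparison (esym gK) (esym gB) (esym gL) ap bp.
rewrite -/r.
have bq : 0 < b `^ r^-1 by rewrite powR_gt0.
move: (a `^ _) (l `^ _) (b `^ _) (omega R k.+1) (omega R k.+2) bq om1 om2 => X Y bq' o1 o2 bq0 o10 o20 H.
(* The common factor n omega_(n-1) mu(B)^q / (n-1), with n = k+2; dividing by it leaves (1 - 1/n) /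
   (1 - q) in front of the term of [L]. *)
have c0 : 0 < k.+2%:R / k.+1%:R * o1 * bq' by rewrite !mulr_gt0// invr_gt0.
rewrite -(ler_pM2l c0).
rewrite (_ : _ * X = k.+2%:R / k.+1%:R * o1 * X * bq'); last by ring.
apply: le_trans H _; rewrite le_eqVlt; apply/orP; left; apply/eqP.
have nE : k.+2%:R = k.+1%:R + 1 :> R by rewrite -natr1.
move: q1; rewrite nE; move: (1 - r^-1) => q' q'0.
have m0 : 0 < k.+1%:R :> R by [].
move: m0; move: (k.+1%:R : R) => m m0.
by field; rewrite !gt_eqF// addr_gt0.
Qed.
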